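(* Fix $d>\sigma\ge2$ and let $m$ be a symbol of order $\sigma$ with associated operator $\mathcal L$ and constants $C_{\mathcal L},C_{\max}$ (see context). There is a constant $k_d>0$ depending only on $d$ such that the following holds for every collection of sectors $\Theta$ with resolution $\epsilon_\Theta\le k_d C_{\mathcal L}^{-2}$. For $\theta\in\Theta$ and $O\in O(d)$ let $$\mathscr J_\theta(O)=\Big\{j\in\{1,\dots,d\}:\ |\langle\nabla m(c_\theta),O\hat e_j\rangle|\ge d^{-1/2}|\nabla m(c_\theta)|\Big\}.$$ There exists $T_0>0$ such that for every $\mathfrak c\in[2,\infty]$ there is a constant $C$ such that for any open interval $I\subset\mathbb R$ with $|I|\le T_0$, any $\theta\in\Theta$, any $O\in O(d)$, any $j\in\mathscr J_\theta(O)$ and any $f\in L^2(\mathbb R^d)$, $$\big\|e^{-it\mathcal L}P_\theta f\big\|_{L^{(\infty,2,\mathfrak c)}_{O,j}(I)}\le C\,N_\theta^{-\frac{\sigma-1}2+(d-1)\left(\frac12-\frac1{\mathfrak c}\right)}\|P_\theta f\|_{L^2(\mathbb R^d)}.$$ Furthermore, if $\operatorname{diam}(\operatorname{spt}\hat f)\le R$, then $$\big\|e^{-it\mathcal L}P_\theta f\big\|_{L^{(\infty,2,\mathfrak c)}_{O,j}(I)}\le C\,N_\theta^{-\frac{\sigma-1}2}R^{(d-1)\left(\frac12-\frac1{\mathfrak c}\right)}\|P_\theta f\|_{L^2(\mathbb R^d)}.$$ The constant $C$ does not depend on $I,\theta,O,j,f,R$.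
   Context: **Symbols.** $\hat f$ is the Fourier transform with $f(x)=\int e^{2\pi i x\xi}\hat f(\xi)\,d\xi$. $\mathcal L f(x)=\int e^{2\pi i x\xi}m(\xi)\hat f(\xi)\,d\xi$ and $e^{it\mathcal L}f(x)=\int e^{2\pi ix\xi}e^{itm(\xi)}\hat f(\xi)\,d\xi$. The symbol $m:\mathbb R^d\to\mathbb R$ is of order $\sigma$ if it is smooth and there are $C_{\max},C_{\mathcal L}\ge1$ such that for all $|\xi|\ge C_{\max}$: $|\partial^\alpha m(\xi)|\le C_{\mathcal L}|\xi|^{\sigma-|\alpha|}$ for $|\alpha|\in\{1,2,3\}$, $|\nabla m(\xi)|\ge C_{\mathcal L}^{-1}|\xi|^{\sigma-1}$, $|\det D^2m(\xi)|^{1/d}\ge C_{\mathcal L}^{-1}|\xi|^{\sigma-2}$. **Sectors.** Fix a resolution $\epsilon_\Theta\in(0,1]$ and a finite set $\mathscr S_\Theta\subset\mathbb S^{d-1}$, $\epsilon_\Theta$-separated, whose $\epsilon_\Theta$-balls cover $\mathbb S^{d-1}$. For $N\in(1+\epsilon_\Theta)^{\mathbb N}$ ($0\in\mathbb N$) and $\hat e\in\mathscr S_\Theta$ let $\theta_{N,\hat e}=\{\xi:1\le|\xi|/N\le(1+\epsilon_\Theta)^2,\ |\xi/|\xi|-\hat e|\le2\epsilon_\Theta\}$ if $N>1$ and $\theta_{1,\hat e}=\{|\xi|\le(1+\epsilon_\Theta)^2\}$. $\Theta$ is the family of all sectors indexed by $(N,\hat e)$; for $\theta=\theta_{N,\hat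 e}$ put $N_\theta=N$, $\hat e_\theta=\hat e$, and $c_\theta=N\hat e$ if $N>1$, $c_\theta=0$ if $N=1$. **Projections.** Let $\chi\in C^\infty([0,\infty))$ be non-increasing, non-negative, $\chi=1$ on $[0,1]$, $\chi\ge\frac12$ on $[0,\sqrt{1+\epsilon_\Theta}]$, $\chi=0$ on $[1+\epsilon_\Theta,\infty)$. Put $\chi^{rad}_N(\xi)=\chi(\frac{|\xi|}{(1+\epsilon_\Theta)N})-\chi(\frac{|\xi|}{N})$ for $N>1$, $\chi^{rad}_1(\xi)=\chi(\frac{|\xi|}{1+\epsilon_\Theta})$, $\chi^{ang}_{\hat e}(\xi)=\chi(|\xi/|\xi|-\hat e|/\epsilon_\Theta)\big/\sum_{\hat e'\in\mathscr S_\Theta}\chi(|\xi/|\xi|-\hat e'|/\epsilon_\Theta)$, $\chi_\theta=\chi^{rad}_{N_\theta}\chi^{ang}_{\hat e_\theta}$ if $N_\theta>1$ and $\chi_\theta=|\mathscr S_\Theta|^{-1}\chi_1^{rad}$ if $N_\theta=1$. $P_\theta$ is the Fourier multiplier operator with multiplier $\chi_\theta$. **Directional norms.** $\hat e_1,\dots,\hat e_d$ is the standard basis and $S_j$ is the permutation matrix exchanging $\hat e_1$ and $\hat e_j$; for $O\in O(d)$, $$\|h\|_{L^{(a,b,c)}_{O,j}(I)}=\Big(\int_{\mathbb R}\Big(\int_I\Big(\int_{\mathbb R^{d-1}}|h(t,OS_j(x_1,x'))|^c\,dx'\Big)^{b/c}dt\Big)^{a/b}dx_1\Big)^{1/a},$$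 with essential suprema replacing integrals for infinite exponents. *)

(* Defs.v *)
From HB Require Import structures.
From mathcomp Require Import all_boot all_order all_algebra finmap.
From mathcomp.real_closed Require Import complex.
From mathcomp Require Import all_classical all_reals all_analysis.

Set Implicit Arguments.
Unset Strict Implicit.
Unset Printing Implicit Defensive.
Import Order.TTheory GRing.Theory Num.Theory.
Import numFieldNormedType.Exports.

Local Open Scope classical_set_scope.
Local Open Scope complex_scope.
Local Open Scope ring_scope.

Definition measure_matrix_display : measure_display -> measure_display.
Proof. exact. Qed.

Section measurable_matrix.
Context {d} {T : measurableType d}.
Variables m n : nat.

Definition mx_coord (i : 'I_m * 'I_n) (A : 'M[T]_(m, n)) : T := A i.1 i.2.

Definition mx_measurable : set (set 'M[T]_(m, n)) :=
  <<s \bigcup_i preimage_set_system setT (mx_coord i) measurable >>.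

Let mx_measurable0 : mx_measurable set0.
Proof. exact: sigma_algebra0. Qed.

Let mx_measurableC A : mx_measurable A -> mx_measurable (~` A).
Proof. exact: sigma_algebraC. Qed.

Let mx_measurable_bigcup (F : (set 'M[T]_(m, n))^nat) :
  (forall i, mx_measurable (F i)) -> mx_measurable (\bigcup_i F i).
Proof. exact: sigma_algebra_bigcup. Qed.

HB.instance Definition _ := @isMeasurable.Build (measure_matrix_display d)
  'M[T]_(m, n) mx_measurable mx_measurable0 mx_measurableC mx_measurable_bigcup.

End measurable_matrix.

Lemma measurable_mx_coord d (T : measurableType d) m n (i : 'I_m) (j : 'I_n) :
  measurable_fun [set: 'M[T]_(m, n)] (fun A => A i j).
Proof.
move=> _ Y mY; rewrite setTI; apply: sub_sigma_algebra.
by exists (i, j) => //; exists Y => //; rewrite setTI.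
Qed.

Lemma measurable_fun_mx d d' (S : measurableType d') (T : measurableType d)
    m n (f : S -> 'M[T]_(m, n)) :
  (forall i j, measurable_fun setT (fun x => f x i j)) -> measurable_fun setT f.
Proof.
move=> mf _ Y mY; rewrite setTI.
suff : @mx_measurable d T m n `<=` [set B | measurable (f @^-1` B)] by exact.
apply: smallest_sub.
  split=> /=.
  - by rewrite preimage_set0.
  - by move=> A mA; rewrite setTD preimage_setC; exact: measurableC.
  - by move=> F mF; rewrite preimage_bigcup; exact: bigcupT_measurable.
by move=> _ [[i j] _] [B mB <-] /=; rewrite setTI -[X in measurable X]setTI; exact: mf.
Qed.

Section lebesgue_cV.
Context {R : realType}.

Definition consv {n} (x : measurableTypeR R * 'cV[R]_n) : 'cV[R]_n.+1 := col_mx x.1%:M x.2.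

Lemma consv0 n (x : measurableTypeR R * 'cV[R]_n) : consv x ord0 0 = x.1.
Proof.
rewrite /consv (_ : ord0 = lshift n (0 : 'I_1)); last exact: val_inj.
by rewrite (@col_mxEu _ 1 n) mxE eqxx mulr1n.
Qed.

Lemma consvS n (x : measurableTypeR R * 'cV[R]_n) (i : 'I_n) :
  consv x (lift ord0 i) 0 = x.2 i 0.
Proof.
rewrite /consv (_ : lift ord0 i = rshift 1 i); last exact: val_inj.
by rewrite (@col_mxEd _ 1 n).
Qed.

Lemma measurable_consv n : measurable_fun setT (@consv n).
Proof.
apply: measurable_fun_mx => i j; rewrite ord1.
have [k ->|->] := unliftP ord0 i.
- rewrite (_ : (fun x => _) = (fun y : 'cV_n => y k 0) \o snd); last first.
    by apply/funext => x /=; rewrite consvS.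
  exact: (measurableT_comp (measurable_mx_coord k 0) measurable_snd).
- rewrite (_ : (fun x => _) = fst); first exact: measurable_fst.
  by apply/funext => x /=; rewrite consv0.
Qed.

Section lebesgue_cons.
Variables (n : nat) (mu : {sigma_finite_measure set 'cV[R]_n -> \bar R}).

Definition lebesgue_cons : set 'cV[R]_n.+1 -> \bar R :=
  pushforward (lebesgue_measure \x mu)%E consv.

Let cons0 : lebesgue_cons set0 = 0%E.
Proof. by rewrite /lebesgue_cons /pushforward preimage_set0 measure0. Qed.

Let cons_ge0 A : (0 <= lebesgue_cons A)%E.
Proof. by rewrite /lebesgue_cons /pushforward measure_ge0. Qed.

Let cons_sigma_additive : semi_sigma_additive lebesgue_cons.
Proof.
move=> F mF tF mUF; rewrite /lebesgue_cons /pushforward preimage_bigcup.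
have mconsv (A : set 'cV[R]_n.+1) : measurable A -> measurable (consv @^-1` A).
  by move=> mA; rewrite -[X in measurable X]setTI; exact: measurable_consv.
apply: measure_semi_sigma_additive.
- by move=> k; exact: mconsv.
- apply/trivIsetP => /= i j _ _ ij; rewrite -preimage_setI.
  by move/trivIsetP : tF => /(_ _ _ _ _ ij) ->//; rewrite preimage_set0.
- by rewrite -preimage_bigcup; exact: mconsv.
Qed.

HB.instance Definition _ := isMeasure.Build _ _ _ lebesgue_cons
  cons0 cons_ge0 cons_sigma_additive.

Let cons_sigma_finite : sigma_finite setT lebesgue_cons.
Proof.
have /sigma_finiteP[F [TF ndF Foo]] := sigma_finiteT (@lebesgue_measure R).
have /sigma_finiteP[G [TG ndG Goo]] := sigma_finiteT mu.
pose g (x : 'cV[R]_n.+1) : measurableTypeR R * 'cV[R]_n :=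
  (x ord0 0, \col_i x (lift ord0 i) 0).
have mg : measurable_fun setT g.
  apply/measurable_fun_pairP; split => /=.
    exact: measurable_mx_coord.
  apply: measurable_fun_mx => i j /=.
  rewrite (_ : (fun x => _) = fun x : 'cV[R]_n.+1 => x (lift ord0 i) 0).
    exact: measurable_mx_coord.
  by apply/funext => x; rewrite mxE.
have consvK : cancel consv g.
  move=> [a v]; rewrite /g consv0; congr pair.
  by apply/colP => i; rewrite mxE consvS.
exists (fun k => g @^-1` (F k `*` G k)).
  rewrite -preimage_bigcup; apply/esym; rewrite -subTset => x _ /=.
  have : setT (g x).1 by []. rewrite TF => -[i _ Fi].
  have : setT (g x).2 by []. rewrite TG => -[j _ Gj].
  exists (maxn i j) => //; split.
  - by move: Fi; exact/subsetPset/ndF/leq_maxl.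
  - by move: Gj; exact/subsetPset/ndG/leq_maxr.
move=> k; have [? ?] := Foo k; have [? ?] := Goo k; split.
  by rewrite -[X in measurable X]setTI; apply: mg => //; exact: measurableX.
rewrite /lebesgue_cons /pushforward -comp_preimage.
rewrite (_ : g \o consv = id); last exact/funext.
rewrite preimage_id product_measure1E//.
by rewrite lte_mul_pinfty// ge0_fin_numE.
Qed.

HB.instance Definition _ := @Measure_isSigmaFinite.Build _ _ _
  lebesgue_cons cons_sigma_finite.
End lebesgue_cons.

Fixpoint lebesgue_cV n : {sigma_finite_measure set 'cV[R]_n -> \bar R} :=
  match n with
  | 0%N => dirac (0 : 'cV[R]_0)
  | n'.+1 => lebesgue_cons (lebesgue_cV n')
  end.

End lebesgue_cV.
Arguments lebesgue_cV {R n}.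

Section euclidean.
Context {R : realType} {d : nat}.
Implicit Types x y : 'cV[R]_d.

(* The library norm on matrices is the sup norm. *)
Definition dotv x y : R := \sum_i x i 0 * y i 0.

Definition enorm x : R := Num.sqrt (dotv x x).

Definition ediam (A : set 'cV[R]_d) : \bar R :=
  maxe 0%E (ereal_sup [set (enorm (p.1 - p.2))%:E | p in A `*` A]).

Definition orthogonal_mx (O : 'M[R]_d) : Prop := O^T *m O = 1%:M.

End euclidean.

Section symbols.
Context {R : realType} {d : nat}.
Implicit Types (f m : 'cV[R]_d -> R) (x xi : 'cV[R]_d).

Definition partial (i : 'I_d) f : 'cV[R]_d -> R :=
  fun x => 'D_(delta_mx i 0) f x.

Definition partials (s : seq 'I_d) f : 'cV[R]_d -> R := foldr partial f s.

Definition mi_order (alpha : {ffun 'I_d -> nat}) : nat := \sum_i alpha i.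

Definition mi_partial (alpha : {ffun 'I_d -> nat}) f : 'cV[R]_d -> R :=
  partials (flatten [seq nseq (alpha i) i | i <- enum 'I_d]) f.

Definition smooth f : Prop := forall s : seq 'I_d,
  (forall i x, derivable (partials s f) x (delta_mx i 0)) /\
  continuous (partials s f).

Definition grad f x : 'cV[R]_d := \col_i partial i f x.

Definition hessian f x : 'M[R]_d := \matrix_(i, j) partials [:: i; j] f x.

Record symbol_of_order (sigma C_L C_max : R) m : Prop := SymbolOfOrder {
  symbol_smooth : smooth m ;
  symbol_C_L : 1 <= C_L ;
  symbol_C_max : 1 <= C_max ;
  symbol_upper : forall (alpha : {ffun 'I_d -> nat}) xi,
    (1 <= mi_order alpha <= 3)%N -> C_max <= enorm xi ->
    `|mi_partial alpha m xi| <= C_L * enorm xi `^ (sigma - (mi_order alpha)%:R) ;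
  symbol_grad : forall xi, C_max <= enorm xi ->
    C_L^-1 * enorm xi `^ (sigma - 1) <= enorm (grad m xi) ;
  symbol_hessian : forall xi, C_max <= enorm xi ->
    C_L^-1 * enorm xi `^ (sigma - 2) <= `|\det (hessian m xi)| `^ d%:R^-1
}.

End symbols.

Section complex_valued.
Context {disp} {T : measurableType disp} {R : realType}.
Variable mu : {measure set T -> \bar R}.
Implicit Types f : T -> R[i].

Definition cintegral (D : set T) f : R[i] :=
  (\int[mu]_(x in D) complex.Re (f x)) +i* (\int[mu]_(x in D) complex.Im (f x)).

Definition cLnorm (p : \bar R) f : \bar R := Lnorm mu p (fun x => (Normc.normc (f x))%:E).

Definition cmeasurable f : Prop :=
  measurable_fun setT (fun x => complex.Re (f x)) /\
  measurable_fun setT (fun x => complex.Im (f x)).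

Definition L2 f : Prop := cmeasurable f /\ (cLnorm 2%:E f < +oo)%E.

End complex_valued.

Section fourier.
Context {R : realType} {d : nat}.
Notation leb := (@lebesgue_cV R d).
Implicit Types (f g : 'cV[R]_d -> R[i]) (x xi : 'cV[R]_d).

(* cis t = exp(i t) *)
Definition cis (t : R) : R[i] := cos t +i* sin t.

Definition fourier_trunc (k : nat) f xi : R[i] :=
  cintegral leb [set x | enorm x <= k%:R]
    (fun x => cis (- (2 * pi * dotv x xi)) * f x).

(* Plancherel extension to L^2: the transform is the L^2-limit of the
   transforms of the truncations of f to the balls |x| <= k. *)
Definition is_fourier f g : Prop :=
  L2 leb g /\
  cLnorm leb 2%:E (fun xi => fourier_trunc k f xi - g xi) @[k --> \oo] --> 0%E.

(* A representative of the transform, which is unique up to null sets; the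
   default value is used for no f in L^2. *)
Definition fourier f : 'cV[R]_d -> R[i] := xget (cst 0) [set g | is_fourier f g].

Definition fourier_multiplier (a : 'cV[R]_d -> R[i]) f x : R[i] :=
  cintegral leb setT (fun xi => cis (2 * pi * dotv x xi) * (a xi * fourier f xi)).

(* exp(i t L) *)
Definition propagator (m : 'cV[R]_d -> R) (t : R) f : 'cV[R]_d -> R[i] :=
  fourier_multiplier (fun xi => cis (t * m xi)) f.

(* Support of g as an almost-everywhere class, i.e. as a distribution. *)
Definition ess_support g : set 'cV[R]_d :=
  [set x | forall U, nbhs x U -> ~ {ae leb, forall y, U y -> g y = 0}].

End fourier.

Section sectors.
Context {R : realType} {d : nat}.
Implicit Types (eps : R) (chi : R -> R) (xi e : 'cV[R]_d).

(* Both conditions are taken non-strict, hence in their weakest form. *)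
Record direction_net eps (S : {fset 'cV[R]_d}) : Prop := DirectionNet {
  net_sphere : forall e, e \in S -> enorm e = 1 ;
  net_separated : forall e e', e \in S -> e' \in S -> e != e' ->
    eps <= enorm (e - e') ;
  net_cover : forall xi, enorm xi = 1 -> exists2 e, e \in S & enorm (xi - e) <= eps
}.

(* A sector is given by its index (N, e), through which alone it enters N_theta,
   c_theta and chi_theta. *)
Record sector := Sector { sector_N : R ; sector_e : 'cV[R]_d }.

Definition sector_family eps (S : {fset 'cV[R]_d}) : set sector :=
  [set th | (exists k : nat, sector_N th = (1 + eps) ^+ k) /\ sector_e th \in S].

Definition sector_center (th : sector) : 'cV[R]_d :=
  if 1 < sector_N th then sector_N th *: sector_e th else 0.

(* Only the values of chi on [0, +oo[ matter.  Smoothness is required on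
   ]0, +oo[; one-sided smoothness at 0 follows from cutoff_one. *)
Record cutoff eps chi : Prop := Cutoff {
  cutoff_smooth : forall (k : nat) (r : R), 0 < r -> derivable (derive1n k chi) r 1 ;
  cutoff_noninc : forall r s : R, 0 <= r -> r <= s -> chi s <= chi r ;
  cutoff_ge0 : forall r : R, 0 <= r -> 0 <= chi r ;
  cutoff_one : forall r : R, 0 <= r <= 1 -> chi r = 1 ;
  cutoff_half : forall r : R, 0 <= r <= Num.sqrt (1 + eps) -> 2^-1 <= chi r ;
  cutoff_zero : forall r : R, 1 + eps <= r -> chi r = 0
}.

Definition chi_rad eps chi (N : R) xi : R :=
  if 1 < N then chi (enorm xi / ((1 + eps) * N)) - chi (enorm xi / N)
  else chi (enorm xi / (1 + eps)).

Definition chi_dir eps chi e xi : R :=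
  chi (enorm ((enorm xi)^-1 *: xi - e) / eps).

Definition chi_ang eps (S : {fset 'cV[R]_d}) chi e xi : R :=
  chi_dir eps chi e xi / \sum_(e' <- S) chi_dir eps chi e' xi.

Definition chi_sector eps (S : {fset 'cV[R]_d}) chi (th : sector) xi : R :=
  if 1 < sector_N th
  then chi_rad eps chi (sector_N th) xi * chi_ang eps S chi (sector_e th) xi
  else (#|` S|)%:R^-1 * chi_rad eps chi (sector_N th) xi.

Definition sector_proj eps (S : {fset 'cV[R]_d}) chi (th : sector) :
    ('cV[R]_d -> R[i]) -> 'cV[R]_d -> R[i] :=
  fourier_multiplier (fun xi => (chi_sector eps S chi th xi)%:C).

Definition good_directions (m : 'cV[R]_d -> R) (th : sector) (O : 'M[R]_d) :
    set 'I_d :=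
  let v := grad m (sector_center th) in
  [set j | (Num.sqrt d%:R)^-1 * enorm v <= `|dotv v (O *m delta_mx j 0)|].

End sectors.
Arguments sector : clear implicits.

(* The norm L^{(a,b,c)}_{O,j}(I) on R^{n+1}, with tperm_mx ord0 j playing the
   role of S_j. *)
Definition dir_norm {R : realType} {n : nat} (a b c : \bar R)
    (O : 'M[R]_n.+1) (j : 'I_n.+1) (I : set R) (h : R -> 'cV[R]_n.+1 -> R[i]) :
    \bar R :=
  Lnorm lebesgue_measure a (fun x1 =>
    Lnorm lebesgue_measure b ((fun t =>
      cLnorm lebesgue_cV c (fun x' =>
        h t (O *m tperm_mx ord0 j *m consv (x1, x')))) \_ I)).

(* Main.v *)
(** Freeze the coordinate [x1] and let [A = O S_j].  On a narrow sector of
    frequency [N] the map [xi |-> (- m xi / (2 pi), xi')], with [xi'] the last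
    coordinates of [A^T xi], stretches distances: the component of the gradient
    of [m] along [O e_j] is comparable with [|grad m|], hence at least of size
    [N^(sigma - 1)], and by the mean value theorem it varies by a small fraction
    of that over the sector.  In these frequency variables the evolution, as a
    function of [(t, x')], is an inverse Fourier transform, so Plancherel gives
    the case [c = 2] with gain [N^(-(sigma - 1) / 2)].  Instead of changing
    variables, the Plancherel inequality is obtained for every expanding phase by
    inserting a Gaussian weight in [(t, x')], whose Fourier transform is explicit,
    and applying Schur's test to the resulting kernel; constants are not sharp.
    For bounded [N] one uses Bernstein's inequality in [x1] and [|I| <= 1].
    Since the frequencies lie in a ball of radius [rho] ([rho = 5 N], or [rho = R]),
    Bernstein's inequality in [x'] bounds the sup norm at each time by the same
    [L^2] quantity, and interpolation gives all [c >= 2]. *)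

From HB Require Import structures.
Require Import Defs.
From mathcomp Require Import all_boot all_order all_algebra finmap.
From mathcomp.real_closed Require Import complex.
From mathcomp Require Import all_classical all_reals all_analysis.
From mathcomp Require Import measurable_realfun ring lra.

Set Implicit Arguments.
Unset Strict Implicit.
Unset Printing Implicit Defensive.
Import Order.TTheory GRing.Theory Num.Theory.
Import numFieldNormedType.Exports.

Local Open Scope classical_set_scope.
Local Open Scope ring_scope.
Local Open Scope complex_scope.

(** The evolution of [P_theta f] is built from [fourier] of [P_theta f], a chosen representative of
    an L^2 limit, whereas [P_theta f] itself is an explicit integral. Fourier inversion is bypassed:
    it is enough that this representative vanishes a.e. off every ball that carries [chi_theta]
    times the transform of [f], and that its L^2 norm is at most twice that of [P_theta f]. If no
    transform exists the representative is zero and both facts are trivial. Oscillating integrals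
    are taken of real functions against cosines, the sine being a cosine with phase shifted by
    [pi / 2]; complex functions are split into two parts at the price of a factor 2. Bernstein's
    inequality bounds a sup norm by the L^2 norm of a different function, whose frequency side
    carries an inverse Gaussian. The L^2 estimate therefore has to be available for every integrable
    function supported in the sector, not only for the transform at hand. In [k_d C_L^-2], one [C_L]
    comes from the upper bound of the Hessian and one from the lower bound of the gradient: their
    ratio limits how far the gradient can turn on the sector. *)

Local Notation measT f := (measurable_fun setT f).
Local Notation intT mu f := (mu.-integrable setT (EFin \o f)).

(** * Integration *)

Section integration_tools.
Context d (T : measurableType d) (R : realType) (mu : {measure set T -> \bar R}).

Import HBNNSimple.

(** Monotonicity without measurability: the integral of a nonnegative function is a supremum over
    simple functions below it. It is applied to inner norms whose measurability in the outer
    variable is never established. *)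
Lemma ge0_le_integralW (D : set T) (f g : T -> \bar R) :
  (forall x, D x -> (0 <= f x)%E) -> (forall x, D x -> (f x <= g x)%E) ->
  (\int[mu]_(x in D) f x <= \int[mu]_(x in D) g x)%E.
Proof.
move=> f0 fg; rewrite integral_mkcond [leRHS]integral_mkcond.
have f0' x : (0 <= (f \_ D) x)%E.
  by rewrite patchE; case: ifPn => // /set_mem; exact: f0.
have fg' x : ((f \_ D) x <= (g \_ D) x)%E.
  by rewrite !patchE; case: ifPn => // /set_mem; exact: fg.
have g0' x : (0 <= (g \_ D) x)%E by exact: le_trans (f0' x) (fg' x).
rewrite !ge0_integralTE//; apply: ereal_sup_le => _ [h hf <-].
by exists h => // x; exact: le_trans (hf x) (fg' x).
Qed.

Lemma integrable_bounded_mul (h g : T -> R) (M : R) :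
  measT h -> (forall x, `|h x| <= M) ->
  intT mu g ->
  intT mu (fun x => h x * g x).
Proof.
move=> mh hM ig.
have -> : EFin \o (fun x => h x * g x) = ((EFin \o h) \* (EFin \o g))%E by [].
apply: integrableMr => //; exists M; split; first exact: num_real.
by move=> N MN x _ /=; exact: le_trans (hM x) (ltW MN).
Qed.

Lemma EFin_Rintegral (g : T -> R) : intT mu g ->
  ((\int[mu]_x g x)%:E = \int[mu]_x (g x)%:E)%E.
Proof. by move=> ig; rewrite /Rintegral fineK//; exact: integrable_fin_num. Qed.

Lemma le_norm_Rintegral_fin (f : T -> R) :
  intT mu f ->
  (`|\int[mu]_x f x|%:E <= \int[mu]_x `|f x|%:E)%E.
Proof.
move=> fi; rewrite -abse_EFin EFin_Rintegral//.
by apply: le_trans (le_abse_integral _ _ _) _ => //; exact: measurable_int fi.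
Qed.

Lemma measurable_patch (A : set T) (f : T -> \bar R) :
  measurable A -> measT f -> measT (f \_ A).
Proof. move=> mA mf; by apply/(measurable_restrictT _ mA); exact: measurable_funTS. Qed.

Lemma integrable_scale (k : R) (f : T -> R) :
  intT mu f ->
  intT mu (fun x => k * f x).
Proof. exact: (integrableZl measurableT k). Qed.

Lemma integrable_measurable (f : T -> R) :
  intT mu f -> measT f.
Proof. by move/measurable_int/measurable_EFinP. Qed.

Lemma integrable_le (f g : T -> R) : measT f ->
  (forall x, `|f x| <= g x) -> (\int[mu]_x (g x)%:E < +oo)%E ->
  intT mu f.
Proof.
move=> mf fg goo; apply/integrableP; split; first exact/measurable_EFinP.
apply: le_lt_trans goo; apply: ge0_le_integralW => //= x _.
by rewrite lee_fin.
Qed.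

(** Cauchy-Schwarz with both sides squared, so that possibly infinite integrals are multiplied and
    no root is taken. *)
Lemma integral_mul_sqr_le (f g : T -> R) :
  measT f -> measT g ->
  (\int[mu]_x `|f x * g x|%:E * \int[mu]_x `|f x * g x|%:E <=
   \int[mu]_x ((f x) ^+ 2)%:E * \int[mu]_x ((g x) ^+ 2)%:E)%E.
Proof.
move=> mf mg.
have h2 (h : T -> R) : (\int[mu]_x ((h x) ^+ 2)%:E = Lnorm mu 2%:E (EFin \o h) * Lnorm mu 2%:E (EFin \o h))%E.
  have := poweR_Lnorm mu (EFin \o h) (_ : 2 != 0 :> R).
  move=> /(_ (lt0r_neq0 (ltr0n _ 2))) => E.
  have -> : (Lnorm mu 2%:E (EFin \o h) * Lnorm mu 2%:E (EFin \o h) = (Lnorm mu 2%:E (EFin \o h)) `^ 2)%E.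
    have := Lnorm_ge0 mu 2%:E (EFin \o h).
    case: (Lnorm mu 2%:E (EFin \o h)) => [r||] //; last by rewrite poweRyr// mulyy.
    by rewrite lee_fin poweR_EFin -EFinM => r0; rewrite powR_mulrn// expr2.
  rewrite E; apply: eq_integral => x _ /=.
  by rewrite powR_mulrn// real_normK// num_real.
have := @hoelder _ _ _ mu f g 2 2 mf mg.
rewrite Lnorm1 => H.
have {H}H : (\int[mu]_x `|f x * g x|%:E <= Lnorm mu 2%:E (EFin \o f) * Lnorm mu 2%:E (EFin \o g))%E.
  by apply: H => //; lra.
rewrite !h2 muleACA; by apply: lee_pmul => //; exact: integral_ge0.
Qed.

End integration_tools.

Section fubini_tools.
Context d1 d2 (T1 : measurableType d1) (T2 : measurableType d2) (R : realType).
Variable m1 : {sigma_finite_measure set T1 -> \bar R}.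
Variable m2 : {sigma_finite_measure set T2 -> \bar R}.

(** A bounded kernel times two integrable densities is integrable on the product. In this form
    Gaussian weights are exchanged with oscillating factors. *)
Lemma Rintegral_swap (p : T1 -> R) (q : T2 -> R) (K : T1 * T2 -> R) (M : R) :
  intT m1 p -> intT m2 q ->
  measT K -> (forall z, `|K z| <= M) ->
  \int[m1]_x (p x * \int[m2]_y (K (x, y) * q y)) =
  \int[m2]_y (q y * \int[m1]_x (K (x, y) * p x)).
Proof.
move=> ip iq mK K1.
have mp := integrable_measurable ip; have mq := integrable_measurable iq.
pose F (z : T1 * T2) : R := p z.1 * (K z * q z.2).
have mF : measT F.
  apply: measurable_funM.
    exact: measurableT_comp mp _.
  by apply: measurable_funM => //; exact: measurableT_comp mq _.
have iK x : intT m2 (fun y => K (x, y) * q y).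
  by apply: integrable_bounded_mul => //; exact: measurableT_comp mK _.
have iK' y : intT m1 (fun x => K (x, y) * p x).
  by apply: integrable_bounded_mul => //; exact: measurableT_comp mK _.
have iF : intT (m1 \x m2)%E F.
  apply/integrable12ltyP; first exact/measurable_EFinP.
  have M0 : 0 <= M by apply: le_trans (normr_ge0 (K (point, point))) _.
  have [J0 J] : (0 <= \int[m2]_y `|q y|%:E /\ \int[m2]_y `|q y|%:E < +oo)%E.
    by split; [exact: integral_ge0|have /integrableP[] := iq].
  have : (\int[m1]_x (`|p x|%:E * (M%:E * \int[m2]_y `|q y|%:E)) < +oo)%E.
    rewrite ge0_integralZr//; first last.
    - by rewrite mule_ge0.
    - by apply/measurable_EFinP; exact: measurableT_comp mp.
    rewrite lte_mul_pinfty ?integral_ge0//.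
      have /integrableP[_ h] := ip.
      by rewrite ge0_fin_numE ?integral_ge0.
    by rewrite lte_mul_pinfty.
  apply: le_lt_trans; apply: ge0_le_integralW => x _.
    by apply: integral_ge0.
  rewrite -ge0_integralZl//; last first.
  - by apply/measurable_EFinP; exact: measurableT_comp mq.
  rewrite -ge0_integralZl//; first last.
  - by move=> y _; rewrite mule_ge0.
  - apply/measurable_EFinP; apply: measurable_funM => //.
    exact: measurableT_comp mq.
  apply: ge0_le_integralW => y _ //=.
  by rewrite lee_fin /F/= !normrM ler_wpM2l// ler_wpM2r.
have L : (\int[m1]_x \int[m2]_y (EFin \o F) (x, y) =
  \int[m1]_x (p x * \int[m2]_y (K (x, y) * q y))%:E)%E.
  apply: eq_integral => x _; rewrite EFinM EFin_Rintegral; [|exact: iK].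
  by rewrite -integralZl//; exact: iK.
have L' : (\int[m2]_y \int[m1]_x (EFin \o F) (x, y) =
  \int[m2]_y (q y * \int[m1]_x (K (x, y) * p x))%:E)%E.
  apply: eq_integral => y _; rewrite EFinM EFin_Rintegral; [|exact: iK'].
  rewrite -integralZl//; last exact: iK'.
  by apply: eq_integral => x _; rewrite -EFinM /F/=; congr EFin; ring.
by rewrite /Rintegral -L -L' (Fubini iF).
Qed.

(** Integrability of the sections plays no part in the argument: the extended integral is a
    difference of two Tonelli integrals, and [fine] preserves measurability. *)
Lemma measurable_Rintegral_param (F : T1 * T2 -> R) :
  measT F -> measT (fun x => \int[m2]_y F (x, y)).
Proof.
move=> mF; apply/measurable_EFinP.
have mE : measT (fun x => \int[m2]_y (F (x, y))%:E)%E.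
  have -> : (fun x => \int[m2]_y (F (x, y))%:E)%E =
    (fun x => \int[m2]_y ((EFin \o F)^\+ (x, y)) - \int[m2]_y ((EFin \o F)^\- (x, y)))%E.
    apply/funext => x; rewrite integralE; congr (_ - _)%E.
    - by apply: eq_integral => y _; rewrite !funeposE.
    - by apply: eq_integral => y _; rewrite !funenegE.
  apply: emeasurable_funB.
    apply: (measurable_fun_fubini_tonelli_F (EFin \o F)^\+%E) => //.
    by apply: measurable_funepos; exact/measurable_EFinP.
  apply: (measurable_fun_fubini_tonelli_F (EFin \o F)^\-%E) => //.
  by apply: measurable_funeneg; exact/measurable_EFinP.
exact/measurable_EFinP/measurableT_comp.
Qed.

End fubini_tools.

(** * Gaussians and their Fourier transforms *)

Section gauss1.
Context (R : realType).
Local Notation mu := (@lebesgue_measure R).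
Implicit Types (F f : R -> R) (b c k u x y : R).

(** The fundamental theorem of calculus on growing symmetric intervals, then dominated convergence.
    It serves as integration by parts on the line. *)
Lemma integral_derivative_eq0 (F f : R -> R) :
  (forall y : R, is_derive y 1 F (f y)) -> continuous f ->
  intT mu f ->
  F n.+1%:R @[n --> \oo] --> (0 : R) -> F (- n.+1%:R) @[n --> \oo] --> (0 : R) ->
  \int[mu]_y f y = 0.
Proof.
move=> dF cf intf Fp Fm.
pose A n : set R := `[- n.+1%:R, n.+1%:R]%classic.
have mf := measurable_int mu intf.
have AE n : (\int[mu]_(y in A n) (f y)%:E = (F n.+1%:R)%:E - (F (- n.+1%:R))%:E)%E.
  apply: continuous_FTC2.
  - by rewrite -subr_gt0 opprK addr_gt0.
  - exact: continuous_subspaceT.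
  - split=> [y _||].
    + by have [] := dF y.
    + apply: cvg_at_right_filter; apply: differentiable_continuous.
      by apply/derivable1_diffP; have [] := dF (- n.+1%:R).
    + apply: cvg_at_left_filter; apply: differentiable_continuous.
      by apply/derivable1_diffP; have [] := dF n.+1%:R.
  - by move=> y _; rewrite derive1E; have [_ ->] := dF y.
have hm n : measurable_fun [set: measurableTypeR R] ((EFin \o f) \_ (A n)).
  by apply: (@measurable_patch _ (measurableTypeR R)) => //; exact: measurable_itv.
have hc : {ae mu, forall y, setT y -> ((EFin \o f) \_ (A n)) y @[n --> \oo] --> (EFin \o f) y}.
  apply: aeW => y _; apply: cvg_near_cst; near=> n.
  rewrite patchE mem_set// /A /= in_itv/= -ler_norml.
  near: n; exists (Num.truncn `|y|).+1 => // n /= yn.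
  by apply: le_trans (ltW (truncnS_gt _)) _; rewrite ler_nat ltnW.
have hd : {ae mu, forall y n, setT y -> (`|((EFin \o f) \_ (A n)) y| <= (abse \o (EFin \o f)) y)%E}.
  apply: aeW => y n _ /=; rewrite patchE; case: ifPn => //= _.
  by rewrite normr0 lee_fin.
have [_ _ ] := dominated_convergence measurableT hm mf hc (integrable_abse intf) hd.
have : [sequence (\int[mu]_x ((EFin \o f) \_ (A n)) x)%E]_n @ \oo --> (0:R)%:E.
  have -> : [sequence (\int[mu]_x ((EFin \o f) \_ (A n)) x)%E]_n =
     (fun n => (F n.+1%:R - F (- n.+1%:R))%:E).
    by apply/funext => n /=; rewrite -integral_mkcond AE EFinB.
  apply: cvg_EFin; first exact: nearW.
  have -> : (0 : R) = 0 - 0 by rewrite subrr.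
  exact: cvgB.
move=> h1 h2; rewrite /Rintegral.
by rewrite -(cvg_lim (@ereal_hausdorff R) h2) (cvg_lim (@ereal_hausdorff R) h1).
Unshelve. all: by end_near. Qed.

Lemma is_derive_quad (k x y : R) :
  is_derive y 1 (fun y => k * (y - x) ^+ 2) (2 * k * (y - x)).
Proof.
have -> : (fun y => k * (y - x) ^+ 2) = k *: ((id - cst x) ^+ 2) by apply/funext.
apply: is_derive_eq; rewrite /GRing.scale/= !fctE; ring.
Qed.

Lemma is_derive_aff (k c y : R) : is_derive y 1 (fun y => k * y + c) k.
Proof.
have -> : (fun y => k * y + c) = k *: id + cst c by apply/funext.
by apply: is_derive_eq; rewrite /GRing.scale/= addr0 mulr1.
Qed.

Definition gauss1 (b u : R) : R := expR (- (pi * b) * u ^+ 2).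

Lemma gauss1_ge0 b u : 0 <= gauss1 b u. Proof. exact: expR_ge0. Qed.

Lemma measurable_gauss1 b : measT (gauss1 b).
Proof.
apply: measurableT_comp; first exact: measurable_expR.
apply: measurable_funM => //; exact: measurable_funX.
Qed.

Lemma is_derive_gauss1 b x y :
  is_derive y 1 (fun y => gauss1 b (y - x)) (- (2 * pi * b) * (y - x) * gauss1 b (y - x)).
Proof.
have dq := is_derive_quad (- (pi * b)) x y.
have h := @is_derive1_comp _ (@expR R) (fun y => - (pi * b) * (y - x) ^+ 2) y _ _ (is_derive_expR _) dq. apply: is_derive_eq; rewrite /GRing.scale/= /gauss1; ring.
Qed.

Lemma normal_fun_gauss1 b x y : 0 < b ->
  gauss1 b (y - x) = normal_fun x (Num.sqrt (2 * pi * b))^-1 y.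
Proof.
move=> b0; rewrite /gauss1 /normal_fun; congr expR.
have p0 : 0 < 2 * pi * b by rewrite !mulr_gt0// pi_gt0.
rewrite exprVn sqr_sqrtr ?ltW//.
have pi0 : (pi : R) != 0 by rewrite gt_eqF// pi_gt0.
have bn : b != 0 by rewrite gt_eqF.
clear -bn pi0; move: (pi : R) pi0 => q q0; field; by rewrite ?bn ?q0.
Qed.

Lemma integral_gauss1 b x : 0 < b ->
  (\int[mu]_y (gauss1 b (y - x))%:E = ((Num.sqrt b)^-1)%:E)%E.
Proof.
move=> b0.
have p0 : 0 < 2 * pi * b by rewrite !mulr_gt0// pi_gt0.
set s : R := (Num.sqrt (2 * pi * b))^-1.
have s0 : s != 0 by rewrite invr_eq0 sqrtr_eq0 -ltNge.
have := integral_normal_pdf x s; rewrite normal_pdfE//.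
under eq_integral do rewrite EFinM.
rewrite ge0_integralZl//; first last.
- by rewrite lee_fin ltW// normal_peak_gt0.
- by move=> y _; rewrite lee_fin normal_fun_ge0.
- by apply/measurable_EFinP; exact: measurable_normal_fun.
move=> h.
have -> : (\int[mu]_y (gauss1 b (y - x))%:E = \int[mu]_y (normal_fun x s y)%:E)%E.
  by apply: eq_integral => y _; rewrite normal_fun_gauss1.
have pk : normal_peak s = Num.sqrt b.
  rewrite /normal_peak /s exprVn sqr_sqrtr ?ltW//.
  have -> : (2 * pi * b)^-1 * pi *+ 2 = b^-1.
    have pi0 : (pi : R) != 0 by rewrite gt_eqF// pi_gt0.
    have bn : b != 0 by rewrite gt_eqF.
    clear -bn pi0; move: (pi : R) pi0 => q q0; field; by rewrite ?bn ?q0.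
  by rewrite sqrtrV ?ltW// invrK.
rewrite pk in h.
have sb : (Num.sqrt b) != 0 by rewrite sqrtr_eq0 -ltNge.
rewrite -[LHS]mul1e -[1%E]/(1%:E) -(mulVf sb) EFinM -muleA h mule1//.
Qed.

Lemma integrable_gauss1 b x : 0 < b ->
  intT mu (fun y => gauss1 b (y - x)).
Proof.
move=> b0; apply: (@integrable_le _ (measurableTypeR R) R mu _ (fun y => gauss1 b (y - x))).
- apply: measurableT_comp; first exact: measurable_gauss1.
  exact: measurable_funB.
- by move=> y; rewrite ger0_norm// gauss1_ge0.
- by rewrite integral_gauss1// ltry.
Qed.

Lemma integrable_mul_gauss1 b x : 0 < b ->
  intT mu (fun y => `|y - x| * gauss1 b (y - x)).
Proof.
move=> b0; have b20 : 0 < b / 2 by rewrite divr_gt0.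
(* Chosen so that [1 + u^2 <= M (1 + pi b u^2 / 2) <= M e^(pi b u^2 / 2)]: half of the Gaussian
   absorbs the polynomial factor. *)
pose M := 1 + 2 / (pi * b).
have pb0 : 0 < pi * b by rewrite mulr_gt0// pi_gt0.
have mg : measT (fun y => gauss1 b (y - x)).
  apply: measurableT_comp; first exact: measurable_gauss1.
  exact: measurable_funB.
apply: (@integrable_le _ (measurableTypeR R) R mu _ (fun y => M * gauss1 (b / 2) (y - x))).
- apply: measurable_funM => //; apply: measurableT_comp => //; exact: measurable_funB.
- move=> y; rewrite normrM normr_id (ger0_norm (gauss1_ge0 _ _)).
  set u := y - x.
  have -> : gauss1 b u = gauss1 (b / 2) u * gauss1 (b / 2) u.
    by rewrite /gauss1 -expRD; congr expR; field.
  rewrite mulrA ler_wpM2r ?gauss1_ge0//.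
  have h1 : `|u| <= 1 + `|u| ^+ 2 by nra.
  rewrite real_normK ?num_real// in h1.
  apply: (@le_trans _ _ ((1 + u ^+ 2) * gauss1 (b / 2) u)).
    by rewrite ler_wpM2r ?gauss1_ge0.
  rewrite /gauss1 mulNr expRN ler_pdivrMr ?expR_gt0//.
  have h2 := expR_ge1Dx (pi * (b / 2) * u ^+ 2).
  have M0 : 0 <= M by rewrite addr_ge0// divr_ge0// ltW.
  apply: le_trans (ler_wpM2l M0 h2).
  rewrite /M; have -> : (1 + 2 / (pi * b)) * (1 + pi * (b / 2) * u ^+ 2) =
    1 + u ^+ 2 + (2 / (pi * b) + pi * b * u ^+ 2 / 2).
    have pi0 : (pi : R) != 0 by rewrite gt_eqF// pi_gt0.
    have bn : b != 0 by rewrite gt_eqF.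
    clear -bn pi0; move: (pi : R) pi0 => q q0; field; by rewrite ?bn ?q0.
  rewrite lerDl addr_ge0//; first by rewrite divr_ge0// ltW.
  by rewrite divr_ge0// mulr_ge0 ?sqr_ge0// ltW.
- under eq_integral do rewrite EFinM.
  have M0 : 0 <= M by rewrite addr_ge0// divr_ge0// ltW.
  rewrite ge0_integralZl//.
  + by rewrite integral_gauss1// -EFinM ltry.
  + apply/measurable_EFinP; apply: measurableT_comp; first exact: measurable_gauss1.
    exact: measurable_funB.
  + by move=> y _; rewrite lee_fin gauss1_ge0.
Qed.

Lemma cvg_gauss1 b c : 0 < b -> gauss1 b (n.+1%:R + c) @[n --> \oo] --> (0 : R).
Proof.
move=> b0.
have pb0 : 0 < pi * b by rewrite mulr_gt0// pi_gt0.
(* [u^2 >= u - 1/4] makes the exponent linear in [n], so a geometric sequence dominates. *)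
pose C := expR (pi * b * (4^-1 - c)).
pose q := expR (- (pi * b)).
have q1 : `|q| < 1 by rewrite ger0_norm ?expR_ge0// -expR0 ltr_expR oppr_lt0.
apply: (@squeeze_cvgr _ _ _ _ (cst 0) (fun n => C * q ^+ n.+1)).
- apply: nearW => n /=; rewrite gauss1_ge0/= /gauss1 /C /q -expRM_natl -expRD ler_expR.
  set m : R := n.+1%:R.
  have : 0 <= pi * b * (m + c - 2^-1) ^+ 2 by rewrite mulr_ge0 ?sqr_ge0// ltW.
  lra.
- exact: cvg_cst.
- rewrite -[X in _ --> X](mulr0 C); apply: cvgM; first exact: cvg_cst.
  rewrite (cvg_shiftS (fun n => q ^+ n)); exact: cvg_expr.
Qed.

Lemma measurable_cos : measT (@cos R).
Proof. by apply: continuous_measurable_fun; exact: continuous_cos. Qed.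

Lemma measurable_sin : measT (@sin R).
Proof. by apply: continuous_measurable_fun; exact: continuous_sin. Qed.

Lemma normr_cos_le1 (t : R) : `|cos t| <= 1.
Proof. by rewrite ler_norml cos_geN1 cos_le1. Qed.

Lemma normr_sin_le1 (t : R) : `|sin t| <= 1.
Proof. by rewrite ler_norml sin_geN1 sin_le1. Qed.

Lemma is_derive_cos_aff k c y :
  is_derive y 1 (fun y => cos (k * y + c)) (- k * sin (k * y + c)).
Proof.
have h := @is_derive1_comp _ (@cos R) (fun y => k * y + c) y _ _ (is_derive_cos _) (is_derive_aff k c y).
by apply: (is_derive_eq h); rewrite mulNr mulNr mulrC.
Qed.

Lemma is_derive_sin_aff k c y :
  is_derive y 1 (fun y => sin (k * y + c)) (k * cos (k * y + c)).
Proof.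
have h := @is_derive1_comp _ (@sin R) (fun y => k * y + c) y _ _ (is_derive_sin _) (is_derive_aff k c y).
by apply: (is_derive_eq h); rewrite mulrC.
Qed.

Lemma measurable_gauss1_shift b x : measT (fun y : measurableTypeR R => gauss1 b (y - x)).
Proof.
apply: measurableT_comp; first exact: measurable_gauss1.
exact: measurable_funB.
Qed.

Section gauss1_fourier.
Variables (b x theta : R).
Hypothesis b0 : 0 < b.

Let J tau := \int[mu]_y (gauss1 b (y - x) * cos (2 * pi * (y - x) * tau + theta)).
Let S tau := \int[mu]_y ((y - x) * gauss1 b (y - x) * sin (2 * pi * (y - x) * tau + theta)).

Let meas_phase tau : measT (fun y : measurableTypeR R => 2 * pi * (y - x) * tau + theta).
Proof.
apply: measurable_funD => //; apply: measurable_funM => //.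
apply: measurable_funM => //; exact: measurable_funB.
Qed.

Let intJ tau : mu.-integrable setT
  (EFin \o (fun y => gauss1 b (y - x) * cos (2 * pi * (y - x) * tau + theta))).
Proof.
have -> : (fun y => gauss1 b (y - x) * cos (2 * pi * (y - x) * tau + theta)) =
  (fun y => cos (2 * pi * (y - x) * tau + theta) * gauss1 b (y - x)).
  by apply/funext => y; rewrite mulrC.
apply: (@integrable_bounded_mul _ (measurableTypeR R) R mu _ _ 1).
- exact: measurableT_comp measurable_cos (meas_phase tau).
- by move=> y; exact: normr_cos_le1.
- exact: integrable_gauss1.
Qed.

Let intS tau : mu.-integrable setT
  (EFin \o (fun y => (y - x) * gauss1 b (y - x) * sin (2 * pi * (y - x) * tau + theta))).
Proof.
have mg : measurable_fun [set: measurableTypeR R] (fun y : measurableTypeR R => (y - x) * gauss1 b (y - x)).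
  by apply: measurable_funM; [exact: measurable_funB|exact: measurable_gauss1_shift].
apply: (@integrable_le _ (measurableTypeR R) R mu _ (fun y => `|y - x| * gauss1 b (y - x))).
- apply: measurable_funM => //.
  exact: measurableT_comp measurable_sin (meas_phase tau).
- move=> y; rewrite !normrM (ger0_norm (gauss1_ge0 _ _)) ler_piMr//.
    by rewrite mulr_ge0// gauss1_ge0.
  exact: normr_sin_le1.
- have /integrableP[_] := integrable_mul_gauss1 x b0.
  apply: le_lt_trans; apply: ge0_le_integralW => y _ /=.
    by rewrite lee_fin mulr_ge0// gauss1_ge0.
  by rewrite lee_fin ler_norm.
Qed.

Let phaseE tau y : 2 * pi * (y - x) * tau + theta = 2 * pi * tau * y + (theta - 2 * pi * tau * x).
Proof. ring. Qed.

(** The derivative of Gaussian times sine integrates to zero; its two terms are the two sides. *)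
Let by_parts tau : 2 * pi * b * S tau = 2 * pi * tau * J tau.
Proof.
pose F y := gauss1 b (y - x) * sin (2 * pi * (y - x) * tau + theta).
pose f1 y := gauss1 b (y - x) * cos (2 * pi * (y - x) * tau + theta).
pose f2 y := (y - x) * gauss1 b (y - x) * sin (2 * pi * (y - x) * tau + theta).
pose f y := 2 * pi * tau * f1 y - 2 * pi * b * f2 y.
have dF y : is_derive y 1 F (f y).
  have -> : F = (fun y => gauss1 b (y - x)) * (fun y => sin (2 * pi * tau * y + (theta - 2 * pi * tau * x))).
    by apply/funext => z; rewrite /F phaseE.
  have d1 := is_derive_gauss1 b x y.
  have d2 := is_derive_sin_aff (2 * pi * tau) (theta - 2 * pi * tau * x) y.
  apply: is_derive_eq; rewrite /GRing.scale/= /f /f1 /f2 phaseE; ring.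
have cg : continuous (fun y => gauss1 b (y - x)).
  move=> y; apply: differentiable_continuous; apply/derivable1_diffP.
  by have [] := is_derive_gauss1 b x y.
have cc : continuous (fun y => cos (2 * pi * (y - x) * tau + theta)).
  have -> : (fun y => cos (2 * pi * (y - x) * tau + theta)) = (fun y => cos (2 * pi * tau * y + (theta - 2 * pi * tau * x))).
    by apply/funext => y; rewrite phaseE.
  move=> y; apply: differentiable_continuous; apply/derivable1_diffP.
  by have [] := is_derive_cos_aff (2 * pi * tau) (theta - 2 * pi * tau * x) y.
have cs : continuous (fun y => sin (2 * pi * (y - x) * tau + theta)).
  have -> : (fun y => sin (2 * pi * (y - x) * tau + theta)) = (fun y => sin (2 * pi * tau * y + (theta - 2 * pi * tau * x))).
    by apply/funext => y; rewrite phaseE.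
  move=> y; apply: differentiable_continuous; apply/derivable1_diffP.
  by have [] := is_derive_sin_aff (2 * pi * tau) (theta - 2 * pi * tau * x) y.
have cf : continuous f.
  move=> y; apply: cvgB; apply: cvgM; try exact: cvg_cst.
  - by apply: cvgM; [exact: cg|exact: cc].
  - apply: cvgM; last exact: cs.
    by apply: cvgM; [apply: cvgB; [exact: cvg_id|exact: cvg_cst]|exact: cg].
have i1 : intT mu (fun y => 2 * pi * tau * f1 y).
  apply: (@integrable_scale _ (measurableTypeR R) R mu); exact: intJ.
have i2 : intT mu (fun y => 2 * pi * b * f2 y).
  apply: (@integrable_scale _ (measurableTypeR R) R mu); exact: intS.
have If : intT mu f.
  exact: (integrableB measurableT i1 i2).
have Fle y : `|F y| <= gauss1 b (y - x).
  rewrite normrM (ger0_norm (gauss1_ge0 _ _)) ler_piMr//; first exact: gauss1_ge0.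
  exact: normr_sin_le1.
have Fp : F n.+1%:R @[n --> \oo] --> (0 : R).
  apply/norm_cvg0P; apply: (@squeeze_cvgr _ _ _ _ (cst 0) (fun n => gauss1 b (n.+1%:R + - x))).
  - by apply: nearW => n /=; rewrite normr_ge0 Fle.
  - exact: cvg_cst.
  - exact: cvg_gauss1.
have Fm : F (- n.+1%:R) @[n --> \oo] --> (0 : R).
  apply/norm_cvg0P; apply: (@squeeze_cvgr _ _ _ _ (cst 0) (fun n => gauss1 b (n.+1%:R + x))).
  - apply: nearW => n /=; rewrite normr_ge0; apply: le_trans (Fle _) _.
    by rewrite /gauss1 -opprD sqrrN.
  - exact: cvg_cst.
  - exact: cvg_gauss1.
have := integral_derivative_eq0 dF cf If Fp Fm.
rewrite /f RintegralB// !RintegralZl//; [|exact: intS|exact: intJ].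
by move/eqP; rewrite subr_eq0 => /eqP/esym.
Qed.

(** Differentiation under the integral, dominated by [2 pi |y - x|] times the Gaussian uniformly in
    [tau], produces [S], which [by_parts] turns back into [J]. *)
Let dJ (tau : R) : is_derive tau 1 J (- (2 * pi / b) * tau * J tau).
Proof.
pose f tau y := gauss1 b (y - x) * cos (2 * pi * (y - x) * tau + theta).
have df (t y : R) : is_derive t 1 (fun t => f t y) (- (2 * pi) * ((y - x) * gauss1 b (y - x) * sin (2 * pi * (y - x) * t + theta))).
  have d1 := is_derive_cos_aff (2 * pi * (y - x)) theta t.
  have -> : (fun t => f t y) = gauss1 b (y - x) *: (fun t => cos (2 * pi * (y - x) * t + theta)) by apply/funext.
  by apply: is_derive_eq; rewrite /GRing.scale/=; ring.
have dfE t y : partial1of2 f t y = - (2 * pi) * ((y - x) * gauss1 b (y - x) * sin (2 * pi * (y - x) * t + theta)).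
  by rewrite partial1of2E; have [_] := df t y.
have It : `]tau - 1, tau + 1[%classic tau by rewrite /= in_itv/=; lra.
pose G y := 2 * pi * (`|y - x| * gauss1 b (y - x)).
have pi2 : 0 <= 2 * pi :> R by rewrite mulr_ge0// pi_ge0.
have G0 y : 0 <= G y by rewrite mulr_ge0// mulr_ge0// gauss1_ge0.
have iG : intT mu G.
  apply: (@integrable_scale _ (measurableTypeR R) R mu); exact: integrable_mul_gauss1.
have Gub t y : `]tau - 1, tau + 1[%classic t -> setT y -> `|partial1of2 f t y| <= G y.
  move=> _ _; rewrite dfE !normrM normrN (ger0_norm pi2) (ger0_norm (gauss1_ge0 _ _)).
  rewrite /G ler_wpM2l// ler_piMr//; first by rewrite mulr_ge0// gauss1_ge0.
  exact: normr_sin_le1.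
have der1 t y : `]tau - 1, tau + 1[%classic t -> setT y -> derivable (f ^~ y) t 1.
  by move=> _ _; have [] := df t y.
have intf t : `]tau - 1, tau + 1[%classic t -> intT mu (f t).
  by move=> _; exact: intJ.
have D1 := derivable_under_integral measurableT It intf der1 G0 iG Gub.
have D2 := differentiation_under_integral measurableT It intf der1 G0 iG Gub.
apply: DeriveDef; first exact: D1.
rewrite -derive1E D2; under eq_Rintegral do rewrite dfE.
rewrite RintegralZl//.
have -> : \int[mu]_y ((y - x) * gauss1 b (y - x) * sin (2 * pi * (y - x) * tau + theta)) = S tau by [].
have := by_parts tau.
have bn : b != 0 by rewrite gt_eqF.
move=> H; have -> : - (2 * pi) * S tau = - (2 * pi * b * S tau) / b by field.
by rewrite H; field.
Qed.

(** The differential equation of [J] makes [J tau * e^(pi tau^2 / b)] constant. The free [theta]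
    gives cosine and sine transforms at once, and in higher dimension it absorbs the phase of the
    other coordinates. *)
Lemma gauss1_fourier tau :
  \int[mu]_y (gauss1 b (y - x) * cos (2 * pi * (y - x) * tau + theta)) =
  (Num.sqrt b)^-1 * gauss1 b^-1 tau * cos theta.
Proof.
pose H t := J t * expR (pi / b * (t - 0) ^+ 2).
have dH (t : R) : is_derive t 1 H 0.
  have h := @is_derive1_comp _ (@expR R) (fun y => pi / b * (y - 0) ^+ 2) t _ _ (is_derive_expR _) (is_derive_quad (pi / b) 0 t).
  have d := dJ t.
  have -> : H = J * (fun t => expR (pi / b * (t - 0) ^+ 2)) by apply/funext.
  apply: is_derive_eq; rewrite /GRing.scale/= subr0; ring.
have HE := is_derive_0_is_cst tau 0 dH.
have J0 : J 0 = (Num.sqrt b)^-1 * cos theta.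
  rewrite /J; under eq_Rintegral do rewrite mulr0 add0r.
  rewrite RintegralZr//; last exact: integrable_gauss1.
  by rewrite /Rintegral integral_gauss1.
have := HE; rewrite /H J0 !subr0 expr0n/= mulr0 expR0 mulr1 => E.
have -> : \int[mu]_y (gauss1 b (y - x) * cos (2 * pi * (y - x) * tau + theta)) =
  J tau * expR (pi / b * tau ^+ 2) * expR (- (pi / b * tau ^+ 2)).
  by rewrite -mulrA -expRD subrr expR0 mulr1.
by rewrite E /gauss1 -mulNr mulrAC.
Qed.

Lemma integrable_gauss1_cos tau : mu.-integrable setT
  (EFin \o (fun y => gauss1 b (y - x) * cos (2 * pi * (y - x) * tau + theta))).
Proof. exact: intJ. Qed.

End gauss1_fourier.

End gauss1.

(** * Column vectors and Gaussians in several variables *)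

Section vectors.
Context (R : realType).
Local Notation mu := (@lebesgue_measure R).

Section coordinates.
Context d (T : measurableType d).

Lemma measurable_coord n (f : T -> 'cV[R]_n) (i : 'I_n) :
  measT f -> measT (fun x => f x i 0).
Proof. by move=> mf; exact: (measurableT_comp (measurable_mx_coord i 0) mf). Qed.

Lemma measurable_dotv n (f g : T -> 'cV[R]_n) :
  measT f -> measT g ->
  measT (fun x => dotv (f x) (g x)).
Proof.
move=> mf mg; rewrite /dotv; apply: measurable_sum => i.
by apply: measurable_funM; exact: measurable_coord.
Qed.

Lemma measurable_addv n (f g : T -> 'cV[R]_n) :
  measT f -> measT g ->
  measT (fun x => f x + g x).
Proof.
move=> mf mg; apply: measurable_fun_mx => i j; rewrite ord1.
under eq_fun do rewrite mxE.
by apply: measurable_funD; exact: measurable_coord.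
Qed.

Lemma measurable_oppv n (f : T -> 'cV[R]_n) :
  measT f -> measT (fun x => - f x).
Proof.
move=> mf; apply: measurable_fun_mx => i j; rewrite ord1.
under eq_fun do rewrite mxE.
by apply: measurable_funN; exact: measurable_coord.
Qed.

Lemma measurable_subv n (f g : T -> 'cV[R]_n) :
  measT f -> measT g ->
  measT (fun x => f x - g x).
Proof. by move=> mf mg; apply: measurable_addv => //; exact: measurable_oppv. Qed.

Lemma measurable_mulmxv n p (A : 'M[R]_(p, n)) (f : T -> 'cV[R]_n) :
  measT f -> measT (fun x => A *m f x).
Proof.
move=> mf; apply: measurable_fun_mx => i j; rewrite ord1.
under eq_fun do rewrite mxE.
apply: measurable_sum => k; apply: measurable_funM => //.
exact: measurable_coord.
Qed.

End coordinates.

Lemma consvP n (v : 'cV[R]_n.+1) : v = consv (v ord0 0, \col_i v (lift ord0 i) 0).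
Proof.
apply/colP => i; have [k ->|->] := unliftP ord0 i.
- by rewrite consvS mxE.
- by rewrite consv0.
Qed.

Lemma dotv_consv n (s t : R) (x y : 'cV[R]_n) :
  dotv (consv (s, x)) (consv (t, y)) = s * t + dotv x y.
Proof.
rewrite /dotv big_ord_recl !consv0/=; congr (_ + _).
by apply: eq_bigr => i _; rewrite !consvS.
Qed.

Lemma consvB n (s t : R) (x y : 'cV[R]_n) :
  consv (s, x) - consv (t, y) = consv (s - t, x - y).
Proof.
apply/colP => i; have [k ->|->] := unliftP ord0 i; rewrite mxE [X in _ + X]mxE.
- by rewrite !consvS/= !mxE.
- by rewrite !consv0.
Qed.

Lemma ge0_integral_consv n (f : 'cV[R]_n.+1 -> \bar R) :
  measT f -> (forall x, 0 <= f x)%E ->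
  (\int[lebesgue_cV]_x f x = \int[mu]_s \int[lebesgue_cV]_y f (consv (s, y)))%E.
Proof.
move=> mf f0.
rewrite (ge0_integral_pushforward (@measurable_consv R n) (mu \x lebesgue_cV)%E)//.
rewrite preimage_setT (fubini_tonelli1 (f \o consv))//.
  exact: measurableT_comp mf (@measurable_consv R n).
by move=> x; exact: f0.
Qed.

Lemma integral_consv n (f : 'cV[R]_n.+1 -> \bar R) :
  lebesgue_cV.-integrable setT f ->
  (\int[lebesgue_cV]_x f x = \int[mu]_s \int[lebesgue_cV]_y f (consv (s, y)))%E.
Proof.
move=> intf; have mf := measurable_int _ intf.
have mfc : measT (f \o consv) by exact: measurableT_comp mf (@measurable_consv R n).
have ifc : (mu \x lebesgue_cV)%E.-integrable setT (f \o consv).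
  apply/integrable12ltyP => //.
  have /integrableP[_] := intf.
  rewrite ge0_integral_consv//.
  exact: measurableT_comp.
rewrite (integral_pushforward (@measurable_consv R n) mf)//.
by rewrite preimage_setT -(integral12_prod_meas1 ifc).
Qed.

Definition gaussv n (b x : 'cV[R]_n) : R :=
  expR (- (pi * \sum_i b i 0 * x i 0 ^+ 2)).

Definition posv n (b : 'cV[R]_n) := forall i, 0 < b i 0.

Definition invv n (b : 'cV[R]_n) : 'cV[R]_n := \col_i (b i 0)^-1.

(** The Fourier transform of [gaussv b]. *)
Definition kernv n (b x : 'cV[R]_n) : R :=
  (\prod_i (Num.sqrt (b i 0))^-1) * gaussv (invv b) x.

Lemma gaussv_ge0 n (b x : 'cV[R]_n) : 0 <= gaussv b x.
Proof. exact: expR_ge0. Qed.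

Lemma gaussv_le1 n (b x : 'cV[R]_n) : posv b -> gaussv b x <= 1.
Proof.
move=> b0; rewrite /gaussv -expR0 ler_expR oppr_le0 mulr_ge0 ?pi_ge0// sumr_ge0// => i _.
by rewrite mulr_ge0 ?sqr_ge0// ltW.
Qed.

Lemma kernv_ge0 n (b x : 'cV[R]_n) : posv b -> 0 <= kernv b x.
Proof.
move=> b0; by rewrite /kernv mulr_ge0 ?gaussv_ge0// prodr_ge0// => i _; rewrite invr_ge0 sqrtr_ge0.
Qed.

Lemma gaussvN n (b x : 'cV[R]_n) : gaussv b (- x) = gaussv b x.
Proof.
rewrite /gaussv; congr (expR (- (_ * _))); apply: eq_bigr => i _.
by rewrite mxE sqrrN.
Qed.

Lemma measurable_gaussv d (T : measurableType d) n (b : 'cV[R]_n) (f : T -> 'cV[R]_n) :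
  measT f -> measT (fun x => gaussv b (f x)).
Proof.
move=> mf; apply: (measurableT_comp (@measurable_expR R)).
apply: measurable_funN; apply: measurable_funM => //.
apply: measurable_sum => i; apply: measurable_funM => //.
by apply: measurable_funX; exact: measurable_coord.
Qed.

Lemma gaussv_consv n (c s : R) (b x : 'cV[R]_n) :
  gaussv (consv (c, b)) (consv (s, x)) = gauss1 c s * gaussv b x.
Proof.
rewrite /gaussv /gauss1 -expRD; congr expR.
rewrite big_ord_recl !consv0/= mulrDr opprD; congr (_ + _).
  by rewrite mulNr mulrA.
by congr (- (_ * _)); apply: eq_bigr => i _; rewrite !consvS.
Qed.

Lemma invv_consv n (c : R) (b : 'cV[R]_n) : invv (consv (c, b)) = consv (c^-1, invv b).
Proof.
apply/colP => i; rewrite mxE; have [k ->|->] := unliftP ord0 i.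
- by rewrite !consvS/= mxE.
- by rewrite !consv0.
Qed.

Lemma kernv_consv n (c s : R) (b x : 'cV[R]_n) :
  kernv (consv (c, b)) (consv (s, x)) =
  (Num.sqrt c)^-1 * gauss1 c^-1 s * kernv b x.
Proof.
rewrite /kernv invv_consv gaussv_consv big_ord_recl consv0/=.
under eq_bigr do rewrite consvS/=.
ring.
Qed.

Lemma posv_consv n (c : R) (b : 'cV[R]_n) : posv (consv (c, b)) -> 0 < c /\ posv b.
Proof.
move=> h; split; first by have := h ord0; rewrite consv0.
by move=> i; have := h (lift ord0 i); rewrite consvS.
Qed.

Lemma measurable_gaussvB n (b x : 'cV[R]_n) :
  measT (fun y : 'cV[R]_n => gaussv b (y - x)).
Proof. by apply: measurable_gaussv; apply: measurable_subv. Qed.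

Lemma integral_gaussv n (b x : 'cV[R]_n) : posv b ->
  (\int[lebesgue_cV]_y (gaussv b (y - x))%:E = (\prod_i (Num.sqrt (b i 0))^-1)%:E)%E.
Proof.
elim: n b x => [|n IH] b x.
  move=> _; rewrite (integral_dirac (0 : 'cV[R]_0) measurableT); last first.
    by apply/measurable_EFinP; exact: measurable_gaussvB.
  by rewrite diracT mul1e /gaussv !big_ord0 mulr0 oppr0 expR0.
rewrite (consvP b) (consvP x); move: (b ord0 0) (x ord0 0) (\col_i b _ _) (\col_i x _ _).
move=> {}c s {}b {}x /posv_consv[c0 b0].
rewrite ge0_integral_consv; first last.
- by move=> y; rewrite lee_fin gaussv_ge0.
- by apply/measurable_EFinP; exact: measurable_gaussvB.
rewrite big_ord_recl consv0/=; under eq_bigr do rewrite consvS/=.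
under eq_integral => t _ do under eq_integral => y _ do rewrite consvB gaussv_consv EFinM.
under eq_integral => t _.
  rewrite ge0_integralZl//; first last.
  - by rewrite lee_fin gauss1_ge0.
  - by move=> y _; rewrite lee_fin gaussv_ge0.
  - by apply/measurable_EFinP; exact: measurable_gaussvB.
  rewrite IH//.
  over.
rewrite ge0_integralZr//; first last.
- by rewrite lee_fin prodr_ge0// => i _; rewrite invr_ge0 sqrtr_ge0.
- by move=> y _; rewrite lee_fin gauss1_ge0.
- by apply/measurable_EFinP; exact: measurable_gauss1_shift.
by rewrite integral_gauss1.
Qed.

Lemma integrable_gaussv n (b x : 'cV[R]_n) : posv b ->
  intT lebesgue_cV (fun y => gaussv b (y - x)).
Proof.
move=> b0; apply: (@integrable_le _ _ R lebesgue_cV _ (fun y => gaussv b (y - x))).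
- exact: measurable_gaussvB.
- by move=> y; rewrite ger0_norm// gaussv_ge0.
- by rewrite integral_gaussv// ltry.
Qed.

Lemma measurable_phase n (x tau : 'cV[R]_n) (theta : R) :
  measT (fun y : 'cV[R]_n => 2 * pi * dotv (y - x) tau + theta).
Proof.
apply: measurable_funD => //; apply: measurable_funM => //.
by apply: measurable_dotv => //; apply: measurable_subv.
Qed.

Lemma integrable_gaussv_cos n (b x tau : 'cV[R]_n) theta : posv b ->
  lebesgue_cV.-integrable setT
   (EFin \o (fun y => gaussv b (y - x) * cos (2 * pi * dotv (y - x) tau + theta))).
Proof.
move=> b0.
have -> : (fun y => gaussv b (y - x) * cos (2 * pi * dotv (y - x) tau + theta)) =
  (fun y => cos (2 * pi * dotv (y - x) tau + theta) * gaussv b (y - x)).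
  by apply/funext => y; rewrite mulrC.
apply: (@integrable_bounded_mul _ _ R lebesgue_cV _ _ 1).
- exact: measurableT_comp (@measurable_cos R) (measurable_phase _ _ _).
- by move=> y; exact: normr_cos_le1.
- exact: integrable_gaussv.
Qed.

(** Induction on the dimension: while the tail is integrated, the phase of the leading coordinate is
    constant and joins [theta]. *)
Lemma gaussv_fourier_shift n (b x tau : 'cV[R]_n) theta : posv b ->
  \int[lebesgue_cV]_y (gaussv b (y - x) * cos (2 * pi * dotv (y - x) tau + theta)) =
  kernv b tau * cos theta.
Proof.
elim: n b x tau theta => [|n IH] b x tau theta.
  move=> b0; rewrite /Rintegral (integral_dirac (0 : 'cV[R]_0) measurableT); last first.
    by have /measurable_int := integrable_gaussv_cos x tau theta b0.
  by rewrite diracT mul1e /= /kernv /gaussv /dotv !big_ord0 !mulr0 !oppr0 expR0 add0r !mul1r.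
rewrite (consvP b) (consvP x) (consvP tau).
move: (b ord0 0) (x ord0 0) (tau ord0 0) (\col_i b _ _) (\col_i x _ _) (\col_i tau _ _).
move=> {}c s t {}b {}x {}tau bc0; have [c0 b0] := posv_consv bc0.
rewrite /Rintegral (integral_consv (integrable_gaussv_cos _ _ _ bc0)).
transitivity (fine (\int[mu]_u (kernv b tau * (gauss1 c (u - s) * cos (2 * pi * (u - s) * t + theta)))%:E)%E).
  congr fine; apply: eq_integral => u _.
  transitivity (\int[lebesgue_cV]_(y in [set: 'cV[R]_n]) ((gauss1 c (u - s))%:E *
     (gaussv b (y - x) * cos (2 * pi * dotv (y - x) tau + (2 * pi * (u - s) * t + theta)))%R%:E))%E.
    apply: eq_integral => y _ /=; rewrite consvB gaussv_consv dotv_consv -EFinM; congr EFin.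
    by rewrite -mulrA; congr (_ * (_ * cos _)); ring.
  rewrite integralZl//; last exact: integrable_gaussv_cos.
  rewrite -EFin_Rintegral; last exact: integrable_gaussv_cos.
  by rewrite IH// -EFinM; congr EFin; rewrite mulrCA.
rewrite -EFin_Rintegral; last first.
  apply: (@integrable_scale _ (measurableTypeR R) R mu).
  exact: integrable_gauss1_cos.
rewrite /= RintegralZl//; last exact: integrable_gauss1_cos.
by rewrite gauss1_fourier// kernv_consv mulrA (mulrC (kernv _ _)).
Qed.

Lemma gaussv_fourier n (b x tau : 'cV[R]_n) theta : posv b ->
  \int[lebesgue_cV]_y (gaussv b (y - x) * cos (2 * pi * dotv y tau + theta)) =
  kernv b tau * cos (2 * pi * dotv x tau + theta).
Proof.
move=> b0; rewrite -(gaussv_fourier_shift x tau (2 * pi * dotv x tau + theta) b0).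
apply: eq_Rintegral => y _; congr (_ * cos _).
rewrite addrA -mulrDr; congr (_ * _ + _); rewrite /dotv -big_split/=.
by apply: eq_bigr => i _; rewrite !mxE mulrBl subrK.
Qed.

End vectors.

Lemma measurable_pair2 d d1 d2 (T : measurableType d) (T1 : measurableType d1)
    (T2 : measurableType d2) (f : T -> T1) (g : T -> T2) :
  measT f -> measT g ->
  measT (fun x => (f x, g x)).
Proof. by move=> mf mg; apply/measurable_fun_pairP; split. Qed.

(** * Plancherel and Bernstein inequalities for oscillating integrals *)

Section schur.
Context d (X : measurableType d) (R : realType).
Variable m : {sigma_finite_measure set X -> \bar R}.

(** [|g x| |g y|] is at most half of [g x ^+ 2 + g y ^+ 2]. Each half is controlled by the row bound
    [A], the second one after exchanging the variables. *)
Lemma schur_test (K : X * X -> R) (g : X -> R) (A : R) :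
  measT K -> (forall z, 0 <= K z) ->
  (forall x y, K (x, y) = K (y, x)) -> measT g ->
  (forall x, (\int[m]_y (K (x, y))%:E <= A%:E)%E) ->
  (\int[m]_x \int[m]_y (`|g x| * `|g y| * K (x, y))%:E <=
   A%:E * \int[m]_x (g x ^+ 2)%:E)%E.
Proof.
move=> mK K0 Ksym mg KA.
pose H (z : X * X) := (2^-1 * g z.1 ^+ 2 * K z)%:E.
have mg1 : measT (fun z : X * X => g z.1) by exact: measurableT_comp mg _.
have mH : measT H.
  apply/measurable_EFinP; apply: measurable_funM => //.
  by apply: measurable_funM => //; exact: measurable_funX.
have H0 z : (0 <= H z)%E by rewrite /H lee_fin; do 2 apply: mulr_ge0 => //; exact: sqr_ge0.
pose H' (z : X * X) := H (z.2, z.1).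
have mH' : measT H'.
  have msw : measT (fun z : X * X => (z.2, z.1)) by exact: measurable_pair2 measurable_snd measurable_fst.
  exact: measurableT_comp mH msw.
have H'0 z : (0 <= H' z)%E by exact: H0.
have HA : (\int[m]_x \int[m]_y H (x, y) <= 2^-1%:E * (A%:E * \int[m]_x (g x ^+ 2)%:E))%E.
  have mg2 : measT (fun x => (g x ^+ 2)%:E).
    by apply/measurable_EFinP; exact: measurable_funX.
  have A0 : 0 <= A by rewrite -lee_fin; apply: le_trans (KA point); apply: integral_ge0 => y _; rewrite lee_fin.
  rewrite muleA -EFinM -ge0_integralZl//; first last.
  - by rewrite lee_fin mulr_ge0//; exact: A0.
  - by move=> x _; rewrite lee_fin sqr_ge0.
  apply: ge0_le_integralW => x _; first exact: integral_ge0.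
  rewrite /H/=; under eq_integral do rewrite EFinM.
  rewrite ge0_integralZl//; first last.
  - by rewrite lee_fin mulr_ge0// ?sqr_ge0.
  - by move=> y _; rewrite lee_fin.
  - by apply/measurable_EFinP; exact: measurableT_comp mK _.
  rewrite EFinM muleAC EFinM; apply: lee_wpmul2r; first by rewrite lee_fin sqr_ge0.
  rewrite EFinM; apply: lee_wpmul2l; first by rewrite lee_fin.
  exact: KA.
apply: (@le_trans _ _ (\int[m]_x \int[m]_y (H (x, y) + H' (x, y)))%E).
  apply: ge0_le_integralW => x _.
    by apply: integral_ge0 => y _; rewrite lee_fin !mulr_ge0.
  apply: ge0_le_integralW => y _.
    by rewrite lee_fin !mulr_ge0.
  rewrite /H' /H/= -EFinD lee_fin (Ksym y x) -mulrDl ler_wpM2r//.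
  have := sqr_ge0 (`|g x| - `|g y|); rewrite sqrrB !real_normK ?num_real//; lra.
have -> : (\int[m]_x \int[m]_y (H (x, y) + H' (x, y)) =
  \int[m]_x \int[m]_y H (x, y) + \int[m]_x \int[m]_y H' (x, y))%E.
  rewrite -ge0_integralD//; first last.
  - exact: (measurable_fun_fubini_tonelli_F H').
  - by move=> x _; exact: integral_ge0.
  - exact: (measurable_fun_fubini_tonelli_F H).
  - by move=> x _; exact: integral_ge0.
  apply: eq_integral => x _; rewrite ge0_integralD//.
  - exact: measurableT_comp mH _.
  - exact: measurableT_comp mH' _.
rewrite (fubini_tonelli H')// /H'/=.
apply: (@le_trans _ _ (2^-1%:E * (A%:E * \int[m]_x (g x ^+ 2)%:E) + 2^-1%:E * (A%:E * \int[m]_x (g x ^+ 2)%:E))%E).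
  exact: leeD.
rewrite -ge0_muleDl ?lee_fin//.
by rewrite -EFinD (_ : 2^-1 + 2^-1 = 1 :> R) ?mul1e//; lra.
Qed.

End schur.

Section oscillating.
Context (R : realType).

Lemma cosB_pihalf (u : R) : cos (u - pi / 2) = sin u.
Proof. by rewrite cosB cos_pihalf sin_pihalf mulr0 mulr1 add0r. Qed.

(** The real part of the integral of [e^(i phi) g] for real [g]; with phase [phi - pi / 2] it is the
    imaginary part. *)
Definition osc d (phi g : 'cV[R]_d -> R) : R :=
  \int[lebesgue_cV]_x (cos (phi x) * g x).

(** The squared modulus of the same complex integral. *)
Definition osc_sqr d (phi g : 'cV[R]_d -> R) : R :=
  osc phi g ^+ 2 + osc (fun x => phi x - pi / 2) g ^+ 2.

Lemma osc_sqr_ge0 d (phi g : 'cV[R]_d -> R) : 0 <= osc_sqr phi g.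
Proof. by rewrite addr_ge0 ?sqr_ge0. Qed.

Lemma integrable_cos_mul d (phi g : 'cV[R]_d -> R) :
  measT phi -> intT lebesgue_cV g ->
  intT lebesgue_cV (fun x => cos (phi x) * g x).
Proof.
move=> mphi ig; apply: (@integrable_bounded_mul _ _ R lebesgue_cV _ _ 1) => //.
- exact: measurableT_comp (@measurable_cos R) mphi.
- by move=> x; exact: normr_cos_le1.
Qed.

Lemma osc_le d (phi g : 'cV[R]_d -> R) :
  measT phi -> intT lebesgue_cV g ->
  `|osc phi g| <= fine (\int[lebesgue_cV]_x `|g x|%:E)%E.
Proof.
move=> mphi ig; have [mg goo] := integrableP _ _ _ ig.
rewrite -lee_fin fineK; last first.
  by rewrite ge0_fin_numE// integral_ge0.
apply: le_trans (le_norm_Rintegral_fin (integrable_cos_mul mphi ig)) _.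
apply: ge0_le_integralW => x _ //.
by rewrite lee_fin normrM ler_piMl// normr_cos_le1.
Qed.

Lemma oscD d (phi : 'cV[R]_d -> R) (beta : R) (g : 'cV[R]_d -> R) :
  measT phi -> intT lebesgue_cV g ->
  osc (fun x => phi x + beta) g =
  cos beta * osc phi g - sin beta * osc (fun x => phi x - pi / 2) g.
Proof.
move=> mphi ig.
have i1 : intT lebesgue_cV (fun x => cos beta * (cos (phi x) * g x)).
  by apply: integrable_scale; exact: integrable_cos_mul.
have i0 : intT lebesgue_cV (fun x => cos (phi x - pi / 2) * g x).
  by apply: integrable_cos_mul => //; exact: measurable_funB.
have i2 : intT lebesgue_cV (fun x => sin beta * (cos (phi x - pi / 2) * g x)).
  exact: integrable_scale.
rewrite /osc -!RintegralZl//; last exact: integrable_cos_mul.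
rewrite -RintegralB//; apply: eq_Rintegral => x _.
by rewrite cosD cosB_pihalf; ring.
Qed.

Lemma osc_sqrD d (phi : 'cV[R]_d -> R) (beta : R) (g : 'cV[R]_d -> R) :
  measT phi -> intT lebesgue_cV g ->
  osc_sqr (fun x => phi x + beta) g = osc_sqr phi g.
Proof.
move=> mphi ig; rewrite /osc_sqr oscD//.
have -> : (fun x => phi x + beta - pi / 2) = (fun x => phi x + (beta - pi / 2)).
  by apply/funext => x; rewrite addrA.
rewrite (@oscD _ phi (beta - pi / 2))// cosB_pihalf.
have -> : sin (beta - pi / 2) = - cos beta.
  by rewrite sinB cos_pihalf sin_pihalf mulr0 mulr1 sub0r.
have := cos2Dsin2 beta; set u := osc phi g; set v := osc _ _ => h.
transitivity ((u ^+ 2 + v ^+ 2) * (cos beta ^+ 2 + sin beta ^+ 2)); first ring.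
by rewrite h mulr1.
Qed.

Section phase.
Context (d k : nat) (Phi : 'cV[R]_d -> 'cV[R]_k) (alpha : 'cV[R]_d -> R).
Hypothesis mPhi : measT Phi.
Hypothesis malpha : measT alpha.

(** As a function of [t], the integral of [g] against this phase is formally the inverse Fourier
    transform of the image of [e^(i alpha) g] under [Phi]; [alpha] collects all that is independent
    of [t]. *)
Definition phase (t : 'cV[R]_k) (x : 'cV[R]_d) : R :=
  2 * pi * dotv t (Phi x) + alpha x.

Lemma measurable_phase2 : measT (fun z : 'cV[R]_k * 'cV[R]_d => phase z.1 z.2).
Proof.
apply: measurable_funD; last exact: measurableT_comp malpha _.
apply: measurable_funM => //; apply: measurable_dotv => //.
exact: measurableT_comp mPhi _.
Qed.

Lemma measurable_phaser t : measT (phase t).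
Proof. exact: (measurableT_comp measurable_phase2 (pair1_measurable t)). Qed.

Lemma measurable_osc_phase (beta : R) (g : 'cV[R]_d -> R) : measT g ->
  measT (fun t => osc (fun x => phase t x + beta) g).
Proof.
move=> mg; apply: (measurable_Rintegral_param lebesgue_cV
  (F := fun z : 'cV[R]_k * 'cV[R]_d => cos (phase z.1 z.2 + beta) * g z.2)).
apply: measurable_funM; last exact: measurableT_comp mg _.
apply: measurableT_comp; first exact: measurable_cos.
by apply: measurable_funD => //; exact: measurable_phase2.
Qed.

Lemma measurable_osc_sqr_phase (g : 'cV[R]_d -> R) : measT g ->
  measT (fun t => osc_sqr (phase t) g).
Proof.
move=> mg; apply: measurable_funD; apply: measurable_funX.
- have := measurable_osc_phase 0 mg.
  by under eq_fun do under eq_fun do rewrite addr0.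
- exact: (measurable_osc_phase (- (pi / 2)) mg).
Qed.

Section core.
Variables (g : 'cV[R]_d -> R).
Hypothesis ig : intT lebesgue_cV g.
Let mg : measT g. Proof. exact: integrable_measurable ig. Qed.

Let C t := osc (phase t) g.
Let S t := osc (fun x => phase t x - pi / 2) g.
(** Half of the opened square: integrating [E (t, x)] against [g x] gives the squared modulus. Its
    uniform bound is what [Rintegral_swap] asks for. *)
Let E (z : 'cV[R]_k * 'cV[R]_d) : R :=
  \int[lebesgue_cV]_y (cos (phase z.1 z.2 - phase z.1 y) * g y).
Let M := fine (\int[lebesgue_cV]_x `|g x|%:E)%E.

Let E_bound z : `|E z| <= M.
Proof.
apply: osc_le => //; apply: measurable_funB => //; exact: measurable_phaser.
Qed.

Let mE : measT E.
Proof.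
apply: (measurable_Rintegral_param lebesgue_cV
  (F := fun z : ('cV[R]_k * 'cV[R]_d) * 'cV[R]_d => cos (phase z.1.1 z.1.2 - phase z.1.1 z.2) * g z.2)).
apply: measurable_funM; last exact: measurableT_comp mg _.
apply: measurableT_comp; first exact: measurable_cos.
apply: measurable_funB.
- exact: (measurableT_comp measurable_phase2 measurable_fst).
- have mzx : measT (fun z : ('cV[R]_k * 'cV[R]_d) * 'cV[R]_d => (z.1.1, z.2)).
    apply: measurable_pair2; last exact: measurable_snd.
    exact: (measurableT_comp measurable_fst measurable_fst).
  exact: (measurableT_comp measurable_phase2 mzx).
Qed.

Let osc_sqrE t : osc_sqr (phase t) g = \int[lebesgue_cV]_x (E (t, x) * g x).
Proof.
have mp := measurable_phaser t.
have mp' : measT (fun x => phase t x - pi / 2) by exact: measurable_funB.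
have i1 := integrable_cos_mul mp ig.
have i2 := integrable_cos_mul mp' ig.
have EE x : E (t, x) = C t * cos (phase t x) + S t * cos (phase t x - pi / 2).
  rewrite /E /C /S /osc -!RintegralZr// -RintegralD//.
  - apply: eq_Rintegral => y _; rewrite cosB !cosB_pihalf/=; ring.
  - have := integrable_scale (cos (phase t x)) i1.
    by congr (_.-integrable _ _); apply/funext => y /=; rewrite mulrC.
  - have := integrable_scale (cos (phase t x - pi / 2)) i2.
    by congr (_.-integrable _ _); apply/funext => y /=; rewrite mulrC.
transitivity (\int[lebesgue_cV]_x (C t * (cos (phase t x) * g x) + S t * (cos (phase t x - pi / 2) * g x))).
  rewrite RintegralD//; [|exact: integrable_scale|exact: integrable_scale].
  by rewrite !RintegralZl.
by apply: eq_Rintegral => x _; rewrite EE; ring.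
Qed.

(** Open the square and integrate in [t] first: what remains is the Fourier transform of the weight
    at [Phi x - Phi y]. *)
Lemma gaussv_osc_sqr b : posv b ->
  \int[lebesgue_cV]_t (gaussv b t * osc_sqr (phase t) g) =
  \int[lebesgue_cV]_x (g x * \int[lebesgue_cV]_y
     (g y * (kernv b (Phi x - Phi y) * cos (alpha x - alpha y)))).
Proof.
move=> b0; under eq_Rintegral do rewrite osc_sqrE.
have iw : (@lebesgue_cV R k).-integrable setT (EFin \o gaussv b).
  by have := integrable_gaussv 0 b0; under [X in _.-integrable _ (_ \o X)]eq_fun do rewrite subr0.
rewrite (Rintegral_swap iw ig mE E_bound).
apply: eq_Rintegral => x _; congr (_ * _).
under eq_Rintegral do rewrite mulrC.
pose K (z : 'cV[R]_k * 'cV[R]_d) := cos (phase z.1 x - phase z.1 z.2).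
have mK : measT K.
  apply: measurableT_comp; first exact: measurable_cos.
  apply: measurable_funB; last exact: measurable_phase2.
  have mzx : measT (fun z : 'cV[R]_k * 'cV[R]_d => (z.1, x)).
    by apply: measurable_pair2 => //; exact: measurable_fst.
  exact: (measurableT_comp measurable_phase2 mzx).
have K1 z : `|K z| <= 1 by exact: normr_cos_le1.
rewrite (Rintegral_swap iw ig mK K1).
apply: eq_Rintegral => y _; congr (_ * _).
rewrite -(gaussv_fourier_shift 0 (Phi x - Phi y) (alpha x - alpha y) b0).
apply: eq_Rintegral => t _; rewrite subr0 mulrC; congr (_ * cos _).
rewrite /phase opprD addrACA -mulrBr; congr (_ * _ + _).
rewrite /dotv -sumrB; apply: eq_bigr => i _; by rewrite !mxE mulrBr.
Qed.

Lemma gaussv_osc_sqr_le b (D : set 'cV[R]_d) (A : R) : posv b -> measurable D ->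
  (forall x, ~ D x -> g x = 0) ->
  (forall x, D x -> (\int[lebesgue_cV]_(y in D) (kernv b (Phi x - Phi y))%:E <= A%:E)%E) ->
  0 <= A ->
  (\int[lebesgue_cV]_t (gaussv b t * osc_sqr (phase t) g)%:E <=
   A%:E * \int[lebesgue_cV]_x (g x ^+ 2)%:E)%E.
Proof.
move=> b0 mD gD DA A0.
(* Row bounds are available only on [D], whereas Schur's test runs over the whole space; the kernel
   is therefore cut off in both variables. The cosine of [alpha x - alpha y] will be bounded by
   one. *)
pose K (z : 'cV[R]_d * 'cV[R]_d) := kernv b (Phi z.1 - Phi z.2) * (\1_D z.1 * \1_D z.2) : R.
have mk : measT (fun z : 'cV[R]_d * 'cV[R]_d => kernv b (Phi z.1 - Phi z.2)).
  apply: measurable_funM => //; apply: measurable_gaussv.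
  by apply: measurable_subv; exact: measurableT_comp mPhi _.
have mi0 : measT (\1_D : 'cV[R]_d -> R) by exact: measurable_indic.
have mi1 : measT (fun z : 'cV[R]_d * 'cV[R]_d => \1_D z.1 : R).
  exact: (measurableT_comp mi0 measurable_fst).
have mi2 : measT (fun z : 'cV[R]_d * 'cV[R]_d => \1_D z.2 : R).
  exact: (measurableT_comp mi0 measurable_snd).
have mK : measT K.
  by apply: measurable_funM => //; exact: measurable_funM.
have i0 x : 0 <= \1_D x :> R by rewrite indicE.
have K0 z : 0 <= K z by rewrite /K; apply: mulr_ge0; [exact: kernv_ge0|exact: mulr_ge0].
have Ks x y : K (x, y) = K (y, x).
  by rewrite /K/= /kernv -[Phi x - _]opprB gaussvN (mulrC (\1_D x)).
have KA x : (\int[lebesgue_cV]_y (K (x, y))%:E <= A%:E)%E.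
  have [xD|xD] := pselect (D x); last first.
    rewrite integral0_eq ?lee_fin// => y _.
    by rewrite /K/= indicE memNset// mul0r mulr0.
  apply: le_trans (DA x xD); rewrite [leRHS]integral_mkcond.
  apply: ge0_le_integralW => y _; first by rewrite lee_fin.
  rewrite patchE /K/= !indicE mem_set// mul1r; case: ifPn => _; by rewrite ?mulr1 ?mulr0.
have iw : (@lebesgue_cV R k).-integrable setT (EFin \o gaussv b).
  by have := integrable_gaussv 0 b0; under [X in _.-integrable _ (_ \o X)]eq_fun do rewrite subr0.
have iwQ : (@lebesgue_cV R k).-integrable setT (EFin \o (fun t => gaussv b t * osc_sqr (phase t) g)).
  have -> : (fun t => gaussv b t * osc_sqr (phase t) g) = (fun t => osc_sqr (phase t) g * gaussv b t).
    by apply/funext => t; rewrite mulrC.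
  apply: (@integrable_bounded_mul _ _ R lebesgue_cV _ _ (M ^+ 2 + M ^+ 2)) => //.
  - exact: measurable_osc_sqr_phase.
  - move=> t; rewrite ger0_norm ?osc_sqr_ge0//.
    have mp := measurable_phaser t.
    have h1 := osc_le mp ig.
    have h2 := osc_le (measurable_funB mp (measurable_cst (pi / 2))) ig.
    rewrite /osc_sqr -(real_normK (num_real (osc (phase t) g))).
    rewrite -(real_normK (num_real (osc (fun x => phase t x - pi / 2) g))).
    by apply: lerD; apply: lerXn2r => //; rewrite nnegrE ?normr_ge0// fine_ge0// integral_ge0.
rewrite -EFin_Rintegral// gaussv_osc_sqr//.
pose J x := \int[lebesgue_cV]_y (g y * (kernv b (Phi x - Phi y) * cos (alpha x - alpha y))).
pose P := \prod_i (Num.sqrt (b i 0))^-1.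
have kP x : `|kernv b x| <= P.
  rewrite ger0_norm ?kernv_ge0// /kernv ler_piMr//.
    by rewrite prodr_ge0// => i _; rewrite invr_ge0 sqrtr_ge0.
  by apply: gaussv_le1 => i; rewrite mxE invr_gt0.
have mkc : measT (fun z : 'cV[R]_d * 'cV[R]_d => kernv b (Phi z.1 - Phi z.2) * cos (alpha z.1 - alpha z.2)).
  apply: measurable_funM => //; apply: measurableT_comp; first exact: measurable_cos.
  by apply: measurable_funB; exact: measurableT_comp malpha _.
have kcP z : `|kernv b (Phi z.1 - Phi z.2) * cos (alpha z.1 - alpha z.2)| <= P.
  rewrite normrM; apply: le_trans (kP (Phi z.1 - Phi z.2)).
  by rewrite ler_piMr// normr_cos_le1.
have iJ x : intT lebesgue_cV (fun y => g y * (kernv b (Phi x - Phi y) * cos (alpha x - alpha y))).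
  have := @integrable_bounded_mul _ _ R lebesgue_cV (fun y => kernv b (Phi x - Phi y) * cos (alpha x - alpha y)) g P
     (measurableT_comp mkc (pair1_measurable x)) (fun y => kcP (x, y)) ig.
  by congr (_.-integrable _ _); apply/funext => y /=; rewrite mulrC.
have Jle x : (`|J x|%:E <= \int[lebesgue_cV]_y (`|g y| * kernv b (Phi x - Phi y))%:E)%E.
  apply: le_trans (le_norm_Rintegral_fin (iJ x)) _.
  apply: ge0_le_integralW => y _ //.
  rewrite lee_fin normrM ler_wpM2l// normrM ger0_norm ?kernv_ge0// ler_piMr ?kernv_ge0//.
  exact: normr_cos_le1.
have mJ : measT J.
  apply: (measurable_Rintegral_param lebesgue_cV
    (F := fun z : 'cV[R]_d * 'cV[R]_d => g z.2 * (kernv b (Phi z.1 - Phi z.2) * cos (alpha z.1 - alpha z.2)))).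
  by apply: measurable_funM => //; exact: measurableT_comp mg _.
have JP x : `|J x| <= P * M.
  have -> : P * M = fine (\int[lebesgue_cV]_y (P * `|g y|)%:E)%E.
    under eq_integral do rewrite EFinM.
    rewrite ge0_integralZl//.
    + rewrite fineM//; have /integrableP[_ goo] := ig.
      by rewrite ge0_fin_numE// integral_ge0.
    + by apply/measurable_EFinP; exact: measurableT_comp mg.
    + by rewrite lee_fin prodr_ge0// => i _; rewrite invr_ge0 sqrtr_ge0.
  have iPg : intT lebesgue_cV (fun y => P * `|g y|).
    by apply: integrable_scale; exact: integrable_norm ig.
  rewrite -/(Rintegral _ _ _) -lee_fin (EFin_Rintegral iPg).
  apply: le_trans (le_norm_Rintegral_fin (iJ x)) _.
  apply: ge0_le_integralW => y _ //.
  by rewrite lee_fin normrM mulrC ler_wpM2r//; exact: (kcP (x, y)).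
have igJ : intT lebesgue_cV (fun x => g x * J x).
  have := @integrable_bounded_mul _ _ R lebesgue_cV J g (P * M) mJ JP ig.
  by congr (_.-integrable _ _); apply/funext => y /=; rewrite mulrC.
apply: le_trans (schur_test mK K0 Ks mg KA).
apply: (@le_trans _ _ `|\int[lebesgue_cV]_x (g x * J x)|%:E).
  by rewrite lee_fin ler_norm.
apply: le_trans (le_norm_Rintegral_fin igJ) _.
apply: ge0_le_integralW => x _ //.
rewrite normrM EFinM.
apply: (@le_trans _ _ (`|g x|%:E * \int[lebesgue_cV]_y (`|g y| * kernv b (Phi x - Phi y))%:E)%E).
  by apply: lee_wpmul2l => //; rewrite lee_fin.
rewrite -ge0_integralZl//; first last.
- by move=> y _; rewrite lee_fin mulr_ge0// kernv_ge0.
- apply/measurable_EFinP; apply: measurable_funM; first exact: measurableT_comp mg.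
  exact: (measurableT_comp mk (pair1_measurable x)).
apply: ge0_le_integralW => y _.
  by rewrite -EFinM lee_fin; do 2 apply: mulr_ge0 => //; exact: kernv_ge0.
rewrite -EFinM lee_fin mulrA /K/= !indicE.
have [xD|xD] := pselect (D x); last by rewrite gD// normr0 !mul0r.
have [yD|yD] := pselect (D y); last by rewrite [g y]gD// normr0 !(mulr0, mul0r).
by rewrite !mem_set// !mulr1.
Qed.

(** The weight is removed by Fatou's lemma as [delta = 1 / (n + 1)] tends to zero, hence the demand
    that the row bound [A] be uniform in [delta]. *)
Lemma osc_sqr_le (b : 'cV[R]_k) (D : set 'cV[R]_d) (A : R) : posv b -> measurable D ->
  (forall x, ~ D x -> g x = 0) ->
  (forall (delta : R) x, 0 < delta -> D x ->
    (\int[lebesgue_cV]_(y in D) (kernv (delta *: b) (Phi x - Phi y))%:E <= A%:E)%E) ->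
  0 <= A ->
  (\int[lebesgue_cV]_t (osc_sqr (phase t) g)%:E <=
   A%:E * \int[lebesgue_cV]_x (g x ^+ 2)%:E)%E.
Proof.
move=> b0 mD gD DA A0.
have d0 n : 0 < n.+1%:R^-1 :> R by rewrite invr_gt0.
have bn n : posv (n.+1%:R^-1 *: b) by move=> i; rewrite mxE mulr_gt0.
pose F n (t : 'cV[R]_k) := (gaussv (n.+1%:R^-1 *: b) t * osc_sqr (phase t) g)%:E.
have mF n : measT (F n).
  apply/measurable_EFinP; apply: measurable_funM; first exact: measurable_gaussv.
  exact: measurable_osc_sqr_phase.
have F0 n t : setT t -> (0 <= F n t)%E.
  by move=> _; rewrite lee_fin mulr_ge0 ?osc_sqr_ge0// gaussv_ge0.
have FA n : (\int[lebesgue_cV]_t F n t <= A%:E * \int[lebesgue_cV]_x (g x ^+ 2)%:E)%E.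
  by apply: (@gaussv_osc_sqr_le _ D) => // x Dx; exact: DA.
have := fatou lebesgue_cV measurableT mF F0.
have lF t : limn_einf (F ^~ t) = (osc_sqr (phase t) g)%:E.
  have : F n t @[n --> \oo] --> (osc_sqr (phase t) g)%:E; last first.
    by move/cvg_limn_einf_sup => -[].
  apply: cvg_EFin; first exact: nearW.
  rewrite /comp/= -[X in _ --> X]mul1r; apply: cvgM; last exact: cvg_cst.
  rewrite -[X in _ --> X]expR0 /gaussv; apply: continuous_cvg; first exact: continuous_expR.
  have -> : (fun n => - (pi * \sum_i (n.+1%:R^-1 *: b) i 0 * t i 0 ^+ 2)) =
    (fun n => (- (pi * \sum_i b i 0 * t i 0 ^+ 2)) * n.+1%:R^-1).
    apply/funext => n; rewrite mulNr -mulrA mulr_suml; congr (- (_ * _)).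
    by apply: eq_bigr => i _; rewrite mxE; ring.
  rewrite -[X in _ --> X](mulr0 (- (pi * \sum_i b i 0 * t i 0 ^+ 2))).
  by apply: cvgM; [exact: cvg_cst|exact: cvg_harmonic].
under eq_integral do rewrite lF.
move/le_trans; apply.
rewrite limn_einf_lim; apply: lime_le; first exact: is_cvg_einfs.
apply: nearW => n; apply: le_trans (FA n).
by apply: ereal_inf_lbound; exists n => /=.
Qed.

End core.
End phase.
End oscillating.

Section plancherel.
Context (R : realType).

(* When [Phi] expands distances, the kernel in the weighted identity is dominated by an isotropic Gaussian of mass independent of the weight. *)
Lemma osc_sqr_expansive d (Phi : 'cV[R]_d -> 'cV[R]_d) (alpha g : 'cV[R]_d -> R)
    (b : 'cV[R]_d) (c0 : R) (D : set 'cV[R]_d) :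
  measT Phi -> measT alpha ->
  intT lebesgue_cV g ->
  posv b -> 0 < c0 -> measurable D ->
  (forall x, ~ D x -> g x = 0) ->
  (forall x y, D x -> D y ->
    c0 * dotv (x - y) (x - y) <= \sum_i (b i 0)^-1 * (Phi x - Phi y) i 0 ^+ 2) ->
  (\int[lebesgue_cV]_t (osc_sqr (phase Phi alpha t) g)%:E <=
   (\prod_i (Num.sqrt (b i 0 * c0))^-1)%:E * \int[lebesgue_cV]_x (g x ^+ 2)%:E)%E.
Proof.
move=> mPhi malpha ig b0 c00 mD gD expand.
apply: (osc_sqr_le mPhi malpha ig b0 mD gD); last first.
  by rewrite prodr_ge0// => i _; rewrite invr_ge0 sqrtr_ge0.
move=> delta x d0 Dx.
pose P := \prod_i (Num.sqrt ((delta *: b) i 0))^-1.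
have P0 : 0 <= P by rewrite prodr_ge0// => i _; rewrite invr_ge0 sqrtr_ge0.
(* Expansion turns the kernel into a Gaussian of parameter [c0 / delta]. Its mass cancels the
   [delta] of the normalization: [(delta b_i) (c0 / delta) = b_i c0]. *)
pose c : 'cV[R]_d := const_mx (c0 / delta).
have c0' : posv c by move=> i; rewrite mxE divr_gt0.
apply: (@le_trans _ _ (\int[lebesgue_cV]_y (P * gaussv c (y - x))%:E)%E).
  rewrite integral_mkcond; apply: ge0_le_integralW => y _.
    rewrite patchE; case: ifPn => // _; rewrite lee_fin kernv_ge0// => i.
    by rewrite mxE mulr_gt0.
  rewrite patchE; case: ifPn => [/set_mem Dy|_]; last first.
    by rewrite lee_fin mulr_ge0// gaussv_ge0.
  rewrite lee_fin /kernv -/P ler_wpM2l// /gaussv ler_expR lerN2 ler_wpM2l ?pi_ge0//.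
  have -> : \sum_i invv (delta *: b) i 0 * (Phi x - Phi y) i 0 ^+ 2 =
     delta^-1 * \sum_i (b i 0)^-1 * (Phi x - Phi y) i 0 ^+ 2.
    rewrite mulr_sumr; apply: eq_bigr => i _; rewrite !mxE invfM -!mulrA//.
  have -> : \sum_i c i 0 * (y - x) i 0 ^+ 2 = delta^-1 * (c0 * dotv (x - y) (x - y)).
    rewrite /dotv !mulr_sumr; apply: eq_bigr => i _; rewrite !mxE; ring.
  by rewrite ler_wpM2l ?invr_ge0 ?(ltW d0)//; exact: expand.
under eq_integral do rewrite EFinM.
rewrite ge0_integralZl//; first last.
- by move=> y _; rewrite lee_fin gaussv_ge0.
- by apply/measurable_EFinP; exact: measurable_gaussvB.
rewrite integral_gaussv// -EFinM lee_fin /P -big_split/= le_eqVlt; apply/orP; left; apply/eqP.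
apply: eq_bigr => i _; rewrite !mxE -invfM -sqrtrM; last first.
  by rewrite mulr_ge0// ltW.
congr (Num.sqrt _)^-1; have dn : delta != 0 by rewrite gt_eqF.
by field.
Qed.

Section bernstein.
Context (d k : nat) (Phi : 'cV[R]_d -> 'cV[R]_k) (alpha g : 'cV[R]_d -> R).
Variables (c : 'cV[R]_k) (rho : R).
Hypothesis mPhi : measT Phi.
Hypothesis malpha : measT alpha.
Hypothesis ig : intT lebesgue_cV g.
Hypothesis rho0 : 0 < rho.
Hypothesis supp : forall x, g x != 0 -> dotv (Phi x - c) (Phi x - c) <= rho ^+ 2.

(** Division by a Gaussian of width [rho] in [Phi - c]. On the support of [g] this costs at most a
    factor [e^pi], so L^2 bounds survive. *)
Definition gauss_amplify (x : 'cV[R]_d) : R :=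
  g x * expR (pi * (dotv (Phi x - c) (Phi x - c) / rho ^+ 2)).

Lemma gauss_amplify_le x : `|gauss_amplify x| <= expR pi * `|g x|.
Proof.
rewrite /gauss_amplify normrM (ger0_norm (expR_ge0 _)) mulrC.
have [->|gx] := eqVneq (g x) 0; first by rewrite normr0 !mulr0.
rewrite ler_wpM2r// ler_expR ger_pMr ?pi_gt0// ler_pdivrMr ?exprn_gt0// mul1r.
exact: supp.
Qed.

Let mg : measT g. Proof. exact: integrable_measurable ig. Qed.

Lemma measurable_gauss_amplify : measT gauss_amplify.
Proof.
apply: measurable_funM => //; apply: (measurableT_comp (@measurable_expR R)).
apply: measurable_funM => //; apply: measurable_funM => //.
by apply: measurable_dotv; apply: measurable_subv.
Qed.

Lemma integrable_gauss_amplify : intT lebesgue_cV gauss_amplify.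
Proof.
apply: (@integrable_le _ _ _ _ _ (fun x => expR pi * `|g x|)).
- exact: measurable_gauss_amplify.
- exact: gauss_amplify_le.
- have /integrableP[_] := integrable_scale (expR pi) (integrable_norm ig).
  apply: le_lt_trans; apply: ge0_le_integralW => x _ /=.
    by rewrite lee_fin mulr_ge0// expR_ge0.
  by rewrite lee_fin ler_norm.
Qed.

Let Psi x := Phi x - c.
Let mPsi : measT Psi. Proof. exact: measurable_subv. Qed.

(* [g] is [gauss_amplify] times a Gaussian in [Phi - c], so the oscillating integral of [g] is a convolution of the one of [gauss_amplify] with a Gaussian. *)
Let osc_conv (beta : R) (x : 'cV[R]_k) :
  osc (fun y => phase Psi alpha x y + beta) g =
  rho ^+ k * \int[lebesgue_cV]_t (gaussv (const_mx (rho ^+ 2)) (t - x) *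
     osc (fun y => phase Psi alpha t y + beta) gauss_amplify).
Proof.
pose b : 'cV[R]_k := const_mx (rho ^+ 2).
have b0 : posv b by move=> i; rewrite mxE exprn_gt0.
have mph : measT (fun z : 'cV[R]_k * 'cV[R]_d => cos (phase Psi alpha z.1 z.2 + beta)).
  apply: measurableT_comp; first exact: measurable_cos.
  by apply: measurable_funD => //; exact: measurable_phase2.
have K1 (z : 'cV[R]_k * 'cV[R]_d) : `|cos (phase Psi alpha z.1 z.2 + beta)| <= 1 by exact: normr_cos_le1.
rewrite (Rintegral_swap (integrable_gaussv x b0) integrable_gauss_amplify mph K1).
have E y : \int[lebesgue_cV]_t (cos (phase Psi alpha t y + beta) * gaussv b (t - x)) =
   kernv b (Psi y) * cos (phase Psi alpha x y + beta).
  rewrite /phase -addrA -(gaussv_fourier x (Psi y) (alpha y + beta) b0).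
  by apply: eq_Rintegral => t _; rewrite mulrC addrA.
under [in RHS]eq_Rintegral do rewrite E.
have rk : rho ^+ k * \prod_(i < k) (Num.sqrt (b i 0))^-1 = 1.
  rewrite -[X in rho ^+ X](card_ord k) -prodr_const -big_split/= big1// => i _.
  by rewrite mxE sqrtr_sqr gtr0_norm// divff// gt_eqF.
have -> : osc (fun y => phase Psi alpha x y + beta) g =
  \int[lebesgue_cV]_y (rho ^+ k * (gauss_amplify y * (kernv b (Psi y) * cos (phase Psi alpha x y + beta)))).
  apply: eq_Rintegral => y _.
  have -> : g y = gauss_amplify y * gaussv (invv b) (Psi y).
    rewrite /gauss_amplify /gaussv -mulrA -expRD.
    have -> : \sum_i invv b i 0 * Psi y i 0 ^+ 2 = dotv (Psi y) (Psi y) / rho ^+ 2.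
      rewrite /dotv mulr_suml; apply: eq_bigr => i _; rewrite !mxE; ring.
    by rewrite subrr expR0 mulr1.
  rewrite /kernv -[LHS]mul1r -[X in X * _ = _]rk; ring.
rewrite RintegralZl//.
have mk : measT (fun y => kernv b (Psi y) * cos (phase Psi alpha x y + beta)).
  apply: measurable_funM; last exact: (measurableT_comp mph (pair1_measurable x)).
  by apply: measurable_funM => //; exact: measurable_gaussv.
have := @integrable_bounded_mul _ _ R lebesgue_cV (fun y => kernv b (Psi y) * cos (phase Psi alpha x y + beta))
  gauss_amplify (\prod_(i < k) (Num.sqrt (b i 0))^-1) mk _ integrable_gauss_amplify.
have -> : (fun y => kernv b (Psi y) * cos (phase Psi alpha x y + beta) * gauss_amplify y) =
  (fun y => gauss_amplify y * (kernv b (Psi y) * cos (phase Psi alpha x y + beta))).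
  by apply/funext => y; rewrite mulrC.
apply => y; rewrite normrM (ger0_norm (kernv_ge0 _ b0)).
have P0 : 0 <= \prod_(i < k) (Num.sqrt (b i 0))^-1.
  by rewrite prodr_ge0// => i _; rewrite invr_ge0 sqrtr_ge0.
apply: (@le_trans _ _ (kernv b (Psi y))).
  by rewrite ler_piMr ?kernv_ge0// normr_cos_le1.
rewrite /kernv ler_piMr//; apply: gaussv_le1 => i; by rewrite mxE invr_gt0.
Qed.

(** Cauchy-Schwarz in the convolution of [osc_conv]. *)
Let osc_sup (beta : R) (x : 'cV[R]_k) :
  ((osc (fun y => phase Psi alpha x y + beta) g ^+ 2)%:E <= (rho ^+ k)%:E *
   \int[lebesgue_cV]_t ((osc (fun y => phase Psi alpha t y + beta) gauss_amplify) ^+ 2)%:E)%E.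
Proof.
pose b : 'cV[R]_k := const_mx (rho ^+ 2).
have b0 : posv b by move=> i; rewrite mxE exprn_gt0.
pose w t := rho ^+ k * gaussv b (t - x).
pose v t := osc (fun y => phase Psi alpha t y + beta) gauss_amplify.
have mv : measT v by apply: measurable_osc_phase => //; exact: measurable_gauss_amplify.
have mw : measT w by apply: measurable_funM => //; exact: measurable_gaussvB.
have ivw0 : intT lebesgue_cV (fun t => v t * gaussv b (t - x)).
  apply: (@integrable_bounded_mul _ _ R lebesgue_cV v _ (fine (\int[lebesgue_cV]_x `|gauss_amplify x|%:E)%E)) => //.
    move=> t; apply: osc_le; last exact: integrable_gauss_amplify.
    by apply: measurable_funD => //; exact: measurable_phaser.
  exact: integrable_gaussv.
have ivw : intT lebesgue_cV (fun t => v t * w t).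
  have -> : (fun t => v t * w t) = (fun t => rho ^+ k * (v t * gaussv b (t - x))).
    by apply/funext => t; rewrite /w; ring.
  exact: integrable_scale.
have -> : osc (fun y => phase Psi alpha x y + beta) g = \int[lebesgue_cV]_t (v t * w t).
  rewrite osc_conv -RintegralZl//.
    by apply: eq_Rintegral => t _; rewrite /w /v; ring.
  move: ivw0; congr (_.-integrable _ _); apply/funext => t /=; by rewrite mulrC.
(* Squaring doubles the Gaussian parameter, so the integral is [rho^(2k)] times [(2 rho^2)^(-k/2)],
   that is [2^(-k/2) rho^k]. *)
have w2 : (\int[lebesgue_cV]_t (w t ^+ 2)%:E <= (rho ^+ k)%:E)%E.
  pose b2 : 'cV[R]_k := const_mx (rho ^+ 2 *+ 2).
  have b20 : posv b2 by move=> i; rewrite mxE mulrn_wgt0// exprn_gt0.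
  have -> : (\int[lebesgue_cV]_t (w t ^+ 2)%:E = \int[lebesgue_cV]_t ((rho ^+ k) ^+ 2 * gaussv b2 (t - x))%:E)%E.
    apply: eq_integral => t _; rewrite /w exprMn; congr (_ * _)%:E.
    rewrite /gaussv expr2 -expRD; congr expR; rewrite -opprD -mulrDr -big_split/=.
    by congr (- (_ * _)); apply: eq_bigr => i _; rewrite !mxE; ring.
  under eq_integral do rewrite EFinM.
  rewrite ge0_integralZl//; first last.
  - by rewrite lee_fin sqr_ge0.
  - by move=> y _; rewrite lee_fin gaussv_ge0.
  - by apply/measurable_EFinP; exact: measurable_gaussvB.
  rewrite integral_gaussv// -EFinM lee_fin expr2 -mulrA ger_pMr ?exprn_gt0//.
  rewrite -[X in rho ^+ X](card_ord k) -prodr_const -big_split/=.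
  apply: prodr_ile1 => i _; rewrite mxE.
  have s0 : 0 < Num.sqrt (rho ^+ 2 *+ 2) by rewrite sqrtr_gt0 mulrn_wgt0// exprn_gt0.
  rewrite divr_ge0 ?(ltW rho0) ?(ltW s0)//= ler_pdivrMr// mul1r.
  rewrite -[leLHS](ger0_norm (ltW rho0)) -sqrtr_sqr ler_wsqrtr// mulr2n lerDl sqr_ge0//.
have cs := integral_mul_sqr_le lebesgue_cV mv mw.
have vw := le_norm_Rintegral_fin ivw.
rewrite -real_normK ?num_real// expr2 EFinM.
apply: (@le_trans _ _ (\int[lebesgue_cV]_x `|v x * w x|%:E * \int[lebesgue_cV]_x `|v x * w x|%:E)%E).
  by apply: lee_pmul => //; rewrite lee_fin.
apply: (le_trans cs); rewrite muleC; apply: lee_wpmul2r => //.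
by apply: integral_ge0 => t _; rewrite lee_fin sqr_ge0.
Qed.

Lemma bernstein (x : 'cV[R]_k) :
  ((osc_sqr (phase Phi alpha x) g)%:E <= (rho ^+ k)%:E *
   \int[lebesgue_cV]_t (osc_sqr (phase Phi alpha t) gauss_amplify)%:E)%E.
Proof.
(* Recentring [Phi] at [c] multiplies the complex integral by a number of modulus one. *)
have shift (h : 'cV[R]_d -> R) t : intT lebesgue_cV h ->
    osc_sqr (phase Phi alpha t) h = osc_sqr (phase Psi alpha t) h.
  move=> ih; rewrite -(osc_sqrD (2 * pi * dotv t c) (measurable_phaser mPsi malpha t) ih).
  congr osc_sqr; apply/funext => y; rewrite /phase /Psi addrAC -mulrDr.
  congr (_ * _ + _); rewrite /dotv -big_split/=; apply: eq_bigr => i _.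
  by rewrite !mxE -mulrDr subrK.
rewrite shift//.
under eq_integral do rewrite (shift _ _ integrable_gauss_amplify).
rewrite /osc_sqr.
under eq_integral do rewrite EFinD.
have m1 (beta : R) : measT (fun t => (osc (fun y => phase Psi alpha t y + beta) gauss_amplify ^+ 2)%:E).
  apply/measurable_EFinP; apply: measurable_funX; apply: measurable_osc_phase => //.
  exact: measurable_gauss_amplify.
have m0 : measT (fun t => (osc (phase Psi alpha t) gauss_amplify ^+ 2)%:E).
  by have := m1 0; under eq_fun do under eq_fun do rewrite addr0.
rewrite ge0_integralD//; first last.
- by move=> t _; rewrite lee_fin sqr_ge0.
- by move=> t _; rewrite lee_fin sqr_ge0.
rewrite ge0_muleDr; first last.
- by apply: integral_ge0 => t _; rewrite lee_fin sqr_ge0.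
- by apply: integral_ge0 => t _; rewrite lee_fin sqr_ge0.
rewrite EFinD; apply: leeD; last exact: (osc_sup (- (pi / 2)) x).
have e0 t : phase Psi alpha t = (fun y => phase Psi alpha t y + 0).
  by apply/funext => y; rewrite addr0.
under eq_integral do rewrite e0.
by rewrite e0; exact: (osc_sup 0 x).
Qed.

End bernstein.
End plancherel.

(** * Euclidean geometry *)

Section euclidean_norm.
Context (R : realType) (d : nat).
Implicit Types x y z : 'cV[R]_d.

Lemma dotvC x y : dotv x y = dotv y x.
Proof. by apply: eq_bigr => i _; rewrite mulrC. Qed.

Lemma dotvDl x y z : dotv (x + y) z = dotv x z + dotv y z.
Proof. by rewrite /dotv -big_split/=; apply: eq_bigr => i _; rewrite mxE mulrDl. Qed.

Lemma dotvZl (a : R) x y : dotv (a *: x) y = a * dotv x y.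
Proof. by rewrite /dotv mulr_sumr; apply: eq_bigr => i _; rewrite mxE mulrA. Qed.

Lemma dotvNl x y : dotv (- x) y = - dotv x y.
Proof. by rewrite -scaleN1r dotvZl mulN1r. Qed.

Lemma dotvBl x y z : dotv (x - y) z = dotv x z - dotv y z.
Proof. by rewrite dotvDl dotvNl. Qed.

Lemma dotvDr x y z : dotv x (y + z) = dotv x y + dotv x z.
Proof. by rewrite !(dotvC x) dotvDl. Qed.

Lemma dotvZr (a : R) x y : dotv x (a *: y) = a * dotv x y.
Proof. by rewrite !(dotvC x) dotvZl. Qed.

Lemma dotvBr x y z : dotv x (y - z) = dotv x y - dotv x z.
Proof. by rewrite !(dotvC x) dotvBl. Qed.

Lemma dotv_ge0 x : 0 <= dotv x x.
Proof. by rewrite sumr_ge0// => i _; rewrite -expr2 sqr_ge0. Qed.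

Lemma enorm_ge0 x : 0 <= enorm x. Proof. exact: sqrtr_ge0. Qed.

Lemma enorm_sqr x : enorm x ^+ 2 = dotv x x.
Proof. by rewrite sqr_sqrtr// dotv_ge0. Qed.

Lemma dotv_eq0 x : dotv x x = 0 -> x = 0.
Proof.
move/eqP; rewrite psumr_eq0; last by move=> i _; rewrite -expr2 sqr_ge0.
move/allP => h; apply/colP => i; rewrite mxE.
by have := h i (mem_index_enum i); rewrite /= mulf_eq0 orbb => /eqP.
Qed.

Lemma enorm_eq0 x : enorm x = 0 -> x = 0.
Proof. by move=> h; apply: dotv_eq0; rewrite -enorm_sqr h expr0n. Qed.

Lemma enorm0 : enorm (0 : 'cV[R]_d) = 0.
Proof. by rewrite /enorm /dotv big1 ?sqrtr0// => i _; rewrite mxE mul0r. Qed.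

Lemma dotv_cauchy_schwarz x y : dotv x y ^+ 2 <= dotv x x * dotv y y.
Proof.
have [y0|y0] := eqVneq (dotv y y) 0.
  by rewrite (dotv_eq0 y0) -(scale0r 0) !dotvZr !mul0r mulr0 expr0n.
have yp : 0 < dotv y y by rewrite lt_neqAle eq_sym y0 dotv_ge0.
have := dotv_ge0 (dotv y y *: x - dotv x y *: y).
rewrite dotvBl !dotvBr !dotvZl !dotvZr (dotvC y x).
set a := dotv y y; set b := dotv x y; set c := dotv x x.
have -> : a * (a * c) - a * (b * b) - (b * (a * b) - b * (b * a)) = a * (c * a - b ^+ 2) by ring.
by rewrite pmulr_rge0// subr_ge0.
Qed.

Lemma normr_dotv_le x y : `|dotv x y| <= enorm x * enorm y.
Proof.
rewrite -[leRHS]ger0_norm; last by rewrite mulr_ge0// enorm_ge0.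
by rewrite -ler_sqr ?nnegrE// !real_normK ?num_real// exprMn !enorm_sqr dotv_cauchy_schwarz.
Qed.

Lemma enorm_triangle x y : enorm (x + y) <= enorm x + enorm y.
Proof.
rewrite -ler_sqr ?nnegrE ?addr_ge0 ?enorm_ge0//.
rewrite enorm_sqr dotvDl !dotvDr (dotvC y x) sqrrD !enorm_sqr.
have := normr_dotv_le x y; have := ler_norm (dotv x y); lra.
Qed.

Lemma enormZ (a : R) x : enorm (a *: x) = `|a| * enorm x.
Proof. by rewrite /enorm dotvZl dotvZr mulrA -expr2 sqrtrM ?sqr_ge0// sqrtr_sqr. Qed.

Lemma enormN x : enorm (- x) = enorm x.
Proof. by rewrite -scaleN1r enormZ normrN1 mul1r. Qed.

Lemma enormB x y : enorm (x - y) = enorm (y - x).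
Proof. by rewrite -enormN opprB. Qed.

Lemma enorm_le_sqr x (r : R) : 0 <= r -> (enorm x <= r) = (dotv x x <= r ^+ 2).
Proof. by move=> r0; rewrite -enorm_sqr ler_sqr// nnegrE enorm_ge0. Qed.

Lemma coord_le_enorm x i : `|x i 0| <= enorm x.
Proof.
rewrite -ler_sqr ?nnegrE ?enorm_ge0// real_normK ?num_real// enorm_sqr.
rewrite /dotv (bigD1 i)//= -expr2 lerDl sumr_ge0// => j _; by rewrite -expr2 sqr_ge0.
Qed.

Lemma measurable_enormB (c : 'cV[R]_d) : measT (fun x : 'cV[R]_d => enorm (x - c)).
Proof.
have ms : measT (@Num.sqrt R).
  by apply: continuous_measurable_fun; exact: sqrt_continuous.
have md : measT (fun x : 'cV[R]_d => dotv (x - c) (x - c)).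
  by apply: measurable_dotv; apply: measurable_subv.
exact: (measurableT_comp ms md).
Qed.

Lemma measurable_enorm : measT (fun x : 'cV[R]_d => enorm x).
Proof.
have := measurable_enormB 0; congr (measurable_fun _ _).
by apply/funext => x; rewrite subr0.
Qed.

Definition eball (c : 'cV[R]_d) (r : R) : set 'cV[R]_d := [set x | enorm (x - c) <= r].

Lemma measurable_eball c r : measurable (eball c r).
Proof.
rewrite -[X in measurable X]setTI.
by have := measurable_enormB c measurableT (measurable_itv `]-oo, r]); rewrite set_itvE.
Qed.

End euclidean_norm.

(** * The Fourier transform of a band-limited function *)

Section complex_integrals.
Context (R : realType).

Definition rpart T (f : T -> R[i]) (x : T) : R := complex.Re (f x).

Definition ipart T (f : T -> R[i]) (x : T) : R := complex.Im (f x).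

Definition sqrn (z : R[i]) : R := complex.Re z ^+ 2 + complex.Im z ^+ 2.

Lemma sqrn_ge0 z : 0 <= sqrn z. Proof. by rewrite addr_ge0 ?sqr_ge0. Qed.

Lemma normc_sqr (z : R[i]) : Normc.normc z ^+ 2 = sqrn z.
Proof. by case: z => a b; rewrite /= sqr_sqrtr// addr_ge0 ?sqr_ge0. Qed.

Lemma normc_nonneg (z : R[i]) : 0 <= Normc.normc z.
Proof. by case: z => a b; exact: sqrtr_ge0. Qed.

Lemma ReB (z w : R[i]) : complex.Re (z - w) = complex.Re z - complex.Re w.
Proof. by case: z w => a b [c d]. Qed.

Lemma ImB (z w : R[i]) : complex.Im (z - w) = complex.Im z - complex.Im w.
Proof. by case: z w => a b [c d]. Qed.

Lemma Re_cisM t (z : R[i]) :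
  complex.Re (cis t * z) = cos t * complex.Re z - cos (t - pi / 2) * complex.Im z.
Proof. by rewrite cosB_pihalf; case: z. Qed.

Lemma Im_cisM t (z : R[i]) :
  complex.Im (cis t * z) = cos (t - pi / 2) * complex.Re z + cos t * complex.Im z.
Proof. by rewrite cosB_pihalf addrC; case: z. Qed.

Lemma cisM (s t : R) : cis s * cis t = cis (s + t).
Proof. by rewrite /cis cosD sinD; congr (_ +i* _); rewrite addrC. Qed.

Lemma complexP (z w : R[i]) : complex.Re z = complex.Re w -> complex.Im z = complex.Im w -> z = w.
Proof. by case: z w => a b [c d] /= -> ->. Qed.

Lemma cLnorm2_sqr d (T : measurableType d) (mu : {measure set T -> \bar R}) (f : T -> R[i]) :
  (cLnorm mu 2%:E f * cLnorm mu 2%:E f = \int[mu]_x (sqrn (f x))%:E)%E.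
Proof.
rewrite /cLnorm; set h := (fun x => _).
have E := poweR_Lnorm mu h (lt0r_neq0 (ltr0n R 2)).
have -> : (Lnorm mu 2%:E h * Lnorm mu 2%:E h = (Lnorm mu 2%:E h) `^ 2)%E.
  have := Lnorm_ge0 mu 2%:E h.
  case: (Lnorm mu 2%:E h) => [r||] //; last by rewrite poweRyr// mulyy.
  by rewrite lee_fin poweR_EFin -EFinM => r0; rewrite powR_mulrn// expr2.
rewrite E; apply: eq_integral => x _ /=.
by rewrite powR_mulrn// real_normK ?num_real// normc_sqr.
Qed.

Section cis_integral.
Context (d : nat) (phi : 'cV[R]_d -> R) (G : 'cV[R]_d -> R[i]).
Hypothesis mphi : measT phi.
Hypothesis iRe : intT lebesgue_cV (rpart G).
Hypothesis iIm : intT lebesgue_cV (ipart G).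
Let I := cintegral lebesgue_cV setT (fun x => cis (phi x) * G x).

Let mphi' : measT (fun x => phi x - pi / 2).
Proof. exact: measurable_funB. Qed.

Lemma Re_cis_integral : complex.Re I =
  osc phi (rpart G) - osc (fun x => phi x - pi / 2) (ipart G).
Proof.
rewrite /I/= /osc -RintegralB//; try exact: integrable_cos_mul.
by apply: eq_Rintegral => x _; rewrite Re_cisM.
Qed.

Lemma Im_cis_integral : complex.Im I =
  osc (fun x => phi x - pi / 2) (rpart G) + osc phi (ipart G).
Proof.
rewrite /I/= /osc -RintegralD//; try exact: integrable_cos_mul.
by apply: eq_Rintegral => x _; rewrite Im_cisM.
Qed.

Lemma sqrn_cis_integral :
  sqrn I <= 2 * (osc_sqr phi (rpart G) + osc_sqr phi (ipart G)).
Proof.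
rewrite /sqrn Re_cis_integral Im_cis_integral /osc_sqr.
set a := osc _ _; set b := osc _ _; set c := osc _ _; set e := osc _ _.
have := sqr_ge0 (a + b); have := sqr_ge0 (c - e); rewrite sqrrB sqrrD => h1 h2.
rewrite sqrrB sqrrD; lra.
Qed.

End cis_integral.

Lemma eq_cintegral d (T : measurableType d) (mu : {measure set T -> \bar R}) (f g : T -> R[i]) :
  (forall x, f x = g x) -> cintegral mu setT f = cintegral mu setT g.
Proof. by move=> /funext ->. Qed.

End complex_integrals.

(** On the ball, [e^(pi r^2)] times a Gaussian is at least one; no volume is computed. *)
Lemma integrable_eball (R : realType) d (c : 'cV[R]_d) (r : R) :
  intT lebesgue_cV (\1_(eball c r) : 'cV[R]_d -> R).
Proof.
have ones_gt0 : posv (const_mx 1 : 'cV[R]_d) by move=> i; rewrite mxE.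
apply: (@integrable_le _ _ R lebesgue_cV (\1_(eball c r)) (fun x => expR (pi * r ^+ 2) * gaussv (const_mx 1) (x - c))).
- by apply: measurable_indic; exact: measurable_eball.
- move=> x; rewrite indicE ger0_norm//; case: (boolP (x \in _)) => [/set_mem xr|_]; last first.
    by rewrite mulr_ge0 ?expR_ge0// gaussv_ge0.
  rewrite /gaussv -expRD -[leLHS]expR0 ler_expR -mulrN -mulrDr mulr_ge0 ?pi_ge0// subr_ge0.
  have -> : \sum_i (const_mx 1 : 'cV[R]_d) i 0 * (x - c) i 0 ^+ 2 = dotv (x - c) (x - c).
    by apply: eq_bigr => i _; rewrite mxE mul1r expr2.
  rewrite -enorm_sqr lerXn2r// nnegrE ?enorm_ge0//.
  exact: le_trans (enorm_ge0 _) xr.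
- have /integrableP[_] := integrable_scale (expR (pi * r ^+ 2)) (integrable_gaussv c ones_gt0).
  apply: le_lt_trans; apply: ge0_le_integralW => x _ /=.
    by rewrite lee_fin mulr_ge0 ?expR_ge0// gaussv_ge0.
  by rewrite lee_fin ler_norm.
Qed.

Lemma kernv_const_le (R : realType) k (b r : R) (x : 'cV[R]_k) : 0 < b -> r ^+ 2 <= dotv x x ->
  kernv (const_mx b) x <= (Num.sqrt b)^-1 ^+ k * expR (- (pi * (b^-1 * r ^+ 2))).
Proof.
move=> b0 rx; rewrite /kernv.
have -> : \prod_(i < k) (Num.sqrt ((const_mx b : 'cV[R]_k) i 0))^-1 = (Num.sqrt b)^-1 ^+ k.
  by rewrite -[X in _ ^+ X](card_ord k) -prodr_const; apply: eq_bigr => i _; rewrite mxE.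
rewrite ler_wpM2l ?exprn_ge0 ?invr_ge0 ?sqrtr_ge0// ler_expR lerN2 ler_wpM2l ?pi_ge0//.
have -> : \sum_i invv (const_mx b) i 0 * x i 0 ^+ 2 = b^-1 * dotv x x.
  by rewrite /dotv mulr_sumr; apply: eq_bigr => i _; rewrite !mxE expr2.
by rewrite ler_wpM2l// invr_ge0 ltW.
Qed.

(** Away from the origin an approximate identity tends to zero uniformly, the exponential beating
    the normalization. This will localize the transform. *)
Lemma kernv_far_le (R : realType) n (eta : R) : 0 < eta -> exists C : R, 0 <= C /\
  forall (k : nat) (x : 'cV[R]_n), eta ^+ 2 <= dotv x x ->
    kernv (const_mx k.+1%:R^-1) x <= C * k.+1%:R^-1.
Proof.
move=> eta0; pose c := pi * eta ^+ 2.
have c0 : 0 < c by rewrite mulr_gt0 ?pi_gt0// exprn_gt0.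
(* From [e^y >= (y / (n + 1))^(n + 1)] at [y = c (k + 1)]. The normalization is at most [(k + 1)^n],
   so the spare power leaves [1 / (k + 1)]. *)
exists ((n.+1%:R / c) ^+ n.+1); split; first by rewrite exprn_ge0// divr_ge0// ltW.
move=> k x etax.
have k0 : 0 < k.+1%:R :> R by [].
have b0 : 0 < k.+1%:R^-1 :> R by rewrite invr_gt0.
apply: (le_trans (kernv_const_le b0 etax)).
rewrite invrK.
set mp : R := k.+1%:R.
have mp0 : 0 < mp by [].
have mp1 : 1 <= mp by rewrite ler1n.
have s1 : (Num.sqrt mp^-1)^-1 ^+ n <= mp ^+ n.
  apply: lerXn2r; rewrite ?nnegrE ?invr_ge0 ?sqrtr_ge0 ?(ltW mp0)//.
  rewrite sqrtrV ?(ltW mp0)// invrK -[leRHS]ger0_norm ?(ltW mp0)// -sqrtr_sqr ler_wsqrtr//.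
  by rewrite expr2 ler_peMr// ltW.
apply: (@le_trans _ _ (mp ^+ n * expR (- (pi * (mp * eta ^+ 2))))).
  by rewrite ler_wpM2r// expR_ge0.
rewrite expRN ler_pdivrMr ?expR_gt0//.
have -> : pi * (mp * eta ^+ 2) = (mp * c / n.+1%:R) *+ n.+1.
  by rewrite -mulr_natr divfK// /c; ring.
rewrite -[X in expR X]mulr_natl expRM_natl [X in _ <= X * _]mulrC.
have e0 : 0 <= mp * c / n.+1%:R by apply: divr_ge0 => //; apply: mulr_ge0; exact: ltW.
have e1 : (mp * c / n.+1%:R) ^+ n.+1 <= expR (mp * c / n.+1%:R) ^+ n.+1.
  apply: lerXn2r; rewrite ?nnegrE ?expR_ge0//.
  by apply: le_trans (expR_ge1Dx _); rewrite lerDr.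
have P0 : 0 <= mp^-1 * (n.+1%:R / c) ^+ n.+1.
  by rewrite mulr_ge0 ?invr_ge0 ?(ltW mp0)// exprn_ge0// divr_ge0// ltW.
apply: le_trans (ler_wpM2l P0 e1).
rewrite -[X in _ <= X]mulrA -exprMn.
have -> : n.+1%:R / c * (mp * c / n.+1%:R) = mp.
  have n0 : n.+1%:R != 0 :> R by rewrite pnatr_eq0.
  have aux (N q z : R) : N != 0 -> q != 0 -> N / q * (z * q / N) = z.
    by move=> N0 q0; field; rewrite N0 q0.
  by apply: aux => //; rewrite gt_eqF.
by rewrite exprS mulrA mulVf ?mul1r// gt_eqF.
Qed.

Section fourier_transform.
Context (R : realType) (d : nat).
Notation leb := (@lebesgue_cV R d).
Variables (H h G : 'cV[R]_d -> R[i]).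
Hypothesis iHr : intT leb (rpart H).
Hypothesis iHi : intT leb (ipart H).
Hypothesis H2 : (\int[leb]_x (sqrn (H x))%:E < +oo)%E.
Hypothesis hE : forall x, h x = cintegral leb setT (fun xi => cis (2 * pi * dotv x xi) * H xi).
Hypothesis hG : is_fourier h G.

Let ph0 := phase (@id 'cV[R]_d) (cst (0 : R)).
Let ph1 := phase (-%R : 'cV[R]_d -> 'cV[R]_d) (cst (0 : R)).
Let mid : measT (@id 'cV[R]_d). Proof. exact: measurable_id. Qed.
Let mopp : measT (-%R : 'cV[R]_d -> 'cV[R]_d). Proof. exact: measurable_oppv. Qed.
Let m0 : measT (cst 0 : 'cV[R]_d -> R). Proof. exact: measurable_cst. Qed.

Let hE0 x : h x = cintegral leb setT (fun xi => cis (ph0 x xi) * H xi).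
Proof. by rewrite hE; apply: eq_cintegral => xi; rewrite /ph0 /phase/= addr0. Qed.

Let ones : 'cV[R]_d := const_mx 1.
Let ones_gt0 : posv ones. Proof. by move=> i; rewrite mxE. Qed.

(** An isometry expands distances with constant one. It is used for [x] to bound [h] by [H], and for
    [- x] to bound the transform of [h] by [h]. *)
Let osc_isometry (Phi : 'cV[R]_d -> 'cV[R]_d) (alpha g : 'cV[R]_d -> R) :
  measT Phi -> measT alpha ->
  (forall x y, dotv (x - y) (x - y) = dotv (Phi x - Phi y) (Phi x - Phi y)) ->
  intT leb g ->
  (\int[leb]_t (osc_sqr (phase Phi alpha t) g)%:E <= \int[leb]_x (g x ^+ 2)%:E)%E.
Proof.
move=> mPhi malpha iso ig.
have := osc_sqr_expansive mPhi malpha ig ones_gt0 ltr01 measurableT.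
rewrite big1 ?mul1e; last by move=> i _; rewrite mxE mulr1 sqrtr1 invr1.
apply=> [x /(_ I)//|x y _ _].
rewrite mul1r iso le_eqVlt; apply/orP; left; apply/eqP; apply: eq_bigr => i _.
by rewrite !mxE invr1 mul1r expr2.
Qed.

Let iso0 (x y : 'cV[R]_d) : dotv (x - y) (x - y) = dotv (id x - id y) (id x - id y) :> R.
Proof. by []. Qed.

Let iso1 (x y : 'cV[R]_d) : dotv (x - y) (x - y) = dotv (- x - - y) (- x - - y) :> R.
Proof. by apply: eq_bigr => i _; rewrite !mxE; ring. Qed.

Let mh beta : measT (fun x => osc (fun xi => ph0 x xi + beta) (rpart H)).
Proof. by apply: measurable_osc_phase => //; exact: (integrable_measurable iHr). Qed.

Let mhi beta : measT (fun x => osc (fun xi => ph0 x xi + beta) (ipart H)).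
Proof. by apply: measurable_osc_phase => //; exact: (integrable_measurable iHi). Qed.

Let ph0_0 x : ph0 x = (fun xi => ph0 x xi + 0).
Proof. by apply/funext => xi; rewrite addr0. Qed.

Let mphase0 x : measT (ph0 x). Proof. exact: measurable_phaser. Qed.

Let mhRe : measT (rpart h).
Proof.
rewrite (_ : rpart h = (fun x => osc (fun xi => ph0 x xi + 0) (rpart H) -
   osc (fun xi => ph0 x xi + (- (pi / 2))) (ipart H))); last first.
  by apply/funext => x; rewrite {1}/rpart -ph0_0 hE0 Re_cis_integral.
exact: measurable_funB.
Qed.

Let mhIm : measT (ipart h).
Proof.
rewrite (_ : ipart h = (fun x => osc (fun xi => ph0 x xi + (- (pi / 2))) (rpart H) +
   osc (fun xi => ph0 x xi + 0) (ipart H))); last first.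
  by apply/funext => x; rewrite {1}/ipart -ph0_0 hE0 Im_cis_integral.
exact: measurable_funD.
Qed.

Let mHr : measT (rpart H). Proof. exact: (integrable_measurable iHr). Qed.
Let mHi : measT (ipart H). Proof. exact: (integrable_measurable iHi). Qed.

Let sqr_int (f : 'cV[R]_d -> R[i]) : measT (rpart f) ->
  measT (ipart f) ->
  (\int[leb]_x (sqrn (f x))%:E = \int[leb]_x (rpart f x ^+ 2)%:E + \int[leb]_x ((ipart f) x ^+ 2)%:E)%E.
Proof.
move=> mr mi; rewrite -ge0_integralD//.
- by move=> x _; rewrite lee_fin sqr_ge0.
- by apply/measurable_EFinP; exact: measurable_funX.
- by move=> x _; rewrite lee_fin sqr_ge0.
- by apply/measurable_EFinP; exact: measurable_funX.
Qed.

(** The factor 2 pays for treating the real and imaginary parts of [F] separately. *)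
Let cis_int_le (Phi : 'cV[R]_d -> 'cV[R]_d) (F : 'cV[R]_d -> R[i]) :
  measT Phi ->
  (forall x y, dotv (x - y) (x - y) = dotv (Phi x - Phi y) (Phi x - Phi y)) ->
  intT leb (rpart F) ->
  intT leb (ipart F) ->
  (\int[leb]_t (sqrn (cintegral leb setT (fun x => cis (phase Phi (cst 0) t x) * F x)))%:E
   <= 2%:E * \int[leb]_x (sqrn (F x))%:E)%E.
Proof.
move=> mPhi iso ir ii.
have mr : measT (fun t => (osc_sqr (phase Phi (cst 0) t) (rpart F))%:E).
  by apply/measurable_EFinP; apply: measurable_osc_sqr_phase => //; exact: (integrable_measurable ir).
have mi : measT (fun t => (osc_sqr (phase Phi (cst 0) t) (ipart F))%:E).
  by apply/measurable_EFinP; apply: measurable_osc_sqr_phase => //; exact: (integrable_measurable ii).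
apply: (@le_trans _ _ (\int[leb]_t (2%:E * ((osc_sqr (phase Phi (cst 0) t) (rpart F))%:E + (osc_sqr (phase Phi (cst 0) t) (ipart F))%:E)))%E).
  apply: ge0_le_integralW => t _; first by rewrite lee_fin sqrn_ge0.
  rewrite -EFinD -EFinM lee_fin; apply: sqrn_cis_integral => //.
  exact: measurable_phaser.
rewrite ge0_integralZl//; last 2 first.
- exact: emeasurable_funD.
- by move=> t _; rewrite adde_ge0// lee_fin osc_sqr_ge0.
apply: lee_wpmul2l => //.
rewrite ge0_integralD//; last 2 first.
- by move=> t _; rewrite lee_fin osc_sqr_ge0.
- by move=> t _; rewrite lee_fin osc_sqr_ge0.
rewrite sqr_int; [|exact: (integrable_measurable ir)|exact: (integrable_measurable ii)].
by apply: leeD; exact: osc_isometry.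
Qed.

Let h2 : (\int[leb]_x (sqrn (h x))%:E < +oo)%E.
Proof.
apply: (@le_lt_trans _ _ (2%:E * \int[leb]_x (sqrn (H x))%:E)%E); last first.
  by apply: lte_mul_pinfty.
have := cis_int_le mid iso0 iHr iHi.
apply: le_trans; apply: ge0_le_integralW => x _; first by rewrite lee_fin sqrn_ge0.
by rewrite hE0.
Qed.

(** [h] is bounded and square integrable but possibly not integrable, so transforms are taken of
    [w h]: with [w] the indicator of a ball to match [fourier_trunc], with [w] a Gaussian for an
    explicit formula. *)
Let wt (w : 'cV[R]_d -> R) x : R[i] := (w x * complex.Re (h x)) +i* (w x * complex.Im (h x)).
Let F w xi := cintegral leb setT (fun x => cis (ph1 xi x) * wt w x).
Let Mh := fine (\int[leb]_x `|rpart H x|%:E)%E + fine (\int[leb]_x `|ipart H x|%:E)%E.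

Let Re_bound x : `|complex.Re (h x)| <= Mh.
Proof.
rewrite hE0 Re_cis_integral//; apply: le_trans (ler_normB _ _) _; apply: lerD.
- exact: osc_le.
- by apply: osc_le => //; exact: measurable_funB.
Qed.

Let Im_bound x : `|complex.Im (h x)| <= Mh.
Proof.
rewrite hE0 Im_cis_integral//; apply: le_trans (ler_normD _ _) _; apply: lerD.
- by apply: osc_le => //; exact: measurable_funB.
- exact: osc_le.
Qed.

Let iwr w : intT leb w -> intT leb (rpart (wt w)).
Proof.
move=> iw; have := integrable_bounded_mul mhRe Re_bound iw.
by congr (_.-integrable _ _); apply/funext => x /=; rewrite mulrC.
Qed.

Let iwi w : intT leb w -> intT leb (ipart (wt w)).
Proof.
move=> iw; have := integrable_bounded_mul mhIm Im_bound iw.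
by congr (_.-integrable _ _); apply/funext => x /=; rewrite mulrC.
Qed.

Let F_le w : intT leb w ->
  (\int[leb]_xi (sqrn (F w xi))%:E <= 2%:E * \int[leb]_x (w x ^+ 2 * sqrn (h x))%:E)%E.
Proof.
move=> iw; apply: (le_trans (cis_int_le mopp iso1 (iwr iw) (iwi iw))).
apply: lee_wpmul2l => //; apply: ge0_le_integralW => x _.
  by rewrite lee_fin sqrn_ge0.
by rewrite lee_fin /sqrn/= !exprMn mulrDr.
Qed.

Let mphase1 x : measT (ph1 x). Proof. exact: measurable_phaser. Qed.

Let F_sub w w' xi : intT leb w -> intT leb w' ->
  F (fun x => w x - w' x) xi = F w xi - F w' xi.
Proof.
move=> iw iw'.
have iww : intT leb (fun x => w x - w' x).
  exact: (integrableB measurableT iw iw').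
have mp' : measT (fun x => ph1 xi x - pi / 2) by exact: measurable_funB.
have oB (phi g g' : 'cV[R]_d -> R) : measT phi -> intT leb g ->
    intT leb g' -> osc phi (fun x => g x - g' x) = osc phi g - osc phi g'.
  move=> mphi ig ig'; rewrite /osc -RintegralB//; try exact: integrable_cos_mul.
  by apply: eq_Rintegral => x _; rewrite mulrBr.
have rE : rpart (wt (fun x => w x - w' x)) = (fun x => (rpart (wt w)) x - (rpart (wt w')) x).
  by apply/funext => x; rewrite /rpart/= mulrBl.
have iE : ipart (wt (fun x => w x - w' x)) = (fun x => (ipart (wt w)) x - (ipart (wt w')) x).
  by apply/funext => x; rewrite /ipart/= mulrBl.
apply: complexP; rewrite ?ReB ?ImB /F.
- rewrite !Re_cis_integral//; try exact: iwr; try exact: iwi.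
  by rewrite rE iE !oB//; try exact: iwr; try exact: iwi; ring.
- rewrite !Im_cis_integral//; try exact: iwr; try exact: iwi.
  by rewrite rE iE !oB//; try exact: iwr; try exact: iwi; ring.
Qed.

Let B (k : nat) : set 'cV[R]_d := eball 0 k%:R.

Let mB k : measurable (B k). Proof. exact: measurable_eball. Qed.

Let truncE k xi : fourier_trunc k h xi = F (\1_(B k)) xi.
Proof.
have BE : [set x | enorm x <= k%:R] = B k.
  by apply/funext => x; rewrite /B /eball/= subr0.
apply: complexP; rewrite /fourier_trunc /F BE /=.
- rewrite Rintegral_mkcond; apply: eq_Rintegral => x _; rewrite patchE !Re_cisM /wt/= indicE.
  rewrite /ph1 /phase/= addr0.
  have -> : 2 * pi * dotv xi (- x) = - (2 * pi * dotv x xi).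
    rewrite -mulrN; congr (_ * _); rewrite /dotv -sumrN; apply: eq_bigr => i _; rewrite mxE; ring.
  rewrite cosB_pihalf -/(B k); case: (x \in B k) => /=; first by rewrite !mul1r.
  by rewrite !mul0r !mulr0 subrr.
- rewrite Rintegral_mkcond; apply: eq_Rintegral => x _; rewrite patchE !Im_cisM /wt/= indicE.
  rewrite /ph1 /phase/= addr0.
  have -> : 2 * pi * dotv xi (- x) = - (2 * pi * dotv x xi).
    rewrite -mulrN; congr (_ * _); rewrite /dotv -sumrN; apply: eq_bigr => i _; rewrite mxE; ring.
  rewrite addrC cosB_pihalf -/(B k); case: (x \in B k) => /=; first by rewrite !mul1r.
  by rewrite !mul0r !mulr0 addr0.
Qed.

Let i1 k : intT leb (\1_(B k) : 'cV[R]_d -> R). Proof. exact: integrable_eball. Qed.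

Let mF w : intT leb w ->
  measT (rpart (F w)) /\ measT (ipart (F w)).
Proof.
move=> iw.
have mr := integrable_measurable (iwr iw); have mi := integrable_measurable (iwi iw).
have p0 xi : ph1 xi = (fun x => ph1 xi x + 0) by apply/funext => x; rewrite addr0.
split.
- rewrite (_ : rpart (F w) = (fun xi => osc (fun x => ph1 xi x + 0) (rpart (wt w)) -
    osc (fun x => ph1 xi x + (- (pi / 2))) (ipart (wt w)))); last first.
    by apply/funext => x; rewrite {1}/rpart -p0 /F Re_cis_integral//; [exact: iwr|exact: iwi].
  by apply: measurable_funB; exact: measurable_osc_phase.
- rewrite (_ : ipart (F w) = (fun xi => osc (fun x => ph1 xi x + (- (pi / 2))) (rpart (wt w)) +
    osc (fun x => ph1 xi x + 0) (ipart (wt w)))); last first.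
    by apply/funext => x; rewrite {1}/ipart -p0 /F Im_cis_integral//; [exact: iwr|exact: iwi].
  by apply: measurable_funD; exact: measurable_osc_phase.
Qed.

Let msq (f : 'cV[R]_d -> R[i]) : measT (rpart f) ->
  measT (ipart f) -> measT (fun x => (sqrn (f x))%:E).
Proof.
move=> mr mi; apply/measurable_EFinP; apply: measurable_funD; exact: measurable_funX.
Qed.

Let mG : measT (rpart G) /\ measT (ipart G).
Proof. by case: hG => -[]. Qed.

Let cvg_trunc : (\int[leb]_xi (sqrn (fourier_trunc k h xi - G xi))%:E)%E @[k --> \oo] --> 0%E.
Proof.
have [_ c] := hG.
have := @cvgeM _ _ _ _ _ _ 0%E 0%E isT c c; rewrite mule0.
by under eq_fun do rewrite cLnorm2_sqr; apply.
Qed.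

Let sqrnD (z w : R[i]) : sqrn z <= 2 * sqrn (w - z) + 2 * sqrn w.
Proof.
rewrite /sqrn ReB ImB; move: (complex.Re z) (complex.Re w) (complex.Im z) (complex.Im w) => a b c e.
have := sqr_ge0 (2 * b - a); have := sqr_ge0 (2 * e - c); nra.
Qed.

Let msub (f : 'cV[R]_d -> R[i]) : measT (rpart f) ->
  measT (ipart f) -> measT (fun x => (sqrn (f x - G x))%:E).
Proof.
have [gr gi] := mG; move=> mr mi; apply: msq.
- rewrite (_ : rpart _ = (fun x => (rpart f) x - (rpart G) x)).
    exact: measurable_funB.
  by apply/funext => x; rewrite /rpart ReB.
- rewrite (_ : ipart _ = (fun x => (ipart f) x - (ipart G) x)).
    exact: measurable_funB.
  by apply/funext => x; rewrite /ipart ImB.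
Qed.

(** A limit passage through [|G|^2 <= 2 |f_k - G|^2 + 2 |f_k|^2], whose factor 2 stays in the
    conclusion. *)
Let sqrn_lim (f : nat -> 'cV[R]_d -> R[i]) (A : \bar R) (D : set 'cV[R]_d) : (0 <= A)%E ->
  measurable D ->
  (forall k, measT (rpart (f k))) -> (forall k, measT (ipart (f k))) ->
  (\int[leb]_xi (sqrn (f k xi - G xi))%:E)%E @[k --> \oo] --> 0%E ->
  (forall k, (\int[leb]_(xi in D) (sqrn (f k xi))%:E <= A)%E) ->
  (\int[leb]_(xi in D) (sqrn (G xi))%:E <= 2%:E * A)%E.
Proof.
move=> A0 mD mr mi c fA.
have step k : (\int[leb]_(xi in D) (sqrn (G xi))%:E <= 2%:E * \int[leb]_xi (sqrn (f k xi - G xi))%:E + 2%:E * A)%E.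
  apply: (@le_trans _ _ (\int[leb]_(xi in D) (2%:E * (sqrn (f k xi - G xi))%:E + 2%:E * (sqrn (f k xi))%:E))%E).
    apply: ge0_le_integralW => xi _; first by rewrite lee_fin sqrn_ge0.
    by rewrite -!EFinM -EFinD lee_fin sqrnD.
  have ms : measurable_fun D (fun xi => (sqrn (f k xi - G xi))%:E).
    by apply: measurable_funTS; exact: msub.
  have mf : measurable_fun D (fun xi => (sqrn (f k xi))%:E).
    by apply: measurable_funTS; exact: msq.
  rewrite ge0_integralD//; last 4 first.
  - by move=> x _; rewrite mule_ge0// lee_fin sqrn_ge0.
  - exact: emeasurable_funM.
  - by move=> x _; rewrite mule_ge0// lee_fin sqrn_ge0.
  - exact: emeasurable_funM.
  rewrite !ge0_integralZl//; try by move=> x _; rewrite lee_fin sqrn_ge0.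
  apply: leeD; apply: lee_wpmul2l => //.
  apply: ge0_subset_integral => //; first exact: msub.
  by move=> x _; rewrite lee_fin sqrn_ge0.
have cc : (2%:E * \int[leb]_xi (sqrn (f k xi - G xi))%:E + 2%:E * A)%E @[k --> \oo] --> (2%:E * A)%E.
  rewrite -[X in _ --> X]add0e; apply: cvgeD => //; last exact: cvg_cst.
  rewrite -[X in _ --> X](mule0 2%:E).
  by apply: cvgeZl.
rewrite -(cvg_lim _ cc)//; apply: lime_ge; first exact: cvgP cc.
exact: nearW.
Qed.

Let h2_0 : (0 <= \int[leb]_x (sqrn (h x))%:E)%E.
Proof. by apply: integral_ge0 => x _; rewrite lee_fin sqrn_ge0. Qed.

Lemma is_fourier_L2_le : (\int[leb]_xi (sqrn (G xi))%:E <= 4%:E * \int[leb]_x (sqrn (h x))%:E)%E.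
Proof.
(* One factor 2 is that of [F_le], the other that of [sqrn_lim]; the sharp constant would be one. *)
have -> : 4%:E = (2%:E * 2%:E)%E :> \bar R by rewrite -EFinM -natrM.
rewrite -muleA; apply: (@sqrn_lim (fun k => fourier_trunc k h)) => //.
- by rewrite mule_ge0.
- by move=> k; rewrite (_ : fourier_trunc k h = F (\1_(B k))); [have [] := mF (i1 k)|apply/funext => xi; exact: truncE].
- by move=> k; rewrite (_ : fourier_trunc k h = F (\1_(B k))); [have [] := mF (i1 k)|apply/funext => xi; exact: truncE].
- move=> k; under eq_integral do rewrite truncE.
  apply: (le_trans (F_le (i1 k))); apply: lee_wpmul2l => //.
  apply: ge0_le_integralW => x _.
    by rewrite lee_fin mulr_ge0 ?sqr_ge0 ?sqrn_ge0.
  rewrite lee_fin ler_piMl ?sqrn_ge0// indicE.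
Qed.

Let bk k : 'cV[R]_d := const_mx k.+1%:R^-1.
Let bk0 k : posv (bk k). Proof. by move=> i; rewrite mxE invr_gt0. Qed.

Let ig k : intT leb (gaussv (bk k)).
Proof.
have := integrable_gaussv 0 (bk0 k).
by under [X in _.-integrable _ (_ \o X)]eq_fun do rewrite subr0.
Qed.

Let gaussv_cvg x : gaussv (bk k) x @[k --> \oo] --> (1 : R).
Proof.
rewrite -[X in _ --> X]expR0 /gaussv; apply: continuous_cvg; first exact: continuous_expR.
have -> : (fun k => - (pi * \sum_i bk k i 0 * x i 0 ^+ 2)) = (fun k => (- (pi * \sum_i x i 0 ^+ 2)) * k.+1%:R^-1).
  apply/funext => k; rewrite mulNr -mulrA mulr_suml; congr (- (_ * _)).
  by apply: eq_bigr => i _; rewrite mxE mulrC.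
rewrite -[X in _ --> X](mulr0 (- (pi * \sum_i x i 0 ^+ 2))).
by apply: cvgM; [exact: cvg_cst|exact: cvg_harmonic].
Qed.

(** Both cut-offs take values in [[0, 1]] and tend to one, so [|h|^2] dominates. *)
Let cvg_trunc_gauss :
  (\int[leb]_x (((\1_(B k) x - gaussv (bk k) x) ^+ 2) * sqrn (h x))%:E)%E @[k --> \oo] --> 0%E.
Proof.
have mhs : measT (fun x => (sqrn (h x))%:E) by exact: msq.
have hm k : measT (fun x => (((\1_(B k) x - gaussv (bk k) x) ^+ 2) * sqrn (h x))%:E).
  apply/measurable_EFinP; apply: measurable_funM; last exact/measurable_EFinP.
  apply: measurable_funX; apply: measurable_funB; first exact: measurable_indic.
  by apply: measurable_gaussv; exact: measurable_id.
have hc : {ae leb, forall x, setT x -> (((\1_(B k) x - gaussv (bk k) x) ^+ 2) * sqrn (h x))%:E @[k --> \oo] --> (cst 0%E) x}.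
  apply: aeW => x _; apply: cvg_EFin; first exact: nearW.
  rewrite /comp /=.
  have cB : (\1_(B k) x : R) @[k --> \oo] --> (1 : R).
    apply: cvg_near_cst; near=> k; rewrite indicE mem_set// /B /eball/= subr0.
    near: k; exists (Num.truncn (enorm x)).+1 => // k /= xk.
    by apply: le_trans (ltW (truncnS_gt _)) _; rewrite ler_nat.
  rewrite -[X in _ --> X](mul0r (sqrn (h x))); apply: cvgM; last exact: cvg_cst.
  have -> : (0 : R) = (1 - 1) * (1 - 1) by rewrite subrr mul0r.
  under eq_fun do rewrite expr2.
  by apply: cvgM; apply: cvgB.
have hd : {ae leb, forall x k, setT x -> (`|(((\1_(B k) x - gaussv (bk k) x) ^+ 2) * sqrn (h x))%:E| <= (fun x => (sqrn (h x))%:E) x)%E}.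
  apply: aeW => x k _ /=; rewrite lee_fin ger0_norm; last by rewrite mulr_ge0 ?sqr_ge0 ?sqrn_ge0.
  rewrite ler_piMl ?sqrn_ge0//.
  have g0 := gaussv_ge0 (bk k) x; have g1 := gaussv_le1 x (bk0 k).
  by rewrite indicE; case: (x \in B k) => /=; nra.
have hi : leb.-integrable setT (fun x => (sqrn (h x))%:E).
  apply/integrableP; split=> //; apply: le_lt_trans h2.
  apply: ge0_le_integralW => x _ //=.
  by rewrite lee_fin ger0_norm ?sqrn_ge0.
have m00 : measT (cst 0%E : 'cV[R]_d -> \bar R) by exact: measurable_cst.
have [_ _ ] := dominated_convergence measurableT hm m00 hc hi hd.
by rewrite integral0.
Unshelve. all: by end_near. Qed.

(** Sharp and Gaussian cut-offs of [h] have transforms with the same L^2 limit [G], and the Gaussian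
    ones can be computed. *)
Let cvg_gauss : (\int[leb]_xi (sqrn (F (gaussv (bk k)) xi - G xi))%:E)%E @[k --> \oo] --> 0%E.
Proof.
have step k : (\int[leb]_xi (sqrn (F (gaussv (bk k)) xi - G xi))%:E <=
   2%:E * (2%:E * \int[leb]_x (((\1_(B k) x - gaussv (bk k) x) ^+ 2) * sqrn (h x))%:E)
   + 2%:E * \int[leb]_xi (sqrn (fourier_trunc k h xi - G xi))%:E)%E.
  have iw : intT leb (fun x => \1_(B k) x - gaussv (bk k) x).
    exact: (integrableB measurableT (i1 k) (ig k)).
  have tE : fourier_trunc k h = F (\1_(B k)) by apply/funext => xi; exact: truncE.
  have [mr mi] := mF iw.
  apply: (@le_trans _ _ (\int[leb]_xi (2%:E * (sqrn (F (fun x => \1_(B k) x - gaussv (bk k) x)%R xi))%:E +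
     2%:E * (sqrn (fourier_trunc k h xi - G xi))%:E))%E).
    apply: ge0_le_integralW => xi _; first by rewrite lee_fin sqrn_ge0.
    rewrite -!EFinM -EFinD lee_fin F_sub// truncE; apply: le_trans (sqrnD _ (F (\1_(B k)) xi - G xi)) _.
    by rewrite opprB addrA subrK.
  have ms : measT (fun xi => (sqrn (fourier_trunc k h xi - G xi))%:E).
    by rewrite tE; apply: msub; have [] := mF (i1 k).
  have mf : measT (fun xi => (sqrn (F (fun x => \1_(B k) x - gaussv (bk k) x)%R xi))%:E).
    exact: msq.
  rewrite ge0_integralD//; last 4 first.
  - by move=> x _; rewrite mule_ge0// lee_fin sqrn_ge0.
  - exact: emeasurable_funM.
  - by move=> x _; rewrite mule_ge0// lee_fin sqrn_ge0.
  - exact: emeasurable_funM.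
  rewrite !ge0_integralZl//; try by move=> x _; rewrite lee_fin sqrn_ge0.
  apply: leeD => //; apply: lee_wpmul2l => //.
  exact: (F_le iw).
apply: (@squeeze_cvge _ _ _ _ (cst 0%E) _ (fun k => 2%:E * (2%:E * \int[leb]_x (((\1_(B k) x - gaussv (bk k) x) ^+ 2) * sqrn (h x))%:E)
   + 2%:E * \int[leb]_xi (sqrn (fourier_trunc k h xi - G xi))%:E)%E).
- apply: nearW => k; rewrite step andbT.
  by apply: integral_ge0 => xi _; rewrite lee_fin sqrn_ge0.
- exact: cvg_cst.
- have -> : 0%E = (2%:E * (2%:E * 0) + 2%:E * 0)%E :> \bar R by rewrite !mule0 adde0.
  by apply: cvgeD => //; do ?apply: cvgeZl.
Qed.

Let cis_mul beta x : cis beta * h x = cintegral leb setT (fun xi => cis (ph0 x xi + beta) * H xi).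
Proof.
have mpb : measT (fun xi => ph0 x xi + beta) by exact: measurable_funD.
have mpp : measT (fun xi => ph0 x xi - pi / 2) by exact: measurable_funB.
have s1 (g : 'cV[R]_d -> R) : intT leb g ->
   osc (fun xi => ph0 x xi + beta - pi / 2) g = cos (beta - pi / 2) * osc (ph0 x) g + cos beta * osc (fun xi => ph0 x xi - pi / 2) g.
  move=> ig'; have -> : (fun xi => ph0 x xi + beta - pi / 2) = (fun xi => ph0 x xi + (beta - pi / 2)).
    by apply/funext => xi; rewrite addrA.
  rewrite oscD//; congr (_ + _); rewrite sinB cos_pihalf sin_pihalf; ring.
apply: complexP.
- rewrite Re_cisM Re_cis_integral// hE0 Re_cis_integral// Im_cis_integral//.
  rewrite (@oscD _ _ (ph0 x) beta)// s1// cosB_pihalf; ring.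
- rewrite Im_cisM Im_cis_integral// hE0 Re_cis_integral// Im_cis_integral//.
  rewrite (@oscD _ _ (ph0 x) beta)// s1// cosB_pihalf; ring.
Qed.

(** The transform of the Gaussian times [h] is the convolution of [H] with the approximate identity
    [kernv (bk k)]. The values of [theta] in use are [0] and [- (pi / 2)]. *)
Let swap_gauss k xi theta (g : 'cV[R]_d -> R) : intT leb g ->
  \int[leb]_x (gaussv (bk k) x * osc (fun zeta => ph0 x zeta + ph1 xi x + theta) g) =
  \int[leb]_zeta (g zeta * (kernv (bk k) (zeta - xi) * cos theta)).
Proof.
move=> ig'.
pose K (z : 'cV[R]_d * 'cV[R]_d) := cos (ph0 z.1 z.2 + ph1 xi z.1 + theta).
have mK : measT K.
  apply: measurableT_comp; first exact: measurable_cos.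
  apply: measurable_funD => //; apply: measurable_funD; first exact: measurable_phase2.
  exact: (measurableT_comp (mphase1 xi) measurable_fst).
have K1 z : `|K z| <= 1 by exact: normr_cos_le1.
rewrite (Rintegral_swap (ig k) ig' mK K1); apply: eq_Rintegral => zeta _; congr (_ * _).
rewrite -(gaussv_fourier_shift 0 (zeta - xi) theta (bk0 k)).
apply: eq_Rintegral => x _; rewrite subr0 mulrC; congr (_ * cos (_ + _)).
rewrite /ph0 /ph1 /phase/= !addr0 -mulrDr; congr (_ * _).
by rewrite dotvBr (dotvC xi) dotvNl.
Qed.

Let iosc k xi theta (g : 'cV[R]_d -> R) : intT leb g ->
  intT leb (fun x => gaussv (bk k) x * osc (fun zeta => ph0 x zeta + ph1 xi x + theta) g).
Proof.
move=> ig'.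
  have mo : measT (fun x => osc (fun zeta => ph0 x zeta + ph1 xi x + theta) g).
    apply: (measurable_Rintegral_param leb (F := fun z : 'cV[R]_d * 'cV[R]_d => cos (ph0 z.1 z.2 + ph1 xi z.1 + theta) * g z.2)).
    apply: measurable_funM; last exact: measurableT_comp (integrable_measurable ig') _.
    apply: measurableT_comp; first exact: measurable_cos.
    apply: measurable_funD => //; apply: measurable_funD; first exact: measurable_phase2.
    exact: (measurableT_comp (mphase1 xi) measurable_fst).
  have := integrable_bounded_mul mo (fun x => osc_le _ ig') (ig k).
  move=> /(_ (fun x => measurable_funD (measurable_funD (mphase0 x) (measurable_cst _)) (measurable_cst _))).
  by congr (_.-integrable _ _); apply/funext => x /=; rewrite mulrC.
Qed.

Let F_gauss_Re k xi : rpart (F (gaussv (bk k))) xi =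
  \int[leb]_zeta (rpart H zeta * (kernv (bk k) (zeta - xi) * cos 0)) -
  \int[leb]_zeta (ipart H zeta * (kernv (bk k) (zeta - xi) * cos (- (pi / 2)))).
Proof.
rewrite -!swap_gauss// -RintegralB//; try exact: iosc.
transitivity (\int[leb]_x complex.Re (cis (ph1 xi x) * wt (gaussv (bk k)) x)); first by [].
apply: eq_Rintegral => x _.
have -> : complex.Re (cis (ph1 xi x) * wt (gaussv (bk k)) x) =
    gaussv (bk k) x * complex.Re (cis (ph1 xi x) * h x).
  by rewrite !Re_cisM /wt/=; ring.
rewrite cis_mul Re_cis_integral//; last exact: measurable_funD.
by rewrite mulrBr; under [in RHS]eq_fun do rewrite addr0.
Qed.

Let F_gauss_Im k xi : ipart (F (gaussv (bk k))) xi =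
  \int[leb]_zeta (rpart H zeta * (kernv (bk k) (zeta - xi) * cos (- (pi / 2)))) +
  \int[leb]_zeta (ipart H zeta * (kernv (bk k) (zeta - xi) * cos 0)).
Proof.
rewrite -!swap_gauss// -RintegralD//; try exact: iosc.
transitivity (\int[leb]_x complex.Im (cis (ph1 xi x) * wt (gaussv (bk k)) x)); first by [].
apply: eq_Rintegral => x _.
have -> : complex.Im (cis (ph1 xi x) * wt (gaussv (bk k)) x) = gaussv (bk k) x * complex.Im (cis (ph1 xi x) * h x).
  by rewrite !Im_cisM /wt/=; ring.
rewrite cis_mul Im_cis_integral//; last exact: measurable_funD.
have e : (fun zeta => ph0 x zeta + ph1 xi x + 0) = (fun zeta => ph0 x zeta + ph1 xi x).
  by apply/funext => z; rewrite addr0.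
by rewrite mulrDr e.
Qed.

Section support.
Variables (c : 'cV[R]_d) (rho : R).
Hypothesis HD : forall xi, ~ eball c rho xi -> H xi = 0.

Let kern_int_cvg theta (g : 'cV[R]_d -> R) xi : intT leb g ->
  (forall zeta, ~ eball c rho zeta -> g zeta = 0) -> ~ eball c rho xi ->
  \int[leb]_zeta (g zeta * (kernv (bk k) (zeta - xi) * cos theta)) @[k --> \oo] --> (0 : R).
Proof.
move=> ig' gD xiD.
(* A lower bound for the distance from [xi] to the ball that carries [g]. *)
pose eta := enorm (xi - c) - rho.
have eta0 : 0 < eta by rewrite subr_gt0 ltNge; apply/negP.
have [C [C0 HC]] := kernv_far_le d eta0.
pose M := fine (\int[leb]_x `|g x|%:E)%E.
have far zeta : eball c rho zeta -> eta ^+ 2 <= dotv (zeta - xi) (zeta - xi).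
  rewrite /eball/= => hz; rewrite -enorm_sqr lerXn2r ?nnegrE ?enorm_ge0 ?(ltW eta0)//.
  rewrite /eta lerBlDr; apply: le_trans (lerD (lexx _) hz).
  rewrite (enormB zeta); have -> : xi - c = (xi - zeta) + (zeta - c) by rewrite addrA subrK.
  exact: enorm_triangle.
have bnd k : `|\int[leb]_zeta (g zeta * (kernv (bk k) (zeta - xi) * cos theta))| <= (C * k.+1%:R^-1) * M.
  have ik : intT leb (fun zeta => g zeta * (kernv (bk k) (zeta - xi) * cos theta)).
    pose P := \prod_(i < d) (Num.sqrt (bk k i 0))^-1.
    have mk : measT (fun zeta : 'cV[R]_d => kernv (bk k) (zeta - xi) * cos theta).
      by apply: measurable_funM => //; apply: measurable_funM => //; exact: measurable_gaussvB.
    have kP (zeta : 'cV[R]_d) : `|kernv (bk k) (zeta - xi) * cos theta| <= P.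
      rewrite normrM (ger0_norm (kernv_ge0 _ (bk0 k))).
      apply: (@le_trans _ _ (kernv (bk k) (zeta - xi))).
        by rewrite ler_piMr ?kernv_ge0// normr_cos_le1.
      rewrite /kernv ler_piMr//; first by rewrite prodr_ge0// => i _; rewrite invr_ge0 sqrtr_ge0.
      by apply: gaussv_le1 => i; rewrite !mxE !invr_gt0.
    have := integrable_bounded_mul mk kP ig'.
    by congr (_.-integrable _ _); apply/funext => x /=; rewrite mulrC.
  have iCg : intT leb (fun x => C * k.+1%:R^-1 * `|g x|).
    by apply: integrable_scale; exact: integrable_norm ig'.
  have -> : C * k.+1%:R^-1 * M = \int[leb]_x (C * k.+1%:R^-1 * `|g x|).
    by rewrite RintegralZl//; exact: integrable_norm ig'.
  rewrite -lee_fin EFin_Rintegral//; apply: (le_trans (le_norm_Rintegral_fin ik)).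
  apply: ge0_le_integralW => zeta _ //; rewrite lee_fin.
  have [zD|zD] := pselect (eball c rho zeta); last by rewrite gD// mul0r normr0 mulr0.
  rewrite normrM mulrC ler_wpM2r// normrM (ger0_norm (kernv_ge0 (zeta - xi) (bk0 k))).
  apply: le_trans (HC k _ (far _ zD)).
  by rewrite ler_piMr ?kernv_ge0// normr_cos_le1.
apply/norm_cvg0P; apply: (@squeeze_cvgr _ _ _ _ (cst 0) (fun k => C * k.+1%:R^-1 * M)).
- by apply: nearW => k; rewrite normr_ge0 bnd.
- exact: cvg_cst.
- have -> : (0 : R) = C * 0 * M by rewrite mulr0 mul0r.
  by apply: cvgM; [apply: cvgM; [exact: cvg_cst|exact: cvg_harmonic]|exact: cvg_cst].
Qed.

(** Off the ball the Gaussian-regularized transforms tend to zero pointwise, while they tend to [G]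
    in L^2; Fatou's lemma forces [G] to vanish there. *)
Lemma is_fourier_support : {ae leb, forall xi, ~ eball c rho xi -> G xi = 0}.
Proof.
pose D := ~` eball c rho.
have mD : measurable D by apply: measurableC; exact: measurable_eball.
have [mGr mGi] := mG.
pose f k xi := (sqrn (F (gaussv (bk k)) xi - G xi))%:E.
have mf k : measurable_fun D (f k).
  by apply: measurable_funTS; apply: msub; have [] := mF (ig k).
have f0 k xi : D xi -> (0 <= f k xi)%E by rewrite lee_fin sqrn_ge0.
have fat := fatou leb mD mf f0.
have lf xi : D xi -> limn_einf (f ^~ xi) = (sqrn (G xi))%:E.
  move=> Dxi.
  have HrD zeta : ~ eball c rho zeta -> rpart H zeta = 0 by move=> /HD; rewrite /rpart => ->.
  have HiD zeta : ~ eball c rho zeta -> ipart H zeta = 0 by move=> /HD; rewrite /ipart => ->.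
  have cr : rpart (F (gaussv (bk k))) xi @[k --> \oo] --> (0 : R).
    under eq_fun do rewrite F_gauss_Re.
    have -> : (0 : R) = 0 - 0 by rewrite subrr.
    by apply: cvgB; exact: kern_int_cvg.
  have ci : ipart (F (gaussv (bk k))) xi @[k --> \oo] --> (0 : R).
    under eq_fun do rewrite F_gauss_Im.
    have -> : (0 : R) = 0 + 0 by rewrite addr0.
    by apply: cvgD; exact: kern_int_cvg.
  have : f k xi @[k --> \oo] --> (sqrn (G xi))%:E; last by move/cvg_limn_einf_sup => -[].
  apply: cvg_EFin; first exact: nearW.
  have -> : sqrn (G xi) = (0 - complex.Re (G xi)) * (0 - complex.Re (G xi)) +
     (0 - complex.Im (G xi)) * (0 - complex.Im (G xi)) by rewrite /sqrn; ring.
  have -> : fine \o f ^~ xi = (fun k => (rpart (F (gaussv (bk k))) xi - complex.Re (G xi)) *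
     (rpart (F (gaussv (bk k))) xi - complex.Re (G xi)) + (ipart (F (gaussv (bk k))) xi - complex.Im (G xi))
     * (ipart (F (gaussv (bk k))) xi - complex.Im (G xi))).
    by apply/funext => k; rewrite /f/= /sqrn ReB ImB !expr2.
  by apply: cvgD; apply: cvgM; apply: cvgB => //; exact: cvg_cst.
have G0 : (\int[leb]_(xi in D) (sqrn (G xi))%:E <= 0)%E.
  have -> : (\int[leb]_(xi in D) (sqrn (G xi))%:E = \int[leb]_(xi in D) limn_einf (f ^~ xi))%E.
    by apply: eq_integral => xi /set_mem Dxi; rewrite lf.
  apply: (le_trans fat).
  have c0 : (\int[leb]_(xi in D) f k xi)%E @[k --> \oo] --> 0%E.
    apply: (@squeeze_cvge _ _ _ _ (cst 0%E) _ (fun k => (\int[leb]_xi f k xi)%E)); last 2 first.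
    - exact: cvg_cst.
    - exact: cvg_gauss.
    apply: nearW => k; apply/andP; split; first by apply: integral_ge0 => xi Dxi; exact: f0.
    apply: ge0_subset_integral => //; first by apply: msub; have [] := mF (ig k).
    by move=> xi _; rewrite lee_fin sqrn_ge0.
  by have [-> _] := cvg_limn_einf_sup c0.
have mGs : measurable_fun D (fun xi => (sqrn (G xi))%:E).
  by apply: measurable_funTS; exact: msq.
have : (\int[leb]_(xi in D) `|(sqrn (G xi))%:E|)%E = 0%E.
  apply/eqP; rewrite eq_le; apply/andP; split; last by apply: integral_ge0.
  apply: le_trans G0; apply: ge0_le_integralW => xi _; first exact: abse_ge0.
  by rewrite gee0_abs// lee_fin sqrn_ge0.
move/(ae_eq_integral_abs _ mD mGs); apply: filterS => xi /= h0 Dxi.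
have [] := h0 Dxi => /eqP; rewrite paddr_eq0 ?sqr_ge0// !sqrf_eq0 => /andP[/eqP a /eqP b].
exact: complexP.
Qed.

End support.
End fourier_transform.

(** * Essential supports *)

Section rational_boxes.
Context (R : realType) (d : nat).
Notation leb := (@lebesgue_cV R d).

(** Cubes with rational centre and side form a countable base. Measurable sets of vectors are
    generated by coordinates, and open sets are reached as countable unions of these cubes. *)
Definition qbox (p : 'cV[rat]_d * nat) : set 'cV[R]_d :=
  [set x | forall i, `|x i 0 - ratr (p.1 i 0)| < p.2.+1%:R^-1].

Lemma measurable_qbox p : measurable (qbox p).
Proof.
rewrite (_ : qbox p = \big[setI/setT]_(i < d)
    [set x : 'cV[R]_d | `|x i 0 - ratr (p.1 i 0)| < p.2.+1%:R^-1]); last first.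
  rewrite -bigcap_seq; apply/seteqP; split => [x h i _|x h i]; first exact: h.
  exact: (h i (mem_index_enum i)).
apply: bigsetI_measurable => i _.
have mf : measT (fun x : 'cV[R]_d => `|x i 0 - ratr (p.1 i 0)|).
  apply: measurableT_comp => //; apply: measurable_funB => //.
  exact: measurable_mx_coord.
have := mf measurableT _ (measurable_itv `]-oo, p.2.+1%:R^-1[).
by rewrite setTI set_itvE.
Qed.

Lemma nbhs_qbox (x : 'cV[R]_d) (U : set 'cV[R]_d) : nbhs x U ->
  exists p, qbox p x /\ qbox p `<=` U.
Proof.
move=> /nbhs_ballP[e /= e0 eU].
have [k ke] : exists k, k.+1%:R^-1 < e / 2.
  by have [k _ /(_ k (leqnn k))] := near_infty_natSinv_lt (PosNum (divr_gt0 e0 (ltr0n R 2))); exists k.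
have k0 : 0 < k.+1%:R^-1 :> R by rewrite invr_gt0.
have /choice[q hq] (i : 'I_d) : exists q, ratr q \in `]x i 0, x i 0 + k.+1%:R^-1[.
  by apply: rat_in_itvoo; rewrite ltrDl.
have xq i : `|x i 0 - ratr (q i)| < k.+1%:R^-1.
  have := hq i; rewrite in_itv/= => /andP[h1 h2]; rewrite ltr_norml ltrBrDl ltrBlDl addrC ltrBlDl.
  by rewrite h2 (lt_trans h1)// ltrDl.
exists (\col_i q i, k); split=> [i|y hy]; rewrite ?mxE//.
apply: eU; split=> // i j; rewrite ord1 /ball/=.
have := hy i; have := xq i; rewrite /= mxE.
move=> h1 h2; have -> : x i 0 - y i 0 = (x i 0 - ratr (q i)) - (y i 0 - ratr (q i)) by ring.
apply: le_lt_trans (ler_normB _ _) _; rewrite (splitr e).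
by apply: ltrD; [exact: lt_trans h1 ke|exact: lt_trans h2 ke].
Qed.

Definition qboxn (k : nat) : set 'cV[R]_d := if choice.unpickle k is Some p then qbox p else set0.

Lemma open_measurable_cV (U : set 'cV[R]_d) : open U -> measurable U.
Proof.
move=> oU; rewrite (_ : U = \bigcup_(k in [set k | qboxn k `<=` U]) qboxn k); last first.
  apply/seteqP; split=> [x Ux|x [k /= kU /kU]//].
  have /nbhs_qbox[p [px pU]] : nbhs x U by apply: open_nbhs_nbhs.
  by exists (choice.pickle p); rewrite /= /qboxn choice.pickleK.
apply: bigcup_measurable => k _; rewrite /qboxn; case: (choice.unpickle k) => // p.
exact: measurable_qbox.
Qed.

Lemma continuous_measurable_cV (f : 'cV[R]_d -> R) : continuous f -> measT f.
Proof.
move=> /continuousP cf; apply: (measurability _ (RGenOpens.measurableE R)).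
move=> _ [_ [a [b ->] <-]]; rewrite setTI; apply: open_measurable_cV.
exact/cf/interval_open.
Qed.

(** The complement of the support is covered by cubes [qbox] on each of which [F] vanishes a.e.;
    there are countably many of them. *)
Lemma ae_ess_support (F : 'cV[R]_d -> R[i]) :
  {ae leb, forall x, ~ ess_support F x -> F x = 0}.
Proof.
pose N k := if `[< {ae leb, forall y, qboxn k y -> F y = 0} >]
  then ~` [set y | qboxn k y -> F y = 0] else set0.
have : leb.-negligible (\bigcup_k N k).
  apply: negligible_bigcup => k; rewrite /N; case: asboolP => [//|_].
  exact: negligible_set0.
apply: negligibleS => x /= /not_implyP[nx Fx].
have /existsNP[U /not_implyP[xU /contrapT aeU]] := nx.
have [p [px pU]] := nbhs_qbox xU.
exists (choice.pickle p) => //; rewrite /N; case: asboolP => [_|[]] /=.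
  by rewrite /qboxn choice.pickleK => /(_ px).
rewrite /qboxn choice.pickleK; apply: filterS aeU => y h /pU; exact: h.
Qed.

End rational_boxes.

(** * Expansion of the symbol on a sector *)

Section partial_derivatives.
Context (R : realType) (d : nat).
Implicit Types (f : 'cV[R]_d -> R) (x e : 'cV[R]_d).

Lemma is_derive_line f x e (s : R) : derivable f (x + s *: e) e ->
  is_derive s 1 (fun u : R => f (x + u *: e)) ('D_e f (x + s *: e)).
Proof.
move=> df.
have E : (fun h : R => h^-1 *: (((fun u : R => f (x + u *: e)) \o shift s) (h *: (1 : R)) - f (x + s *: e)))
    = (fun h : R => h^-1 *: ((f \o shift (x + s *: e)) (h *: e) - f (x + s *: e))).
  apply/funext => h /=; congr (_ *: (f _ - _)).
  by rewrite scalerDl [h%:A]mulr1 addrCA.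
split; first by rewrite /derivable E.
by rewrite /derive E.
Qed.

Definition C1 f := (forall i x, derivable f x (delta_mx i 0)) /\
  (forall i, continuous (partial i f)).

Lemma coord_MVT f x i (s : R) : (forall y, derivable f y (delta_mx i 0)) ->
  exists t : R, (0 <= t <= s) || (s <= t <= 0) /\
   f (x + s *: delta_mx i 0) - f x = s * partial i f (x + t *: delta_mx i 0).
Proof.
move=> df; pose g (u : R) := f (x + u *: delta_mx i 0).
have dg (u : R) : is_derive u 1 g (partial i f (x + u *: delta_mx i 0)) by exact: is_derive_line.
have cg : continuous g.
  by move=> u; apply: differentiable_continuous; apply/derivable1_diffP; have [] := dg u.
have g0 : g 0 = f x by rewrite /g scale0r addr0.
have [s0|s0] := leP 0 s.
- have [t + E] := MVT_segment s0 (fun u _ => dg u) (continuous_subspaceT cg).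
  rewrite in_itv/= => ts; exists t; split; first by rewrite ts.
  by rewrite -g0 -/(g s) E subr0 mulrC.
- have [t + E] := MVT_segment (ltW s0) (fun u _ => dg u) (continuous_subspaceT cg).
  rewrite in_itv/= => ts; exists t; split; first by rewrite ts orbT.
  by rewrite -g0 -/(g s) -opprB E sub0r mulrN opprK mulrC.
Qed.

Definition box (c : 'cV[R]_d) (r : R) : set 'cV[R]_d := [set x | forall i, `|x i 0 - c i 0| <= r].

Lemma telescoping_MVT f c r xi zeta : (forall i y, derivable f y (delta_mx i 0)) ->
  box c r xi -> box c r zeta ->
  exists p : 'I_d -> 'cV[R]_d, (forall i, box c r (p i)) /\
    f xi - f zeta = \sum_i partial i f (p i) * (xi i 0 - zeta i 0).
Proof.
move=> df bxi bz.
(* [w] passes from [zeta] to [xi] by one coordinate at a time. Such a path stays in a coordinate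
   box, though not in a Euclidean ball, which is why boxes appear here. *)
pose w k : 'cV[R]_d := \col_i (if (i < k)%N then xi i 0 else zeta i 0).
have wS (i : 'I_d) : w i.+1 = w i + (xi i 0 - zeta i 0) *: delta_mx i 0.
  apply/colP => j; rewrite !mxE eqxx andbT ltnS leq_eqVlt.
  have [->|ji] := eqVneq j i; first by rewrite eqxx ltnn /= mulr1 addrC subrK.
  by rewrite (inj_eq val_inj) (negbTE ji) /= mulr0 addr0.
have step (i : 'I_d) : exists p, box c r p /\
    f (w i.+1) - f (w i) = partial i f p * (xi i 0 - zeta i 0).
  rewrite wS; have [t [ht ->]] := coord_MVT (w i) (xi i 0 - zeta i 0) (df i).
  exists (w i + t *: delta_mx i 0); split; last by rewrite mulrC.
  move=> j; rewrite !mxE eqxx andbT.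
  have [->|ji] := eqVneq j i.
    rewrite ltnn mulr1; have := bxi i; have := bz i; rewrite !ler_norml.
    by case/orP: ht => /andP[? ?] /andP[? ?] /andP[? ?]; apply/andP; split; lra.
  rewrite mulr0 addr0; case: ifP => _; [exact: bxi|exact: bz].
have [p hp] := choice step; exists p; split=> [i|]; first by have [] := hp i.
have -> : xi = w d by apply/colP => j; rewrite mxE ltn_ord.
have -> : f zeta = f (w 0%N) by congr f; apply/colP => j; rewrite mxE.
rewrite -(telescope_sumr (fun k => f (w k)) (leq0n d)) big_mkord.
apply: eq_bigr => i _; have [_ ->] := hp i.
by congr (_ * (_ - _)); rewrite !mxE ltn_ord.
Qed.

Lemma is_derive_shift f c y e : derivable f (y + c) e ->
  is_derive y e (fun z => f (z + c)) ('D_e f (y + c)).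
Proof.
move=> df.
have E : (fun h : R => h^-1 *: (((fun z => f (z + c)) \o shift y) (h *: e) - f (y + c)))
    = (fun h : R => h^-1 *: ((f \o shift (y + c)) (h *: e) - f (y + c))).
  by apply/funext => h /=; rewrite addrA.
split; first by rewrite /derivable E.
by rewrite /derive E.
Qed.

(* Both mixed derivatives are limits of the same second difference quotient. *)
Lemma second_difference f i j x (h : R) : 0 < h ->
  (forall z, derivable f z (delta_mx i 0)) ->
  (forall z, derivable (partial i f) z (delta_mx j 0)) ->
  exists y : 'cV[R]_d, (forall k, `|y k 0 - x k 0| <= h *+ 2) /\
   f (x + h *: delta_mx i 0 + h *: delta_mx j 0) - f (x + h *: delta_mx i 0) -
   (f (x + h *: delta_mx j 0) - f x) = h ^+ 2 * partial j (partial i f) y.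
Proof.
move=> h0 di dj.
pose F z := f (z + h *: delta_mx j 0) - f z.
have dF z : is_derive z (delta_mx i 0) F (partial i f (z + h *: delta_mx j 0) - partial i f z).
  apply: is_deriveB; first exact: is_derive_shift.
  exact: derivableP.
have [t [ht E1]] := coord_MVT x h (fun z => @ex_derive _ _ _ _ _ _ _ (dF z)).
have [t' [ht' E2]] := coord_MVT (x + t *: delta_mx i 0) h dj.
exists (x + t *: delta_mx i 0 + t' *: delta_mx j 0); split.
  move=> k; rewrite !mxE eqxx !andbT.
  have {}ht : 0 <= t <= h by case/orP: ht => // /andP[a b]; apply/andP; split; lra.
  have {}ht' : 0 <= t' <= h by case/orP: ht' => // /andP[a b]; apply/andP; split; lra.
  rewrite -addrA addrAC subrr add0r mulr2n ger0_norm.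
    by case: (k == i); case: (k == j); rewrite ?mulr1 ?mulr0; lra.
  by case: (k == i); case: (k == j); rewrite ?mulr1 ?mulr0; lra.
rewrite -/(F (x + h *: delta_mx i 0)) -/(F x) E1 /partial (@derive_val _ _ _ _ _ _ _ (dF _)) -/(partial i f _) -/(partial i f (x + t *: _)) E2.
by rewrite expr2 mulrA.
Qed.

(** The second difference is symmetric in [i] and [j], so one mixed derivative at some [y] equals
    the other at some [z], both points as near to [x] as desired; continuity concludes. *)
Lemma mixed_partials f i j : C1 f -> C1 (partial i f) -> C1 (partial j f) ->
  partial i (partial j f) = partial j (partial i f).
Proof.
move=> [df cf] [di ci] [dj cj]; apply/funext => x.
apply/eqP; rewrite -subr_eq0 -normr_le0; suff aux (e : R) : 0 < e -> `|partial i (partial j f) x - partial j (partial i f) x| <= e.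
  by apply/ler_addgt0Pl => e e0; rewrite addr0; exact: aux.
move=> e0.
have e20 : 0 < e / 2 by rewrite divr_gt0.
have /cvgr_dist_lt/(_ _ e20) Nij := ci j x; have /cvgr_dist_lt/(_ _ e20) Nji := cj i x.
move/nbhs_ballP : Nij => [r1 /= r10 hr1]; move/nbhs_ballP : Nji => [r2 /= r20 hr2].
pose r := Num.min r1 r2.
have r0 : 0 < r by rewrite lt_min r10 r20.
have h0 : 0 < r / 3 by rewrite divr_gt0.
have [y [hy E1]] := second_difference x h0 (df i) (di j).
have [z [hz E2]] := second_difference x h0 (df j) (dj i).
have bx (w : 'cV[R]_d) (s : R) : r <= s -> (forall k, `|w k 0 - x k 0| <= (r / 3) *+ 2) -> ball x s w.
  move=> rs hw; have s0 : 0 < s by exact: lt_le_trans rs.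
  split=> // k l; rewrite ord1 /ball/= distrC; apply: le_lt_trans (hw k) _.
  by rewrite mulr2n; lra.
have rr1 : r <= r1 by rewrite ge_min lexx.
have rr2 : r <= r2 by rewrite ge_min lexx orbT.
have h1 := hr1 _ (bx _ _ rr1 hy); have h2 := hr2 _ (bx _ _ rr2 hz).
have E : partial j (partial i f) y = partial i (partial j f) z.
  have E3 : (r / 3) ^+ 2 * partial j (partial i f) y = (r / 3) ^+ 2 * partial i (partial j f) z.
    rewrite -E1 -E2 [x + (r / 3) *: delta_mx j 0 + _]addrAC.
    by move: (f (x + _ + _)) (f (x + _)) (f (x + _)) (f x) => a b c g; ring.
  have r20' : (r / 3) ^+ 2 != 0 by exact: lt0r_neq0 (exprn_gt0 2 h0).
  exact: mulfI r20' _ _ E3.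
move: h1 h2; rewrite E; set A := partial j _ x; set B := partial i _ x; set C := partial i _ z.
move=> h1 h2; have -> : B - A = (B - C) - (A - C) by ring.
apply: le_trans (ler_normB _ _) _; rewrite (splitr e).
exact: lerD (ltW h2) (ltW h1).
Qed.

End partial_derivatives.

Lemma perm_eq_pair (T : eqType) (t : seq T) i j :
  perm_eq t [:: i; j] -> t = [:: i; j] \/ t = [:: j; i].
Proof.
move=> pe; have := perm_size pe; case: t pe => [|a [|b [|? ?]]]// pe _.
have : a \in [:: i; j] by rewrite -(perm_mem pe) mem_head.
rewrite !inE => /orP[/eqP ai|/eqP aj]; subst a; [left|right].
  by move: pe; rewrite perm_cons => /perm_mem /(_ b); rewrite !inE eqxx => /esym/eqP ->.
have : perm_eq [:: j; b] [:: j; i] := perm_trans pe (permEl (perm_catC [:: i] [:: j])).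
by rewrite perm_cons => /perm_mem /(_ b); rewrite !inE eqxx => /esym/eqP ->.
Qed.

Section symbols.
Context (R : realType) (d : nat).
Implicit Types (m : 'cV[R]_d -> R) (c xi zeta : 'cV[R]_d).

Lemma smooth_C1 m (s : seq 'I_d) : smooth m -> C1 (partials s m).
Proof. by move=> sm; split=> [|i]; [have [] := sm s|have [_] := sm (i :: s)]. Qed.

(** [mi_partial] differentiates in the fixed order of the indices. When [i] and [j] come in the
    opposite order, the symmetry of second derivatives is needed. *)
Lemma symbol_second_partial (sigma C_L C_max : R) m xi i j :
  symbol_of_order sigma C_L C_max m -> C_max <= enorm xi ->
  `|partial i (partial j m) xi| <= C_L * enorm xi `^ (sigma - 2).
Proof.
move=> sm hxi.
pose alpha := [ffun k : 'I_d => (k == i) + (k == j)]%N.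
have sum_delta (F : 'I_d -> nat) l : (\sum_k (F k * (k == l)) = F l)%N.
  rewrite (bigD1 l)//= eqxx muln1 big1 ?addn0// => k /negbTE ->; exact: muln0.
have o2 : mi_order alpha = 2%N.
  rewrite /mi_order (eq_bigr (fun k => (1 * (k == i) + 1 * (k == j))%N)).
    by rewrite big_split/= !(sum_delta (fun=> 1%N)).
  by move=> k _; rewrite ffunE !mul1n.
have : perm_eq (flatten [seq nseq (alpha i) i | i <- enum 'I_d]) [:: i; j].
  apply/permP => p; rewrite count_flatten -map_comp sumnE big_map big_enum/=.
  rewrite (eq_bigr (fun k => (p k * (k == i) + p k * (k == j))%N)).
    by rewrite big_split/= !sum_delta addn0.
  by move=> k _; rewrite /= count_nseq ffunE mulnDr.
have := symbol_upper sm (alpha := alpha) (xi := xi); rewrite o2 => /(_ isT hxi).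
rewrite /mi_partial => + pe; move: (flatten _) pe => t pe h.
have Cl := mixed_partials (smooth_C1 [::] (symbol_smooth sm))
  (smooth_C1 [:: i] (symbol_smooth sm)) (smooth_C1 [:: j] (symbol_smooth sm)).
have {}Cl : partial i (partial j m) = partial j (partial i m) := Cl.
case: (perm_eq_pair pe) => E; rewrite E in h; first exact: h.
by rewrite Cl; exact: h.
Qed.

(** The mean value theorem twice: each partial derivative moves by at most [d M r] over the box, and
    there are [d] coordinates to sum. *)
Lemma linearization m c (r M : R) xi zeta : smooth m -> 0 <= r -> 0 <= M ->
  (forall p i j, box c r p -> `|partial i (partial j m) p| <= M) ->
  box c r xi -> box c r zeta ->
  `|m xi - m zeta - dotv (grad m c) (xi - zeta)| <= d%:R ^+ 2 * M * r * enorm (xi - zeta).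
Proof.
move=> sm r0 M0 hM bx bz.
have bc : box c r c by move=> i; rewrite subrr normr0.
have [p [bp ->]] := telescoping_MVT (proj1 (sm [::])) bx bz.
rewrite /dotv -sumrB; apply: le_trans (ler_norm_sum _ _ _) _.
apply: (@le_trans _ _ (\sum_(i < d) d%:R * M * r * enorm (xi - zeta))); last first.
  by rewrite big_const card_ord iter_addr_0 -[X in X <= _]mulr_natl expr2 !mulrA.
apply: ler_sum => i _; rewrite !mxE -mulrBl normrM.
have hg : `|partial i m (p i) - partial i m c| <= d%:R * M * r.
  have [q [bq ->]] := telescoping_MVT (proj1 (sm [:: i])) (bp i) bc.
  apply: le_trans (ler_norm_sum _ _ _) _.
  apply: (@le_trans _ _ (\sum_(i < d) M * r)); last first.
    by rewrite big_const card_ord iter_addr_0 -[X in X <= _]mulr_natl mulrA.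
  by apply: ler_sum => j _; rewrite normrM ler_pM//; [exact: hM|exact: bp].
apply: ler_pM => //.
by have := coord_le_enorm (xi - zeta) i; rewrite !mxE.
Qed.

End symbols.

Section directional_expansion.
Context (R : realType).

(* If the transversal part [U] of a vector of length [E] is small, its first
   component [u0] is nearly [E], and the increment [D] is of size [l * E / s]. *)
Lemma expansion_arith (s G l g0 u0 t err U E D : R) :
  1 <= s -> 0 < l -> l <= G -> 0 <= U -> 0 <= E -> E ^+ 2 = u0 ^+ 2 + U ^+ 2 ->
  s^-1 * G <= `|g0| -> `|t| <= G * U -> `|err| <= l / (4 * s) * E -> D = g0 * u0 + t + err ->
  (1024 * s ^+ 2)^-1 * E ^+ 2 <= D ^+ 2 / (2 * pi * l) ^+ 2 + U ^+ 2.
Proof.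
move=> s1 l0 lG U0 E0 Eu hg ht he DE.
have s0 : 0 < s by lra.
have G0 : 0 < G by exact: lt_le_trans lG.
(* A transversal part of this size is enough on its own, since [32^2 = 1024]. *)
have [EU|UE] := leP (E / (32 * s)) U.
  apply: (@le_trans _ _ (U ^+ 2)); last first.
    by rewrite lerDr divr_ge0// sqr_ge0.
  have -> : (1024 * s ^+ 2)^-1 * E ^+ 2 = (E / (32 * s)) ^+ 2 by field; rewrite lt0r_neq0.
  by rewrite lerXn2r// nnegrE// divr_ge0// mulr_ge0// ltW.
have u0E : E - U <= `|u0|.
  rewrite lerBlDr -ler_sqr ?nnegrE ?addr_ge0// Eu sqrrD real_normK ?num_real//.
  have := mulr_ge0 (normr_ge0 u0) U0; lra.
have UE' : U < E / s / 32 by rewrite -mulrA -invfM (mulrC s).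
have EsE : E / s <= E by rewrite ler_pdivrMr// ler_peMr.
have Es0 : 0 <= E / s by rewrite divr_ge0// ltW.
(* The main term is at least [G (E - U) / s]. With [U] below [E / (32 s)] the losses are [U / s] and
   [U], each at most [E / (32 s)], and the error [E / (4 s)], all times [G]: less than half of
   [G E / s] in total. *)
have D1 : l * (E / s / 2) <= `|D|.
  have h1 : s^-1 * G * (E - U) <= `|g0 * u0|.
    rewrite normrM; apply: ler_pM => //; last lra.
    by apply: mulr_ge0; rewrite ?invr_ge0 ltW.
  have h2 : `|g0 * u0| - `|t| - `|err| <= `|D|.
    rewrite DE; have := ler_normB (g0 * u0 + t + err) (t + err); have := ler_normD t err.
    by rewrite (_ : g0 * u0 + t + err - (t + err) = g0 * u0); [lra|ring].
  have h3 : l / (4 * s) * E <= G * (E / s / 4).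
    rewrite (_ : l / (4 * s) * E = l * (E / s / 4)); last by field; rewrite lt0r_neq0.
    by rewrite ler_wpM2r// divr_ge0.
  have h4 : s^-1 * G * (E - U) = G * (E / s - U / s) by ring.
  have h5 : U / s <= U by rewrite ler_pdivrMr// ler_peMr.
  have h6 : G * (E / s / 2) <= G * (E / s - U / s) - G * U - G * (E / s / 4).
    by rewrite -!mulrBr ler_wpM2l ?(ltW G0)//; lra.
  have h7 : l * (E / s / 2) <= G * (E / s / 2) by rewrite ler_wpM2r// divr_ge0.
  lra.
apply: (@le_trans _ _ (D ^+ 2 / (2 * pi * l) ^+ 2)); last by rewrite lerDl sqr_ge0.
have p0 : 0 < pi :> R := pi_gt0 R.
have p4 : pi <= 4 :> R by have := @pihalf_lt2 R; lra.
rewrite ler_pdivlMr ?exprn_gt0 ?mulr_gt0//.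
apply: (@le_trans _ _ ((l * (E / s / 2)) ^+ 2)); last first.
  rewrite -(real_normK (num_real D)) lerXn2r// nnegrE.
  by apply: mulr_ge0; [exact: ltW|exact: divr_ge0].
have -> : (1024 * s ^+ 2)^-1 * E ^+ 2 * (2 * pi * l) ^+ 2 = (l * (E / s / 2)) ^+ 2 * (pi / 8) ^+ 2.
  by move: (pi : R) => q; field; rewrite lt0r_neq0.
rewrite ler_piMr ?sqr_ge0//; apply: exprn_ile1; lra.
Qed.

End directional_expansion.

Section orthogonal_matrices.
Context (R : realType) (d : nat).
Implicit Types (A O : 'M[R]_d) (x y : 'cV[R]_d).

Lemma dotv_mulmx A x y : dotv (A *m x) y = dotv x (A^T *m y).
Proof.
have dE (u v : 'cV[R]_d) : dotv u v = (u^T *m v) 0 0.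
  by rewrite mxE; apply: eq_bigr => i _; rewrite mxE.
by rewrite !dE trmx_mul mulmxA.
Qed.

Lemma orthogonal_mulmx_trmx A : orthogonal_mx A -> A *m A^T = 1%:M.
Proof. exact: mulmx1C. Qed.

Lemma dotv_orthogonal A x y : orthogonal_mx A -> dotv (A^T *m x) (A^T *m y) = dotv x y.
Proof.
by move=> oA; rewrite dotv_mulmx trmxK mulmxA (orthogonal_mulmx_trmx oA) mul1mx.
Qed.

End orthogonal_matrices.

Lemma orthogonal_tperm (R : realType) n (O : 'M[R]_n) i j :
  orthogonal_mx O -> orthogonal_mx (O *m tperm_mx i j).
Proof.
rewrite /orthogonal_mx => oO; rewrite trmx_mul tr_tperm_mx mulmxA -(mulmxA _ O^T) oO mulmx1.
by rewrite -perm_mxM perm.tperm2 perm_mx1.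
Qed.

Lemma coord0_tperm (R : realType) n (O : 'M[R]_n.+1) j (v : 'cV[R]_n.+1) :
  ((O *m tperm_mx ord0 j)^T *m v) ord0 0 = dotv v (O *m delta_mx j 0).
Proof.
have -> : O *m delta_mx j 0 = O *m tperm_mx ord0 j *m (delta_mx ord0 0 : 'cV[R]_n.+1).
  rewrite -mulmxA -xrowE; congr (O *m _); apply/colP => i; rewrite !mxE eqxx !andbT.
  by congr (_%:R); rewrite -(inj_eq (@perm.perm_inj _ (perm.tperm ord0 j)) i j) perm.tpermR.
rewrite dotvC dotv_mulmx /dotv (bigD1 ord0)//= big1 ?addr0.
  by rewrite [X in _ = X * _]mxE !eqxx mul1r.
by move=> i /negbTE i0; rewrite [X in X * _]mxE i0 mul0r.
Qed.

Definition tailv (R : realType) n (v : 'cV[R]_n.+1) : 'cV[R]_n := \col_i v (lift ord0 i) 0.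

Section symbol_expansion.
Context (R : realType) (n : nat).
Let d := n.+1.
Let k : R := (20 * d%:R ^+ 3 * 2 ^+ d)^-1.

Lemma enorm_box (c p : 'cV[R]_d) (r : R) : 0 <= r -> box c r p -> enorm (p - c) <= d%:R * r.
Proof.
move=> r0 bp; have dr0 : 0 <= d%:R * r by exact: mulr_ge0.
rewrite enorm_le_sqr// /dotv; apply: (@le_trans _ _ (\sum_(i < d) r ^+ 2)).
  apply: ler_sum => i _; rewrite -expr2 -(real_normK (num_real _)) lerXn2r ?nnegrE//.
  by have := bp i; rewrite !mxE.
rewrite big_const card_ord iter_addr_0 -[X in X <= _]mulr_natl exprMn ler_wpM2r ?sqr_ge0//.
by rewrite expr2 ler_peMr// ler1n.
Qed.

Lemma symbol_expansive (sigma C_L C_max eps N : R) m (e : 'cV[R]_d) (A : 'M[R]_d) xi zeta :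
  symbol_of_order sigma C_L C_max m -> 2 <= sigma -> sigma <= d%:R ->
  0 < eps -> eps <= k * C_L ^- 2 -> 2 * C_max <= N -> enorm e = 1 -> orthogonal_mx A ->
  (Num.sqrt d%:R)^-1 * enorm (grad m (N *: e)) <= `|(A^T *m grad m (N *: e)) ord0 0| ->
  eball (N *: e) (5 * eps * N) xi -> eball (N *: e) (5 * eps * N) zeta ->
  (1024 * d%:R)^-1 * dotv (xi - zeta) (xi - zeta) <=
    (m xi - m zeta) ^+ 2 / (2 * pi * (C_L^-1 * N `^ (sigma - 1))) ^+ 2
    + dotv (tailv (A^T *m (xi - zeta))) (tailv (A^T *m (xi - zeta))).
Proof.
move=> sm s2 sd eps0 epsk N2 e1 oA good bxi bzeta.
have CL1 := symbol_C_L sm; have CM1 := symbol_C_max sm.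
have CL0 : 0 < C_L by lra.
have N0 : 0 < N by lra.
set c := N *: e; pose r := 5 * eps * N.
have r0 : 0 <= r by rewrite /r !mulr_ge0// ltW.
have d1 : 1 <= d%:R :> R by rewrite ler1n.
have d0 : 0 < d%:R :> R by lra.
have p1 : 1 <= 2 ^+ d :> R by apply: exprn_ege1; lra.
have p0 : 0 < 2 ^+ d :> R by lra.
have K0 : 0 < 20 * d%:R ^+ 3 * 2 ^+ d :> R.
  by apply: mulr_gt0 => //; apply: mulr_gt0 => //; exact: exprn_gt0.
(* The linearization error [d^2 M r], with [M = 2^d C_L N^(sigma - 2)] and [r = 5 eps N], must not
   exceed [C_L^-1 N^(sigma - 1) / (4 d)]. This is that condition, and it fixes the value of [k]. *)
have key : 20 * d%:R ^+ 3 * 2 ^+ d * C_L ^+ 2 * eps <= 1.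
  rewrite -ler_pdivlMl; last by apply: mulr_gt0 => //; exact: exprn_gt0.
  by rewrite mulr1 invfM.
(* Points of the box are within [d r] of [c], and now [d r <= N / 2]. Their norm then lies between
   [N / 2], which is at least [C_max], and [2 N], so the symbol bounds apply. *)
have key' : 10 * d%:R * eps <= 1.
  apply: le_trans key; rewrite ler_wpM2r ?(ltW eps0)//.
  have h1 : d%:R <= d%:R ^+ 3 :> R by rewrite exprS ler_peMr ?(ltW d0)// exprn_ege1.
  have h2 : 1 <= C_L ^+ 2 by rewrite exprn_ege1.
  have d30 : 0 <= 20 * d%:R ^+ 3 :> R by lra.
  apply: (@le_trans _ _ (20 * d%:R ^+ 3)); first lra.
  rewrite -[X in _ <= X]mulrA ler_peMr//.
  by rewrite mulr_ege1.
have cN : enorm c = N by rewrite /c enormZ e1 mulr1 ger0_norm// ltW.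
have bN p : box c r p -> N / 2 <= enorm p <= 2 * N.
  move=> /(enorm_box r0); have -> : d%:R * r = 10 * d%:R * eps * (N / 2) by rewrite /r; field.
  move=> h; have {h} : enorm (p - c) <= N / 2.
    by apply: le_trans h _; rewrite ler_piMl// divr_ge0// ltW.
  move=> h; have := enorm_triangle (p - c) c; have := enorm_triangle (c - p) p.
  rewrite !subrK cN (enormB c) => h1 h2; apply/andP; split; lra.
(* [2^(sigma - 2) <= 2^d] because [sigma <= d]; the constant thus depends on the dimension alone. *)
pose M := C_L * (2 ^+ d * N `^ (sigma - 2)).
have M0 : 0 <= M by rewrite !mulr_ge0 ?powR_ge0// ltW.
have hM p i j : box c r p -> `|partial i (partial j m) p| <= M.
  move=> /bN/andP[p1' p2]; apply: le_trans (symbol_second_partial i j sm _) _; first by lra.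
  rewrite ler_wpM2l ?(ltW CL0)//; apply: (@le_trans _ _ ((2 * N) `^ (sigma - 2))).
    by rewrite ge0_ler_powR ?nnegrE ?enorm_ge0//; [lra|rewrite mulr_ge0// ltW].
  rewrite powRM ?(ltW N0)// ler_wpM2r ?powR_ge0// -powR_mulrn// ler_powR//; first lra.
  lra.
have eb x : eball c r x -> box c r x.
  by move=> hx i; have := coord_le_enorm (x - c) i; rewrite !mxE => h; exact: le_trans hx.
have lin := linearization (symbol_smooth sm) r0 M0 hM (eb _ bxi) (eb _ bzeta).
set v := grad m c in good lin.
set w := xi - zeta in lin *.
pose u := A^T *m w; pose g := A^T *m v.
have gw : dotv v w = g ord0 0 * u ord0 0 + dotv (tailv g) (tailv u).
  by rewrite -(dotv_orthogonal _ _ oA) -/u -/g {1}(consvP g) {1}(consvP u) dotv_consv.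
have ww : enorm w ^+ 2 = (u ord0 0) ^+ 2 + enorm (tailv u) ^+ 2.
  by rewrite !enorm_sqr -(dotv_orthogonal w w oA) -/u {1 2}(consvP u) dotv_consv expr2.
have gv : enorm (tailv g) <= enorm v.
  have vv : dotv v v = g ord0 0 ^+ 2 + dotv (tailv g) (tailv g).
    by rewrite -(dotv_orthogonal v v oA) -/g {1 2}(consvP g) dotv_consv expr2.
  by rewrite enorm_le_sqr ?enorm_ge0// enorm_sqr vv lerDr sqr_ge0.
have l0 : 0 < C_L^-1 * N `^ (sigma - 1) by rewrite mulr_gt0 ?invr_gt0 ?powR_gt0.
have lG : C_L^-1 * N `^ (sigma - 1) <= enorm v.
  by have := symbol_grad sm (xi := c); rewrite cN; apply; lra.
have s1 : 1 <= Num.sqrt d%:R :> R by rewrite -[leLHS]sqrtr1 ler_wsqrtr.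
have ss : Num.sqrt d%:R ^+ 2 = d%:R :> R by rewrite sqr_sqrtr// ltW.
rewrite -[X in (1024 * X)^-1]ss -!enorm_sqr.
(* Coordinates [A^T] put [O e_j] first. Then [s = sqrt d] comes from the choice of [j], [l] from the
   lower bound on the gradient, and [err] is the linearization error. *)
apply: (@expansion_arith _ _ (enorm v) _ (g ord0 0) (u ord0 0) (dotv (tailv g) (tailv u))
  (m xi - m zeta - dotv v w)) => //; rewrite ?enorm_ge0//.
- apply: le_trans (normr_dotv_le _ _) _.
  by rewrite ler_wpM2r ?enorm_ge0.
- apply: le_trans lin _; rewrite ler_wpM2r ?enorm_ge0//.
  apply: (@le_trans _ _ (C_L^-1 * N `^ (sigma - 1) / (4 * d%:R))); last first.
    rewrite ler_wpM2l ?(ltW l0)// lef_pV2 ?posrE ?mulr_gt0//; last lra.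
    by rewrite ler_pM2l// -[leRHS]ss expr2 ler_peMr//; lra.
  have NN : N `^ (sigma - 1) = N `^ (sigma - 2) * N.
    rewrite -[X in _ = _ * X]powRr1 ?(ltW N0)// -powRD ?(gt_eqF N0) ?implybT//.
    by congr (_ `^ _); ring.
  rewrite NN /M /r.
  have -> : d%:R ^+ 2 * (C_L * (2 ^+ d * N `^ (sigma - 2))) * (5 * eps * N) =
    C_L^-1 * (N `^ (sigma - 2) * N) / (4 * d%:R) * (20 * d%:R ^+ 3 * 2 ^+ d * C_L ^+ 2 * eps).
    move: (2 ^+ d) (d%:R : R) d0 (N `^ _) => q D D0 Q; field.
    by rewrite !lt0r_neq0.
  rewrite ler_piMr//; rewrite !mulr_ge0 ?invr_ge0 ?powR_ge0 ?(ltW CL0) ?(ltW N0)//.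
- by rewrite gw; ring.
Qed.

End symbol_expansion.

(** * Sectors and their multipliers *)

Lemma measurable_inv_ge0 (R : realType) d (T : measurableType d) (g : T -> R) :
  (forall x, 0 <= g x) -> measT g -> measT (fun x => (g x)^-1).
Proof.
move=> g0 mg; have -> : (fun x => (g x)^-1) = (fun x => g x `^ (-1)).
  by apply/funext => x; rewrite powR_inv1.
have -> : (fun x => g x `^ (-1)) = (@powR R ^~ (-1)) \o g by [].
apply: measurableT_comp mg; exact: measurable_powR.
Qed.

Section sector_cutoffs.
Context (R : realType) (d : nat) (eps : R) (S : {fset 'cV[R]_d}) (chi : R -> R).
Hypothesis eps01 : 0 < eps <= 1.
Hypothesis net : direction_net eps S.
Hypothesis cut : cutoff eps chi.

Let eps0 : 0 < eps. Proof. by case/andP: eps01. Qed.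
Let eps1 : eps <= 1. Proof. by case/andP: eps01. Qed.

Lemma cutoff_le1 r : 0 <= r -> chi r <= 1.
Proof.
move=> r0; rewrite -(cutoff_one cut (r := 0)) ?lexx ?ler01//.
exact: (cutoff_noninc cut).
Qed.

(** [chi] is controlled on the half-line only; composed with [max 0] it is monotone on the whole
    line, hence measurable. *)
Lemma measurable_cutoff d' (T : measurableType d') (g : T -> R) : (forall x, 0 <= g x) ->
  measT g -> measT (fun x => chi (g x)).
Proof.
move=> g0 mg; have -> : (fun x => chi (g x)) = (fun r => chi (Num.max 0 r)) \o g.
  by apply/funext => x /=; rewrite max_r.
apply: measurableT_comp mg; apply: nonincreasing_measurable => // x y xy.
apply: (cutoff_noninc cut); first by rewrite le_max lexx.
by rewrite ge_max !le_max lexx xy orbT.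
Qed.

Lemma measurable_chi_rad N : 0 <= N -> measT (fun xi : 'cV[R]_d => chi_rad eps chi N xi).
Proof.
move=> N0.
have m1 (c : R) : 0 <= c -> measT (fun xi : 'cV[R]_d => chi (enorm xi / c)).
  move=> c0; apply: measurable_cutoff => [x|]; first by rewrite divr_ge0 ?enorm_ge0.
  by apply: measurable_funM => //; exact: measurable_enorm.
rewrite /chi_rad; case: (1 < N); last by apply: m1; rewrite addr_ge0// ltW.
by apply: measurable_funB; apply: m1 => //; rewrite mulr_ge0// addr_ge0// ltW.
Qed.

Lemma measurable_chi_dir e : measT (fun xi : 'cV[R]_d => chi_dir eps chi e xi).
Proof.
apply: measurable_cutoff => [x|]; first by rewrite divr_ge0 ?enorm_ge0 ?ltW.
apply: measurable_funM => //.
have -> : (fun xi : 'cV[R]_d => enorm ((enorm xi)^-1 *: xi - e)) =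
    (fun x => enorm (x - e)) \o (fun xi : 'cV[R]_d => (enorm xi)^-1 *: xi) by [].
apply: measurableT_comp; first exact: measurable_enormB.
apply: measurable_fun_mx => i j.
have -> : (fun xi : 'cV[R]_d => ((enorm xi)^-1 *: xi) i j) = (fun xi => (enorm xi)^-1 * xi i j).
  by apply/funext => xi; rewrite mxE.
apply: measurable_funM; last exact: measurable_mx_coord.
by apply: measurable_inv_ge0 => [x|]; [exact: enorm_ge0|exact: measurable_enorm].
Qed.

Lemma chi_dir_ge0 e (xi : 'cV[R]_d) : 0 <= chi_dir eps chi e xi.
Proof. by apply: (cutoff_ge0 cut); rewrite divr_ge0 ?enorm_ge0 ?ltW. Qed.

Lemma measurable_chi_sector th : 0 <= sector_N th ->
  measT (fun xi : 'cV[R]_d => chi_sector eps S chi th xi).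
Proof.
move=> N0; rewrite /chi_sector; case: (1 < sector_N th); last first.
  by apply: measurable_funM => //; exact: measurable_chi_rad.
apply: measurable_funM; first exact: measurable_chi_rad.
apply: measurable_funM; first exact: measurable_chi_dir.
apply: measurable_inv_ge0 => [x|]; first by apply: sumr_ge0 => e _; exact: chi_dir_ge0.
by apply: measurable_sum => e; exact: measurable_chi_dir.
Qed.

Lemma normr_chi_rad_le1 N (xi : 'cV[R]_d) : 0 <= N -> `|chi_rad eps chi N xi| <= 1.
Proof.
move=> N0.
have h (c : R) : 0 <= c -> 0 <= chi (enorm (xi : 'cV[R]_d) / c) <= 1.
  move=> c0; have x0 : 0 <= enorm xi / c by rewrite divr_ge0 ?enorm_ge0.
  by rewrite (cutoff_ge0 cut)// cutoff_le1.
have e1 : 0 <= 1 + eps by rewrite addr_ge0// ltW.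
rewrite /chi_rad; case: ifP => _; last first.
  by have /andP[h0 h1] := h _ e1; rewrite ger0_norm.
have /andP[h0 h1] := h _ N0; have /andP[h2 h3] := h _ (mulr_ge0 e1 N0).
by rewrite ler_norml; apply/andP; split; lra.
Qed.

Lemma normr_chi_sector_le1 th xi : 0 <= sector_N th -> sector_e th \in S ->
  `|chi_sector eps S chi th xi| <= 1.
Proof.
move=> N0 eS; rewrite /chi_sector; case: ifP => _; rewrite normrM mulr_ile1 ?normr_ge0 ?normr_chi_rad_le1//.
- have s0 : 0 <= \sum_(e' <- S) chi_dir eps chi e' xi.
    by apply: sumr_ge0 => e _; exact: chi_dir_ge0.
  rewrite ger0_norm; last by rewrite divr_ge0 ?chi_dir_ge0.
  (* Where the angular sum vanishes, the quotient is zero because the inverse of zero is zero. *)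
  rewrite /chi_ang; have [->|s1] := eqVneq (\sum_(e' <- S) chi_dir eps chi e' xi) 0; first by rewrite invr0 mulr0.
  rewrite ler_pdivrMr ?mul1r; last by rewrite lt_neqAle eq_sym s1.
  rewrite (big_rem (sector_e th))//= lerDl.
  by apply: sumr_ge0 => e _; exact: chi_dir_ge0.
- rewrite ger0_norm ?invr_ge0// invf_le1 ?ler1n ?ltr0n cardfs_gt0;
  by apply/fset0Pn; exists (sector_e th).
Qed.

(** The radius [5 eps N] is an angular deviation of at most [2 eps N] plus a radial one of at most
    [3 eps N]; the radius 4 of the lowest sector is [(1 + 1)^2]. *)
Lemma chi_sector_support th xi : sector_family eps S th -> chi_sector eps S chi th xi != 0 ->
  if 1 < sector_N th then eball (sector_center th) (5 * eps * sector_N th) xi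
  else eball (sector_center th) 4 xi.
Proof.
case: th => N e [/= [k ->] eS]; set N' := (1 + eps) ^+ k.
have e1 : 1 <= 1 + eps by rewrite lerDl ltW.
have e0 : 0 < 1 + eps by lra.
have e2 : (1 + eps) ^+ 2 <= 1 + 3 * eps.
  by have := mulr_ge0 (ltW eps0) (_ : 0 <= 1 - eps); rewrite ?subr_ge0// => /(_ eps1); lra.
rewrite /chi_sector /sector_center /eball/=; case: ifPn => N1; rewrite mulf_eq0 negb_or => /andP[h1 h2].
- have N0 : 0 < N' by lra.
  have hN : N' < enorm xi.
    rewrite ltNge; apply/negP => h; move: h1; rewrite /chi_rad N1 !(cutoff_one cut) ?subrr ?eqxx//.
      by rewrite divr_ge0 ?enorm_ge0 ?(ltW N0)//= ler_pdivrMr ?mul1r.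
    rewrite divr_ge0 ?enorm_ge0 ?mulr_ge0 ?(ltW N0) ?(ltW e0)//= ler_pdivrMr ?mulr_gt0// mul1r.
    by apply: le_trans h _; rewrite ler_peMl// ltW.
  have hN2 : enorm xi < (1 + eps) ^+ 2 * N'.
    rewrite ltNge; apply/negP => h; move: h1; rewrite /chi_rad N1 !(cutoff_zero cut) ?subrr ?eqxx//.
      rewrite ler_pdivlMr//; apply: le_trans h; rewrite ler_wpM2r ?(ltW N0)//.
      by rewrite expr2 ler_peMl// ltW.
    by rewrite ler_pdivlMr ?mulr_gt0// mulrA -expr2.
  have he : enorm ((enorm xi)^-1 *: xi - e) < 2 * eps.
    have : chi_dir eps chi e xi != 0 by move: h2; rewrite /chi_ang mulf_eq0 negb_or => /andP[].
    apply: contraNT; rewrite -leNgt /chi_dir => h; rewrite (cutoff_zero cut)//.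
    by rewrite ler_pdivlMr//; apply: le_trans h; rewrite ler_wpM2r ?(ltW eps0)// [leRHS](_ : 2 = 1 + 1)// lerD2l.
  have x0 : 0 < enorm xi by exact: lt_trans hN.
  pose w : 'cV[R]_d := (enorm xi)^-1 *: xi; rewrite -/w in he.
  have w1 : enorm w = 1 by rewrite /w enormZ ger0_norm ?invr_ge0 ?enorm_ge0// mulVf// gt_eqF.
  have wx : enorm xi *: w = xi by rewrite /w scalerA mulfV ?scale1r// gt_eqF.
  clearbody w.
  have -> : xi - N' *: e = N' *: (w - e) + (enorm xi - N') *: w.
    rewrite -[X in X - _ = _]wx; by apply/colP => i; rewrite !mxE; ring.
  apply: le_trans (enorm_triangle _ _) _; rewrite !enormZ w1 mulr1 !ger0_norm ?(ltW N0)//; last first.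
    by rewrite subr_ge0 ltW.
  have h3 : N' * enorm (w - e) <= N' * (2 * eps) by rewrite ler_wpM2l// ltW.
  have h4 : (1 + eps) ^+ 2 * N' <= (1 + 3 * eps) * N' by rewrite ler_wpM2r// ltW.
  lra.
- rewrite subr0; move: h2; apply: contraNT; rewrite -ltNge => h; rewrite /chi_rad (negbTE N1).
  rewrite (cutoff_zero cut)// ler_pdivlMr// -expr2; apply: le_trans (ltW h).
  apply: le_trans e2 _; have := eps1; lra.
Qed.

End sector_cutoffs.

(** * Square-integrable functions and localized multipliers *)

Section square_integrable.
Context (R : realType) (d : nat).
Notation leb := (@lebesgue_cV R d).
Implicit Types (F G : 'cV[R]_d -> R[i]).

Lemma Re_realM (a : R) (z : R[i]) : complex.Re (a%:C * z) = a * complex.Re z.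
Proof. by case: z => x y /=; rewrite mul0r subr0. Qed.

Lemma Im_realM (a : R) (z : R[i]) : complex.Im (a%:C * z) = a * complex.Im z.
Proof. by case: z => x y /=; rewrite mul0r addr0. Qed.

Lemma L2_measurable F : L2 leb F ->
  measT (rpart F) /\ measT (ipart F).
Proof. by case. Qed.

Lemma L2_integral F : L2 leb F -> (\int[leb]_x (sqrn (F x))%:E < +oo)%E.
Proof.
move=> [_ F2]; rewrite -cLnorm2_sqr.
have := Lnorm_ge0 leb 2%:E (fun x => (Normc.normc (F x))%:E).
rewrite -/(cLnorm leb 2%:E F); move: (cLnorm leb 2%:E F) F2 => [r||]// _ r0.
by rewrite -EFinM ltry.
Qed.

Lemma L2_0 : L2 leb (cst 0).
Proof.
split; first by split; exact: measurable_cst.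
have := cLnorm2_sqr leb (cst 0 : 'cV[R]_d -> R[i]).
rewrite (_ : (fun x => _) = cst 0%E); last first.
  by apply/funext => x; rewrite /sqrn/= expr0n addr0.
rewrite integral0 => /eqP; rewrite mule_eq0 orbb => /eqP ->; exact: ltry.
Qed.

(* The second case is the default value of [xget]. *)
Lemma fourier_dichotomy (f : 'cV[R]_d -> R[i]) : is_fourier f (fourier f) \/ fourier f = cst 0.
Proof.
rewrite /fourier; have [[g fg]|nf] := pselect (exists g, is_fourier f g).
  by left; exact: (xgetPex _ (ex_intro _ g fg)).
by right; rewrite xgetPN// => g fg; apply: nf; exists g.
Qed.

Lemma L2_fourier (f : 'cV[R]_d -> R[i]) : L2 leb (fourier f).
Proof. by have [[]//|->] := fourier_dichotomy f; exact: L2_0. Qed.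

Lemma L2_part_lt F (f : 'cV[R]_d -> R) : L2 leb F -> (forall x, f x ^+ 2 <= sqrn (F x)) ->
  (\int[leb]_x (f x ^+ 2)%:E < +oo)%E.
Proof.
move=> F2 fF; apply: le_lt_trans (L2_integral F2).
by apply: ge0_le_integralW => x _; rewrite lee_fin ?sqr_ge0.
Qed.

(** On the ball [|g| <= 1 + g^2], and balls have finite measure. *)
Lemma integrable_bounded_support (a g : 'cV[R]_d -> R) c (r : R) :
  measT a -> measT g ->
  (forall x, `|a x| <= 1) -> (forall x, ~ eball c r x -> a x * g x = 0) ->
  (\int[leb]_x (g x ^+ 2)%:E < +oo)%E ->
  intT leb (fun x => a x * g x).
Proof.
move=> ma mg a1 supp g2.
have mg2 : measT (fun x => (g x ^+ 2)%:E).
  by apply/measurable_EFinP; exact: measurable_funX.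
apply: (@integrable_le _ _ R leb _ (fun x => \1_(eball c r) x + g x ^+ 2)).
- exact: measurable_funM.
- move=> x; have [xb|xb] := pselect (eball c r x); last first.
    by rewrite supp// normr0 addr_ge0 ?sqr_ge0// indicE.
  rewrite indicE mem_set//= normrM.
  apply: (@le_trans _ _ `|g x|); first by rewrite ler_piMl// a1.
  by rewrite -(real_normK (num_real (g x))); have := sqr_ge0 (`|g x| - 1); rewrite sqrrB; have := normr_ge0 (g x); lra.
- rewrite (_ : (fun x => _) = (fun x => (\1_(eball c r) x)%:E + (g x ^+ 2)%:E)%E); last first.
    by apply/funext => x; rewrite EFinD.
  have mi : measT (fun x : 'cV[R]_d => (\1_(eball c r) x : R)%:E).
    by apply/measurable_EFinP; apply: measurable_indic; exact: measurable_eball.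
  rewrite ge0_integralD//; try by move=> x _; rewrite lee_fin ?sqr_ge0// indicE.
  apply: lte_add_pinfty => //.
  have /integrableP[_] := integrable_eball c r; apply: le_lt_trans.
  by apply: ge0_le_integralW => x _ //=; rewrite lee_fin ler_norm.
Qed.

Lemma cis_integral_ae (phi : 'cV[R]_d -> R) F G :
  measT phi ->
  measT (rpart F) -> measT (ipart F) ->
  measT (rpart G) -> measT (ipart G) ->
  {ae leb, forall x, F x = G x} ->
  cintegral leb setT (fun x => cis (phi x) * F x) = cintegral leb setT (fun x => cis (phi x) * G x).
Proof.
move=> mphi mFr mFi mGr mGi FG.
have mc : measT (fun x => cos (phi x)).
  exact: measurableT_comp (@measurable_cos R) mphi.
have ms : measT (fun x => cos (phi x - pi / 2)).
  by apply: measurableT_comp (@measurable_cos R) _; exact: measurable_funB.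
have mR (K : 'cV[R]_d -> R[i]) : measT (rpart K) -> measT (ipart K) ->
   measT (fun x => (complex.Re (cis (phi x) * K x))%:E).
  move=> mr mi; apply/measurable_EFinP; under eq_fun do rewrite Re_cisM.
  by apply: measurable_funB; apply: measurable_funM.
have mI (K : 'cV[R]_d -> R[i]) : measT (rpart K) -> measT (ipart K) ->
   measT (fun x => (complex.Im (cis (phi x) * K x))%:E).
  move=> mr mi; apply/measurable_EFinP; under eq_fun do rewrite Im_cisM.
  by apply: measurable_funD; apply: measurable_funM.
apply: complexP; rewrite /cintegral/= /Rintegral; congr fine; apply: ae_eq_integral => //;
  try exact: mR; try exact: mI.
- by apply: filterS FG => x /= -> _.
- by apply: filterS FG => x /= -> _.
Qed.

(** A representative that vanishes everywhere off [D]. The lemmas on oscillating integrals require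
    pointwise supports, while transforms are known only a.e. *)
Definition restrict (D : set 'cV[R]_d) F x : R[i] := if x \in D then F x else 0.

Lemma measurable_restrict D F : measurable D ->
  measT (rpart F) -> measT (ipart F) ->
  measT (rpart (restrict D F)) /\ measT (ipart (restrict D F)).
Proof.
move=> mD mr mi; split.
- have -> : rpart (restrict D F) = (fun x => \1_D x * rpart F x).
    by apply/funext => x; rewrite /rpart /restrict indicE; case: (x \in D); rewrite ?mul1r ?mul0r.
  by apply: measurable_funM => //; exact: measurable_indic.
- have -> : ipart (restrict D F) = (fun x => \1_D x * ipart F x).
    by apply/funext => x; rewrite /ipart /restrict indicE; case: (x \in D); rewrite ?mul1r ?mul0r.
  by apply: measurable_funM => //; exact: measurable_indic.
Qed.

Lemma restrict_out D F x : ~ D x -> restrict D F x = 0.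
Proof. by move=> nD; rewrite /restrict memNset. Qed.

Lemma restrict_ae D F : {ae leb, forall x, ~ D x -> F x = 0} ->
  {ae leb, forall x, F x = restrict D F x}.
Proof.
apply: filterS => x h; rewrite /restrict; case: ifPn => // /negP xD.
by apply: h => Dx; apply: xD; rewrite inE.
Qed.

Lemma sqrn_restrict_le D F x : sqrn (restrict D F x) <= sqrn (F x).
Proof. by rewrite /restrict; case: ifP => // _; rewrite {1}/sqrn/= expr0n addr0 sqrn_ge0. Qed.

End square_integrable.

Section localized_multiplier.
Context (R : realType) (d : nat).
Notation leb := (@lebesgue_cV R d).
Variables (a : 'cV[R]_d -> R) (F : 'cV[R]_d -> R[i]) (c0 : 'cV[R]_d) (r0 : R).
Hypothesis ma : measT a.
Hypothesis a1 : forall x, `|a x| <= 1.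
Hypothesis asupp : forall x, ~ eball c0 r0 x -> a x = 0.
Hypothesis F2 : L2 leb F.

Let H xi := (a xi)%:C * F xi.
Let h x := cintegral leb setT (fun xi => cis (2 * pi * dotv x xi) * H xi).
Let G := fourier h.

Let mFr : measT (rpart F). Proof. by have [] := L2_measurable F2. Qed.
Let mFi : measT (ipart F). Proof. by have [] := L2_measurable F2. Qed.

Let HrE : rpart H = (fun x => a x * rpart F x).
Proof. by apply/funext => x; rewrite /rpart Re_realM. Qed.

Let HiE : ipart H = (fun x => a x * ipart F x).
Proof. by apply/funext => x; rewrite /ipart Im_realM. Qed.

Let iHr : intT leb (rpart H).
Proof.
rewrite HrE; apply: (@integrable_bounded_support _ _ _ _ c0 r0) => //.
  by move=> x /asupp ->; rewrite mul0r.
by apply: (L2_part_lt F2) => x; rewrite lerDl sqr_ge0.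
Qed.

Let iHi : intT leb (ipart H).
Proof.
rewrite HiE; apply: (@integrable_bounded_support _ _ _ _ c0 r0) => //.
  by move=> x /asupp ->; rewrite mul0r.
by apply: (L2_part_lt F2) => x; rewrite lerDr sqr_ge0.
Qed.

Let mHr : measT (rpart H). Proof. exact: (integrable_measurable iHr). Qed.
Let mHi : measT (ipart H). Proof. exact: (integrable_measurable iHi). Qed.

Lemma localized_fourier_le : (\int[leb]_xi (sqrn (G xi))%:E <= 4%:E * \int[leb]_x (sqrn (h x))%:E)%E.
Proof.
have [hG|G0] := fourier_dichotomy h; first exact: (is_fourier_L2_le iHr iHi (fun=> erefl) hG).
rewrite /G G0 (_ : (fun x => _) = cst 0%E); last first.
  by apply/funext => x; rewrite /sqrn/= expr0n addr0.
rewrite integral0 mule_ge0//; apply: integral_ge0 => x _; exact: sqrn_ge0.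
Qed.

Lemma localized_fourier_support c r : {ae leb, forall xi, ~ eball c r xi -> H xi = 0} ->
  {ae leb, forall xi, ~ eball c r xi -> G xi = 0}.
Proof.
move=> Hcr; have [hG|G0] := fourier_dichotomy h; last by apply: nearW => x _; rewrite /G G0.
have mD : measurable (eball c r) by exact: measurable_eball.
(* A null change of [H] leaves [h] untouched and makes the support condition pointwise. *)
pose H' := restrict (eball c r) H.
have [mr mi] := measurable_restrict mD mHr mHi.
have HH' := restrict_ae Hcr.
have restr_le x : `|rpart H' x| <= `|rpart H x| /\ `|ipart H' x| <= `|ipart H x|.
  by rewrite /rpart /ipart /H' /restrict; case: ifP => _ //; rewrite normr0.
have ir : intT leb (rpart H').
  apply: (@integrable_le _ _ R leb _ (fun x => `|rpart H x|)) => //.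
    by move=> x; have [] := restr_le x.
  by have /integrableP[_] := iHr.
have ii : intT leb (ipart H').
  apply: (@integrable_le _ _ R leb _ (fun x => `|ipart H x|)) => //.
    by move=> x; have [] := restr_le x.
  by have /integrableP[_] := iHi.
have H2 : (\int[leb]_x (sqrn (H' x))%:E < +oo)%E.
  apply: le_lt_trans (L2_integral F2).
  apply: ge0_le_integralW => x _; rewrite lee_fin ?sqrn_ge0//.
  apply: le_trans (sqrn_restrict_le _ _ _) _.
  rewrite /sqrn Re_realM Im_realM !exprMn -mulrDr ler_piMl ?sqrn_ge0//.
  by rewrite -(real_normK (num_real _)) exprn_ile1.
have hE x : h x = cintegral leb setT (fun xi => cis (2 * pi * dotv x xi) * H' xi).
  apply: cis_integral_ae => //.
  by apply: measurable_funM => //; apply: measurable_dotv.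
apply: (is_fourier_support ir ii H2 hE hG) => xi nb; exact: restrict_out.
Qed.

Lemma localized_null : {ae leb, forall xi, H xi = 0} -> cLnorm leb 2%:E h = 0%E.
Proof.
move=> H0; have h0 x : h x = 0.
  rewrite /h (cis_integral_ae (G := cst 0))//; try exact: measurable_cst.
    by apply: complexP; rewrite [LHS]/= /Rintegral integral0_eq// => y _; rewrite /= !mulr0 ?subr0 ?addr0.
  by apply: measurable_funM => //; apply: measurable_dotv.
have := cLnorm2_sqr leb h; rewrite (_ : (fun x => _) = cst 0%E); last first.
  by apply/funext => x; rewrite h0 /sqrn/= expr0n addr0.
by rewrite integral0 => /eqP; rewrite mule_eq0 orbb => /eqP.
Qed.

End localized_multiplier.

(** For spectra of diameter zero, to which Bernstein's inequality with a positive radius does not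
    apply. *)
Lemma lebesgue_point (R : realType) n (c : 'cV[R]_n.+1) : lebesgue_cV (eball c 0) = 0%E.
Proof.
have [c0 cE] : exists y, eball c 0 = [set consv (c ord0 0, y)].
  exists (tailv c); apply/seteqP; split=> x /=.
    rewrite /eball/= => xc; rewrite -consvP.
    by apply/eqP; rewrite -subr_eq0; apply/eqP/enorm_eq0/le_anti; rewrite xc enorm_ge0.
  by move=> ->; rewrite -consvP /eball/= subrr enorm0.
rewrite /= /lebesgue_cons /pushforward.
have -> : consv @^-1` eball c 0 = [set c ord0 0] `*` [set c0].
  rewrite cE; apply/seteqP; split=> -[s y] /=.
    move=> e; split; first by have := congr1 (fun v : 'cV[R]_n.+1 => v ord0 0) e; rewrite !consv0.
    by apply/colP => i; have := congr1 (fun v : 'cV[R]_n.+1 => v (lift ord0 i) 0) e; rewrite !consvS.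
  by move=> [-> ->].
have m1 : measurable [set c0].
  have -> : [set c0] = eball c0 0; last exact: measurable_eball.
  apply/seteqP; split=> x /=; first by move=> ->; rewrite /eball/= subrr enorm0.
  rewrite /eball/= => xc.
  by apply/eqP; rewrite -subr_eq0; apply/eqP/enorm_eq0/le_anti; rewrite xc enorm_ge0.
rewrite product_measure1E//.
transitivity (0 * lebesgue_cV [set c0])%E; last exact: mul0e.
by congr (_ * _)%E; exact: lebesgue_measure_set1.
Qed.

Lemma ess_support_eball (R : realType) d (F : 'cV[R]_d -> R[i]) (r : R) :
  (ediam (ess_support F) <= r%:E)%E -> 0 <= r /\
  exists c, {ae lebesgue_cV, forall x, ~ eball c r x -> F x = 0}.
Proof.
rewrite /ediam ge_max => /andP[r0 dr]; split; first by rewrite -lee_fin.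
have ae := ae_ess_support F.
have [e0|/set0P[c Fc]] := eqVneq (ess_support F) set0.
  by exists 0; apply: filterS ae => x + _; apply; rewrite e0.
(* Any point of the support can be the centre, with the diameter as radius. *)
exists c; apply: filterS ae => x + xc; apply => Fx; apply: xc.
rewrite /eball/= -lee_fin; apply: le_trans dr; apply: ereal_sup_ubound.
by exists (x, c).
Qed.

(** * Directional estimates *)

Section interpolation.
Context d (T : measurableType d) (R : realType) (mu : {measure set T -> \bar R}).

(** [|v|^p <= (M S)^(p/2 - 1) W], and the integral of [W] is at most [S]. One quantity [S] governs
    both endpoints, so only powers of [M] depend on [c]. *)
Lemma cLnorm_interpolation (v : T -> R[i]) (W : T -> R) (M S : R) (c : \bar R) :
  (2%:E <= c)%E -> 0 <= M -> 0 <= S -> measT W ->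
  (forall x, sqrn (v x) <= W x) -> (forall x, W x <= M * S) ->
  (\int[mu]_x (W x)%:E <= S%:E)%E ->
  (cLnorm mu c v <= (M `^ (2^-1 - fine (c^-1)%E) * Num.sqrt S)%:E)%E.
Proof.
move=> c2 M0 S0 mW vW WMS iW.
have W0 x : 0 <= W x by exact: le_trans (sqrn_ge0 _) (vW x).
have MS0 : 0 <= M * S by exact: mulr_ge0.
case: c c2 => [p| |]//; last first.
  move=> _; rewrite invey /= subr0 /cLnorm unlock; case: ifP => _; last first.
    by rewrite lee_fin mulr_ge0 ?powR_ge0 ?sqrtr_ge0.
  apply/ess_sup_inf.ess_supP/aeW => x /=; rewrite lee_fin ger0_norm ?normc_nonneg//.
  rewrite powR12_sqrt// -sqrtrM// -[leLHS]ger0_norm ?normc_nonneg// -sqrtr_sqr normc_sqr.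
  by rewrite ler_wsqrtr// (le_trans (vW x)).
rewrite lee_fin => p2; have p0 : 0 < p by lra.
have pn0 : p != 0 by rewrite gt_eqF.
rewrite inver (negbTE pn0) /= /cLnorm unlock.
pose e := p / 2 - 1.
have e0 : 0 <= e by rewrite /e; lra.
have e1 : (e + 1 == 0) = false by apply/negbTE; rewrite gt_eqF//; lra.
have step x : (`|(Normc.normc (v x))%:E| `^ p <= ((M * S) `^ e)%:E * (W x)%:E)%E.
  have -> : (`|(Normc.normc (v x))%:E| `^ p = (Normc.normc (v x) `^ p)%:E)%E.
    by rewrite gee0_abs// lee_fin normc_nonneg.
  rewrite -EFinM lee_fin.
  have -> : p = 2 * (p / 2) by field.
  rewrite powRrM powR_mulrn ?normc_nonneg// normc_sqr.
  apply: (@le_trans _ _ (W x `^ (p / 2))).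
    by rewrite ge0_ler_powR ?nnegrE ?sqrn_ge0//; lra.
  have -> : p / 2 = e + 1 by rewrite /e; ring.
  rewrite powRD ?e1// powRr1//.
  by rewrite ler_wpM2r// ge0_ler_powR ?nnegrE.
have : (\int[mu]_x (`|(Normc.normc (v x))%:E| `^ p) <= ((M * S) `^ e * S)%:E)%E.
  apply: (@le_trans _ _ (\int[mu]_x (((M * S) `^ e)%:E * (W x)%:E))%E).
    by apply: ge0_le_integralW => x _; [exact: poweR_ge0|exact: step].
  have mWE : measT (fun x => (W x)%:E) by apply/measurable_EFinP.
  have W0E x : setT x -> (0 <= (W x)%:E)%E by rewrite lee_fin W0.
  have k0 : (0 <= ((M * S) `^ e)%:E)%E by rewrite lee_fin powR_ge0.
  by rewrite (ge0_integralZl mu measurableT mWE W0E k0) EFinM; exact: lee_wpmul2l.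
move=> /(gt0_ler_poweR (r := p^-1)) h.
apply: le_trans (h _ _ _) _.
- by rewrite invr_ge0 ltW.
- by rewrite in_itv/= leey andbT integral_ge0// => x _; exact: poweR_ge0.
- by rewrite in_itv/= leey andbT lee_fin mulr_ge0// powR_ge0.
rewrite poweR_EFin lee_fin.
have -> : (M * S) `^ e * S = M `^ e * S `^ (p / 2).
  rewrite powRM// -mulrA; congr (_ * _).
  have -> : p / 2 = e + 1 by rewrite /e; ring.
  by rewrite [RHS]powRD ?e1// powRr1.
rewrite powRM ?powR_ge0// -!powRrM.
have -> : p / 2 / p = 2^-1 by field.
have -> : e / p = 2^-1 - p^-1 by rewrite /e; field.
by rewrite powR12_sqrt.
Qed.

End interpolation.

(** * Plancherel bounds with the coordinate x1 frozen *)

Section slabs.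
Context (R : realType) (n : nat).
Notation d := n.+1.
Notation leb := (@lebesgue_cV R d).
Notation T1 := (measurableTypeR R).
Variables (A : 'M[R]_d).

Definition slice (x : 'cV[R]_d) : 'cV[R]_n := tailv (A^T *m x).

Definition slab (a g : 'cV[R]_d -> R) : \bar R :=
  (\int[lebesgue_cV]_y (osc_sqr (phase slice a y) g)%:E)%E.

Lemma measurable_slice : measT slice.
Proof.
apply: measurable_fun_mx => i j; rewrite ord1.
have -> : (fun x => slice x i 0) = (fun x => (A^T *m x) (lift ord0 i) 0).
  by apply/funext => x; rewrite mxE.
by apply: measurable_coord; apply: measurable_mulmxv.
Qed.

Lemma measurable_lead : measT (fun x : 'cV[R]_d => (A^T *m x) ord0 0).
Proof. by apply: measurable_coord; apply: measurable_mulmxv. Qed.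

Lemma measurable_consv_fun d' (T : measurableType d') k (f : T -> R) (g : T -> 'cV[R]_k) :
  measT f -> measT g -> measT (fun x => consv (f x, g x)).
Proof.
move=> mf mg; have mfg : measT (fun x => (f x, g x) : T1 * 'cV[R]_k).
  exact: measurable_fun_pair.
exact: (measurableT_comp (@measurable_consv R k) mfg).
Qed.

Section smoothing.
Variables (m alpha g : 'cV[R]_d -> R) (lam c0 : R) (D : set 'cV[R]_d).
Hypothesis mm : measT m.
Hypothesis malpha : measT alpha.
Hypothesis ig : intT leb g.
Hypothesis lam0 : 0 < lam.
Hypothesis c00 : 0 < c0.
Hypothesis mD : measurable D.
Hypothesis gD : forall x, ~ D x -> g x = 0.
Hypothesis expand : forall x y, D x -> D y -> c0 * dotv (x - y) (x - y) <=
  (m x - m y) ^+ 2 / (2 * pi * lam) ^+ 2 + dotv (tailv (A^T *m (x - y))) (tailv (A^T *m (x - y))).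

(** Division by [2 pi] offsets the factor in [phase]: pairing with [(t, y)] yields [- t m] plus the
    phase of the slice. *)
Let Phi x := consv (- (m x / (2 * pi)), slice x).

Let mPhi : measT Phi.
Proof.
apply: measurable_consv_fun; last exact: measurable_slice.
by apply: measurableT_comp => //; exact: measurable_funM.
Qed.

Let phaseE (t : R) y : phase Phi alpha (consv (t, y)) = phase slice (fun x => alpha x - t * m x) y.
Proof.
apply/funext => x; rewrite /phase dotv_consv mulrDr; have := pi_gt0 R.
move: (pi : R) (dotv y _) (m x) (alpha x) => q u v w q0.
by field; rewrite gt_eqF.
Qed.

Lemma measurable_slab : measurable_fun (setT : set T1) (fun t : T1 => slab (fun x => alpha x - t * m x) g).
Proof.
have -> : (fun t : T1 => slab (fun x => alpha x - t * m x) g) =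
   (fun t : T1 => \int[lebesgue_cV]_y ((fun z => (osc_sqr (phase Phi alpha z) g)%:E) \o consv) (t, y))%E.
  by apply/funext => t; apply: eq_integral => y _ /=; rewrite phaseE.
apply: (measurable_fun_fubini_tonelli_F (m2 := @lebesgue_cV R n)) => [|z]; last by rewrite /= lee_fin osc_sqr_ge0.
apply: measurableT_comp (@measurable_consv R n).
apply/measurable_EFinP; apply: measurable_osc_sqr_phase => //; exact: (integrable_measurable ig).
Qed.

(* [t] is dual to [- m / (2 pi)] and thus replaces the frozen coordinate. *)
Lemma slab_smoothing :
  (\int[lebesgue_measure]_(t in (setT : set T1)) slab (fun x => (alpha x - t * m x)%R) g
     <= (lam^-1 * (Num.sqrt c0)^-1 ^+ d)%:E * \int[leb]_x (g x ^+ 2)%:E)%E.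
Proof.
(* The weight [lam^-2] on the first component of [Phi] matches the hypothesis [expand]. The square
   root in the resulting constant turns [lam ^+ 2] into the single gain [lam^-1]. *)
pose b : 'cV[R]_d := consv (lam ^+ 2, const_mx 1).
have b0 : posv b.
  move=> i; have [j ->|->] := unliftP ord0 i; rewrite /b ?consv0 ?consvS ?mxE//=.
  exact: exprn_gt0.
have := osc_sqr_expansive mPhi malpha ig b0 c00 mD gD.
rewrite ge0_integral_consv; first last.
- by move=> x; rewrite lee_fin osc_sqr_ge0.
- by apply/measurable_EFinP; apply: measurable_osc_sqr_phase => //; exact: (integrable_measurable ig).
have -> : (\int[lebesgue_measure]_(t in (setT : set T1)) slab (fun x => (alpha x - t * m x)%R) g =
   \int[lebesgue_measure]_(s in (setT : set T1)) \int[lebesgue_cV]_y (osc_sqr (phase Phi alpha (consv (s, y))) g)%:E)%E.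
  by apply: eq_integral => t _; apply: eq_integral => y _; rewrite phaseE.
have -> : \prod_i (Num.sqrt (b i 0 * c0))^-1 = lam^-1 * (Num.sqrt c0)^-1 ^+ d.
  rewrite big_ord_recl /b consv0 /= sqrtrM ?sqr_ge0// sqrtr_sqr (gtr0_norm lam0) invfM [in RHS]exprS -!mulrA.
  rewrite (eq_bigr (fun=> (Num.sqrt c0)^-1)); last by move=> i _; rewrite consvS /= mxE mul1r.
  by rewrite big_const card_ord iter_mulr_1.
apply => x y Dx Dy; apply: le_trans (expand Dx Dy) _.
have slB : slice x - slice y = tailv (A^T *m (x - y)).
  by rewrite mulmxBr; apply/colP => i; rewrite /slice !mxE.
rewrite big_ord_recl /b consv0 /Phi consvB consv0 /=; apply: lerD.
  rewrite le_eqVlt; apply/orP; left; apply/eqP.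
  have := pi_gt0 R; move: (pi : R) (m x) (m y) lam lam0 => q u v l l0 q0.
  by field; rewrite !gt_eqF.
rewrite /dotv le_eqVlt; apply/orP; left; apply/eqP; apply: eq_bigr => i _.
by rewrite slB !consvS /= [const_mx 1 _ _]mxE invr1 mul1r expr2.
Qed.

End smoothing.

Section bounded_frequencies.
Variables (a g : 'cV[R]_d -> R) (r : R) (c : 'cV[R]_d).
Hypothesis oA : orthogonal_mx A.
Hypothesis ma : measT a.
Hypothesis ig : intT leb g.
Hypothesis r0 : 0 < r.
Hypothesis gsupp : forall x, ~ eball c r x -> g x = 0.

(** The leading frequency as a vector of length one, so that [bernstein] applies in dimension one
    and costs a single factor [r]. *)
Let Phi1 (x : 'cV[R]_d) : 'cV[R]_1 := consv ((A^T *m x) ord0 0, 0).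

Let mPhi1 : measT Phi1.
Proof. by apply: measurable_consv_fun => //; exact: measurable_lead. Qed.

Let supp x : g x != 0 -> dotv (Phi1 x - Phi1 c) (Phi1 x - Phi1 c) <= r ^+ 2.
Proof.
move=> gx; have xc : eball c r x by apply: contrapT => /gsupp e; rewrite e eqxx in gx.
rewrite /Phi1 consvB dotv_consv subr0 [dotv 0 0]big_ord0 addr0.
have -> : (A^T *m x) ord0 0 - (A^T *m c) ord0 0 = (A^T *m (x - c)) ord0 0.
  by rewrite mulmxBr [RHS]mxE [X in _ = _ + X]mxE.
rewrite -expr2 -(real_normK (num_real _)) lerXn2r ?nnegrE ?(ltW r0)//.
apply: le_trans (coord_le_enorm _ _) _.
by rewrite /enorm (dotv_orthogonal _ _ oA); exact: xc.
Qed.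

Let gt := gauss_amplify Phi1 g (Phi1 c) r.
Let igt : intT leb gt. Proof. exact: integrable_gauss_amplify. Qed.

Let ay y (x : 'cV[R]_d) := 2 * pi * dotv y (slice x) + a x.

Let may y : measT (ay y).
Proof.
apply: measurable_funD => //; apply: measurable_funM => //.
by apply: measurable_dotv => //; exact: measurable_slice.
Qed.

Let phase1E s y z : phase Phi1 (ay y) (consv (s, z)) = phase (fun x => A^T *m x) a (consv (s, y)).
Proof.
apply/funext => x; rewrite /phase /ay dotv_consv addrA -mulrDr; congr (_ * _ + _).
by rewrite [dotv z _]big_ord0 addr0 [in RHS](consvP (A^T *m x)) dotv_consv.
Qed.

Lemma integral_gauss_amplify_le k (Psi : 'cV[R]_d -> 'cV[R]_k) c' (f : 'cV[R]_d -> R) :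
  measT f ->
  (forall x, f x != 0 -> dotv (Psi x - c') (Psi x - c') <= r ^+ 2) ->
  (\int[leb]_x (gauss_amplify Psi f c' r x ^+ 2)%:E <= (expR pi ^+ 2)%:E * \int[leb]_x (f x ^+ 2)%:E)%E.
Proof.
move=> mf hs; rewrite -ge0_integralZl//; last 2 first.
- by apply/measurable_EFinP; exact: measurable_funX.
- by move=> x _; rewrite lee_fin sqr_ge0.
apply: ge0_le_integralW => x _; first by rewrite lee_fin sqr_ge0.
rewrite -EFinM lee_fin -exprMn -(real_normK (num_real (gauss_amplify _ _ _ _ _))) -[leRHS]real_normK ?num_real//.
rewrite lerXn2r ?nnegrE// [leRHS]normrM (ger0_norm (expR_ge0 _)).
exact: gauss_amplify_le.
Qed.

(* Bernstein in the frozen coordinate, then Plancherel in all coordinates. *)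
Lemma slab_le : (slab a g <= (r * expR pi ^+ 2)%:E * \int[leb]_x (g x ^+ 2)%:E)%E.
Proof.
have mgt := integrable_measurable igt.
have step y : ((osc_sqr (phase slice a y) g)%:E <=
    r%:E * \int[lebesgue_measure]_(s in (setT : set T1)) (osc_sqr (phase (fun x => (A^T *m x)%R) a (consv (s, y))) gt)%:E)%E.
  have -> : phase slice a y = phase Phi1 (ay y) 0.
    apply/funext => x; rewrite /phase /ay (_ : dotv 0 (Phi1 x) = 0) ?mulr0 ?add0r//.
    by rewrite /dotv big1// => i _; rewrite mxE mul0r.
  apply: le_trans (bernstein mPhi1 (may y) ig r0 supp 0) _.
  rewrite expr1; apply: lee_wpmul2l; first by rewrite lee_fin ltW.
  rewrite ge0_integral_consv; first last.
  - by move=> x; rewrite lee_fin osc_sqr_ge0.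
  - by apply/measurable_EFinP; apply: measurable_osc_sqr_phase.
  apply: ge0_le_integralW => s _.
    by apply: integral_ge0 => z _; rewrite lee_fin osc_sqr_ge0.
  under eq_integral do rewrite phase1E.
  by rewrite integral_cst//= diracT mule1.
pose f (z : T1 * 'cV[R]_n) := (osc_sqr (phase (fun x => A^T *m x) a (consv z)) gt)%:E.
have mf : measT f.
  apply: (measurableT_comp (f := fun z : 'cV[R]_d => (osc_sqr (phase (fun x => A^T *m x) a z) gt)%:E)); last exact: measurable_consv.
  apply/measurable_EFinP; apply: measurable_osc_sqr_phase => //.
  exact: measurable_mulmxv.
have f0 z : (0 <= f z)%E by rewrite lee_fin osc_sqr_ge0.
apply: (@le_trans _ _ (\int[lebesgue_cV]_y (r%:E * \int[lebesgue_measure]_(s in (setT : set T1)) f (s, y)))%E).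
  by apply: ge0_le_integralW => y _; [rewrite lee_fin osc_sqr_ge0|exact: step].
rewrite ge0_integralZl//; last 3 first.
- exact: (measurable_fun_fubini_tonelli_G (m1 := @lebesgue_measure R)).
- by move=> y _; exact: integral_ge0.
- by rewrite lee_fin ltW.
rewrite EFinM -muleA; apply: lee_wpmul2l; first by rewrite lee_fin ltW.
rewrite -(fubini_tonelli (m1 := @lebesgue_measure R) (m2 := @lebesgue_cV R n))//.
apply: le_trans (integral_gauss_amplify_le _ _); last 2 first.
- exact: (integrable_measurable ig).
- exact: supp.
have ones_gt0 : posv (const_mx 1 : 'cV[R]_d) by move=> i; rewrite mxE.
have := osc_sqr_expansive (measurable_mulmxv A^T (@measurable_id _ _ setT)) ma igt ones_gt0 ltr01 measurableT.
rewrite big1 ?mul1e; last by move=> i _; rewrite mxE mulr1 sqrtr1 invr1.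
rewrite ge0_integral_consv; first last.
- by move=> x; rewrite lee_fin osc_sqr_ge0.
- apply/measurable_EFinP; apply: measurable_osc_sqr_phase => //.
  exact: measurable_mulmxv.
apply=> [x /(_ I)//|x y _ _].
rewrite mul1r -mulmxBr -(dotv_orthogonal _ _ oA) le_eqVlt; apply/orP; left; apply/eqP.
by apply: eq_bigr => i _; rewrite [const_mx 1 _ _]mxE invr1 mul1r expr2.
Qed.

End bounded_frequencies.
End slabs.

Section mixed_norms.
Context d (T : measurableType d) (R : realType) (mu : {measure set T -> \bar R}).

Lemma Lnorm_infty_le (f : T -> \bar R) (B : \bar R) :
  (0 <= B)%E -> (forall x, `|f x| <= B)%E -> (Lnorm mu +oo%E f <= B)%E.
Proof.
move=> B0 fB; rewrite unlock; case: ifP => // _.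
by apply/ess_sup_inf.ess_supP/aeW.
Qed.

(** Measurability is asked of the majorant [S] only; [F] will be an inner norm depending on the
    time. *)
Lemma Lnorm2_patch_le (I : set T) (F S : T -> \bar R) (k : R) (B : \bar R) :
  measurable I -> measurable_fun I S -> 0 <= k ->
  (forall t, 0 <= F t)%E -> (forall t, 0 <= S t)%E ->
  (forall t, F t * F t <= k%:E * S t)%E -> (\int[mu]_(t in I) S t <= B)%E ->
  (Lnorm mu 2%:E (F \_ I) <= (k%:E * B) `^ 2^-1)%E.
Proof.
move=> mI mS k0 F0 S0 FS SB; rewrite unlock.
have B0 : (0 <= B)%E by apply: le_trans SB; apply: integral_ge0 => t _; exact: S0.
have E : (\int[mu]_x (`|(F \_ I) x| `^ 2) <= k%:E * B)%E.
  apply: (@le_trans _ _ (\int[mu]_(x in I) (k%:E * S x))%E).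
    rewrite [leRHS]integral_mkcond; apply: ge0_le_integralW => x _; first exact: poweR_ge0.
    rewrite !patchE; case: ifP => _; last by rewrite abse0 poweR0r.
    apply: le_trans (FS x); rewrite gee0_abs//; have := F0 x; case: (F x) => [r| |]// r0.
      by rewrite lee_fin powR_mulrn.
    by rewrite mulyy leey.
  rewrite ge0_integralZl//; first by apply: lee_wpmul2l.
apply: gt0_ler_poweR => //.
- by rewrite in_itv/= leey andbT integral_ge0// => x _; exact: poweR_ge0.
- by rewrite in_itv/= leey andbT mule_ge0.
Qed.

End mixed_norms.

Lemma poweR_half_sqr (R : realType) (k : R) (x : \bar R) : 0 <= k -> (0 <= x)%E ->
  ((k%:E * (x * x)) `^ 2^-1 = (Num.sqrt k)%:E * x)%E.
Proof.
move=> k0 x0; rewrite poweRM//; last by rewrite mule_ge0.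
rewrite poweR_EFin powR12_sqrt//; congr (_ * _)%E.
case: x x0 => [r| |]// r0; last by rewrite mulyy poweRyr// invr_neq0.
by rewrite lee_fin in r0; rewrite -EFinM poweR_EFin powR12_sqrt ?mulr_ge0// -expr2 sqrtr_sqr ger0_norm.
Qed.

(** * From L^2 smoothing to the mixed norm at fixed x1 *)

Section directional_estimate.
Context (R : realType) (n : nat).
Notation d := n.+1.
Notation leb := (@lebesgue_cV R d).
Notation T1 := (measurableTypeR R).
Variables (A : 'M[R]_d) (m : 'cV[R]_d -> R) (G0 : 'cV[R]_d -> R[i]).
Variables (D : set 'cV[R]_d) (c : 'cV[R]_d) (rho L : R) (I : set T1) (p : \bar R) (x1 : R).
Hypothesis oA : orthogonal_mx A.
Hypothesis mm : measT m.
Hypothesis G02 : L2 leb G0.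
Hypothesis mD : measurable D.
Hypothesis Dball : D `<=` eball c rho.
Hypothesis rho0 : 0 < rho.
Hypothesis G0D : {ae leb, forall xi, ~ D xi -> G0 xi = 0}.
Hypothesis mI : measurable I.
Hypothesis L0 : 0 <= L.
Hypothesis p2 : (2%:E <= p)%E.
Hypothesis smoothing : forall alpha g : 'cV[R]_d -> R, measT alpha ->
  intT leb g -> (forall x, ~ D x -> g x = 0) ->
  (\int[lebesgue_measure]_(t in I) slab A (fun x => (alpha x - t * m x)%R) g <=
    L%:E * \int[leb]_x (g x ^+ 2)%:E)%E.

Let G := restrict D G0.
Let al (x : 'cV[R]_d) := 2 * pi * (x1 * (A^T *m x) ord0 0).
Let a t (x : 'cV[R]_d) := al x - t * m x.

Let mal : measT al.
Proof.
by apply: measurable_funM => //; apply: measurable_funM => //; exact: measurable_lead.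
Qed.

Let ma t : measT (a t).
Proof. by apply: measurable_funB => //; exact: measurable_funM. Qed.

Let mG0r : measT (rpart G0). Proof. by have [] := L2_measurable G02. Qed.
Let mG0i : measT (ipart G0). Proof. by have [] := L2_measurable G02. Qed.
Let mGr : measT (rpart G). Proof. by have [] := measurable_restrict mD mG0r mG0i. Qed.
Let mGi : measT (ipart G). Proof. by have [] := measurable_restrict mD mG0r mG0i. Qed.

Let restr_int (f : 'cV[R]_d -> R) : measT f ->
  (forall x, f x ^+ 2 <= sqrn (G0 x)) ->
  intT leb (fun x => \1_D x * f x).
Proof.
move=> mf fG; apply: (@integrable_bounded_support _ _ _ _ c rho) => //.
- by move=> x; rewrite indicE ger0_norm//; case: (x \in D).
- by move=> x nb; rewrite indicE memNset ?mul0r// => /Dball.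
- exact: (L2_part_lt G02).
Qed.

Let iGr : intT leb (rpart G).
Proof.
have -> : rpart G = (fun x => \1_D x * rpart G0 x).
  by apply/funext => x; rewrite /rpart /G /restrict indicE; case: (x \in D); rewrite ?mul1r ?mul0r.
by apply: restr_int => // x; rewrite lerDl sqr_ge0.
Qed.

Let iGi : intT leb (ipart G).
Proof.
have -> : ipart G = (fun x => \1_D x * ipart G0 x).
  by apply/funext => x; rewrite /ipart /G /restrict indicE; case: (x \in D); rewrite ?mul1r ?mul0r.
by apply: restr_int => // x; rewrite lerDr sqr_ge0.
Qed.

Let GrD x : ~ D x -> rpart G x = 0. Proof. by move=> /restrict_out h; rewrite /rpart /G h. Qed.
Let GiD x : ~ D x -> ipart G x = 0. Proof. by move=> /restrict_out h; rewrite /ipart /G h. Qed.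

(** The evolution at time [t], on the hyperplane where the first rotated coordinate is [x1]. *)
Let v t x' := cintegral leb setT
  (fun xi => cis (2 * pi * dotv (A *m consv (x1, x')) xi) * (cis (- t * m xi) * G0 xi)).

Let W t x' := 2 * (osc_sqr (phase (slice A) (a t) x') (rpart G) + osc_sqr (phase (slice A) (a t) x') (ipart G)).

Let mphase t x' : measT (phase (slice A) (a t) x').
Proof. by apply: measurable_phaser => //; exact: measurable_slice. Qed.

Let vW t x' : sqrn (v t x') <= W t x'.
Proof.
have -> : v t x' = cintegral leb setT (fun xi => cis (phase (slice A) (a t) x' xi) * G xi).
  rewrite -(cis_integral_ae (mphase t x') mG0r mG0i mGr mGi (restrict_ae G0D)).
  apply: eq_cintegral => xi; rewrite mulrA cisM; congr (cis _ * _).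
  rewrite dotv_mulmx (consvP (A^T *m xi)) dotv_consv /phase /a /al /slice.
  rewrite -/(tailv _); ring.
exact: sqrn_cis_integral.
Qed.

Let gsupp (g : 'cV[R]_d -> R) : (forall x, ~ D x -> g x = 0) ->
  forall x, g x != 0 -> dotv (slice A x - slice A c) (slice A x - slice A c) <= rho ^+ 2.
Proof.
move=> gD x gx; have xD : D x by apply: contrapT => /gD e; rewrite e eqxx in gx.
have h : dotv (A^T *m (x - c)) (A^T *m (x - c)) <= rho ^+ 2.
  by rewrite (dotv_orthogonal _ _ oA) -enorm_le_sqr ?(ltW rho0)//; exact: Dball.
apply: le_trans h; rewrite (consvP (A^T *m (x - c))) dotv_consv.
have -> : slice A x - slice A c = tailv (A^T *m (x - c)).
  by rewrite mulmxBr; apply/colP => i; rewrite /slice !mxE.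
by rewrite -/(tailv _) lerDr -expr2 sqr_ge0.
Qed.

Let amp (g : 'cV[R]_d -> R) := gauss_amplify (slice A) g (slice A c) rho.

Let ampD g : (forall x, ~ D x -> g x = 0) -> forall x, ~ D x -> amp g x = 0.
Proof. by move=> gD x /gD e; rewrite /amp /gauss_amplify e mul0r. Qed.

Let iamp g : intT leb g -> (forall x, ~ D x -> g x = 0) ->
  intT leb (amp g).
Proof.
by move=> ig gD; apply: integrable_gauss_amplify => //; [exact: measurable_slice|exact: gsupp].
Qed.

(** One quantity for both endpoints of the interpolation: the first term bounds the L^2 norm, the
    second, with the amplified function, the sup norm. *)
Let S0 t g := (slab A (a t) g + slab A (a t) (amp g))%E.

Let slab_ge0 t g : (0 <= slab A (a t) g)%E.
Proof. by apply: integral_ge0 => y _; rewrite lee_fin osc_sqr_ge0. Qed.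

Let S0_ge0 t g : (0 <= S0 t g)%E. Proof. by rewrite adde_ge0. Qed.

Let S t := (2%:E * (S0 t (rpart G) + S0 t (ipart G)))%E.

Let S_ge0 t : (0 <= S t)%E. Proof. by rewrite mule_ge0// adde_ge0. Qed.

Let mslab g : intT leb g -> measurable_fun I (fun t : T1 => slab A (a t) g).
Proof. by move=> ig; apply: measurable_funTS; exact: measurable_slab. Qed.

Let mS0 g : intT leb g -> (forall x, ~ D x -> g x = 0) ->
  measurable_fun I (fun t : T1 => S0 t g).
Proof. by move=> ig gD; apply: emeasurable_funD; apply: mslab => //; exact: iamp. Qed.

Let mS : measurable_fun I (fun t : T1 => S t).
Proof. by apply: emeasurable_funM => //; apply: emeasurable_funD; exact: mS0. Qed.

Let S0_int g : intT leb g -> (forall x, ~ D x -> g x = 0) ->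
  (\int[lebesgue_measure]_(t in I) S0 t g <=
    (L * (1 + expR pi ^+ 2))%:E * \int[leb]_x (g x ^+ 2)%:E)%E.
Proof.
move=> ig gD; rewrite ge0_integralD//; last 2 first.
- exact: mslab.
- by apply: mslab; exact: iamp.
rewrite mulrDr mulr1 EFinD ge0_muleDl ?lee_fin ?mulr_ge0 ?sqr_ge0//.
apply: leeD; first exact: smoothing.
apply: le_trans (smoothing mal (iamp ig gD) (ampD gD)) _.
rewrite EFinM -muleA; apply: lee_wpmul2l; first by rewrite lee_fin.
by apply: integral_gauss_amplify_le => //; [exact: (integrable_measurable ig)|exact: gsupp].
Qed.

Let S_int : (\int[lebesgue_measure]_(t in I) S t <=
    (2 * (L * (1 + expR pi ^+ 2)))%:E * \int[leb]_x (sqrn (G0 x))%:E)%E.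
Proof.
rewrite ge0_integralZl//; last 2 first.
- by apply: emeasurable_funD; exact: mS0.
- by move=> t _; rewrite adde_ge0.
rewrite [in leRHS]EFinM -muleA; apply: lee_wpmul2l => //.
rewrite ge0_integralD//; [|exact: mS0|exact: mS0].
apply: le_trans (leeD (S0_int iGr GrD) (S0_int iGi GiD)) _.
have sq0 (f : 'cV[R]_d -> R) : (0 <= \int[leb]_x (f x ^+ 2)%:E)%E.
  by apply: integral_ge0 => x _; rewrite lee_fin sqr_ge0.
rewrite -ge0_muleDr//; apply: lee_wpmul2l.
  by rewrite lee_fin mulr_ge0// addr_ge0 ?sqr_ge0.
rewrite -ge0_integralD//; try by move=> x _; rewrite lee_fin sqr_ge0.
- apply: ge0_le_integralW => x _; first by rewrite adde_ge0// lee_fin sqr_ge0.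
  by rewrite -EFinD lee_fin; exact: sqrn_restrict_le.
- by apply/measurable_EFinP; exact: measurable_funX.
- by apply/measurable_EFinP; exact: measurable_funX.
Qed.

Let K := (rho ^+ n) `^ (2^-1 - fine (p^-1)%E).

Let K_gt0 : 0 < K. Proof. by rewrite powR_gt0// exprn_gt0. Qed.

Let mW t : measT (W t).
Proof.
apply: measurable_funM => //; apply: measurable_funD; apply: measurable_osc_sqr_phase => //;
  exact: measurable_slice.
Qed.

Let W_int t : (\int[lebesgue_cV]_x' (W t x')%:E <= S t)%E.
Proof.
have mo g : measT g -> measT (fun x' : 'cV[R]_n => (osc_sqr (phase (slice A) (a t) x') g)%:E).
  move=> mg; apply/measurable_EFinP; apply: measurable_osc_sqr_phase => //; exact: measurable_slice.
under eq_integral do rewrite EFinM.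
rewrite ge0_integralZl//; last 2 first.
- by under eq_fun do rewrite EFinD; apply: emeasurable_funD; exact: mo.
- by move=> y _; rewrite lee_fin addr_ge0 ?osc_sqr_ge0.
apply: lee_wpmul2l => //; under eq_integral do rewrite EFinD.
rewrite ge0_integralD//; [|by move=> y _; rewrite lee_fin osc_sqr_ge0|exact: mo|by move=> y _; rewrite lee_fin osc_sqr_ge0|exact: mo].
by apply: leeD; rewrite leeDl.
Qed.

Let W_le t x' : ((W t x')%:E <= (rho ^+ n)%:E * S t)%E.
Proof.
have bern g : intT leb g -> (forall x, ~ D x -> g x = 0) ->
    ((osc_sqr (phase (slice A) (a t) x') g)%:E <= (rho ^+ n)%:E * S0 t g)%E.
  move=> ig gD; apply: le_trans (bernstein (measurable_slice A) (ma t) ig rho0 (gsupp gD) x') _.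
  apply: lee_wpmul2l; first by rewrite lee_fin exprn_ge0// ltW.
  by rewrite leeDr.
rewrite /W /S EFinM muleCA; apply: lee_wpmul2l => //.
rewrite EFinD ge0_muleDr//; apply: leeD; exact: bern.
Qed.

Let inner t : (cLnorm lebesgue_cV p (v t) * cLnorm lebesgue_cV p (v t) <= (K ^+ 2)%:E * S t)%E.
Proof.
have n0 : (0 <= cLnorm lebesgue_cV p (v t))%E by exact: Lnorm_ge0.
(* [S t] is known to be finite for almost every time only; where it is infinite the bound is trivial
   because [K] is positive. *)
have := W_le t; have := W_int t; have := S_ge0 t; case: (S t) => [s| |]//; last first.
  by move=> _ _ _; rewrite gt0_muley ?leey// lte_fin exprn_gt0.
rewrite lee_fin => s0 Wi Wl.
have rn0 : 0 <= rho ^+ n by rewrite exprn_ge0// ltW.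
have h := cLnorm_interpolation p2 rn0 s0 (mW t) (vW t) (fun x => Wl x) Wi.
apply: le_trans (lee_pmul n0 n0 h h) _.
by rewrite -!EFinM lee_fin -/K mulrACA -!expr2 sqr_sqrtr.
Qed.

Lemma directional_estimate :
  (Lnorm lebesgue_measure 2%:E ((fun t : T1 => cLnorm lebesgue_cV p (v t)) \_ I) <=
   ((K ^+ 2)%:E * ((2 * (L * (1 + expR pi ^+ 2)))%:E * \int[leb]_x (sqrn (G0 x))%:E)) `^ 2^-1)%E.
Proof.
have F0 t : (0 <= cLnorm lebesgue_cV p (v t))%E by exact: Lnorm_ge0.
exact: (@Lnorm2_patch_le _ T1 R lebesgue_measure I _ _ (K ^+ 2) _ mI mS (sqr_ge0 K) F0 S_ge0 inner S_int).
Qed.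

End directional_estimate.

(** * Estimates for one sector *)

Section sector_estimates.
Context (R : realType) (n : nat).
Notation d := n.+1.
Notation leb := (@lebesgue_cV R d).
Notation T1 := (measurableTypeR R).
Variables (sigma C_L C_max : R) (m : 'cV[R]_d -> R).
Hypothesis sigma2 : 2 <= sigma < d%:R.
Hypothesis sm : symbol_of_order sigma C_L C_max m.
Variables (eps : R) (S : {fset 'cV[R]_d}) (chi : R -> R).
Hypothesis eps01 : 0 < eps <= 1.
Hypothesis net : direction_net eps S.
Hypothesis cut : cutoff eps chi.
Hypothesis epsk : eps <= (20 * d%:R ^+ 3 * 2 ^+ d)^-1 * C_L ^- 2.
Variables (th : sector R d) (O : 'M[R]_d) (j : 'I_d).
Hypothesis thS : sector_family eps S th.
Hypothesis oO : orthogonal_mx O.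
Hypothesis good : good_directions m th O j.

Let N := sector_N th.
Let A := O *m tperm_mx ord0 j.

Definition sector_ball := if 1 < N then eball (sector_center th) (5 * eps * N)
  else eball (sector_center th) 4.

(* The two summands serve the frequencies [N >= 2 C_max] and [N < 2 C_max]. *)
Definition smoothing_const := C_L * (Num.sqrt (1024 * d%:R)^-1)^-1 ^+ d +
  10 * C_max * expR pi ^+ 2 * (2 * C_max) `^ (sigma - 1).

Let CL1 := symbol_C_L sm.
Let CM1 := symbol_C_max sm.

Lemma sector_N_ge1 : 1 <= N.
Proof.
have [[k Nk] _] := thS; rewrite /N Nk exprn_ege1// lerDl ltW//.
by have /andP[] := eps01.
Qed.

Lemma smoothing_const_ge0 : 0 <= smoothing_const.
Proof.
have h0 : 0 <= C_L by apply: le_trans CL1.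
have h1 : 0 <= C_max by apply: le_trans CM1.
have h2 : 0 <= (2 * C_max) `^ (sigma - 1) by exact: powR_ge0.
apply: addr_ge0; last by apply: mulr_ge0 => //; apply: mulr_ge0; [exact: mulr_ge0|exact: sqr_ge0].
have h3 (x : R) : 0 <= (Num.sqrt x)^-1 ^+ d by apply: exprn_ge0; rewrite invr_ge0 sqrtr_ge0.
exact: mulr_ge0 h0 (h3 _).
Qed.

Lemma sector_ball_sub : sector_ball `<=` eball (sector_center th) (5 * N).
Proof.
have N1 := sector_N_ge1; have /andP[eps0 eps1] := eps01.
rewrite /sector_ball; case: ifP => _ x /= h; apply: le_trans h _.
  by rewrite ler_wpM2r ?(le_trans ler01 N1)// ler_piMr.
by apply: (@le_trans _ _ (5 * 1)); [lra|rewrite ler_wpM2l].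
Qed.

Lemma measurable_sector_ball : measurable sector_ball.
Proof. by rewrite /sector_ball; case: ifP => _; exact: measurable_eball. Qed.

Lemma sector_smoothing (a b : R) (D : set 'cV[R]_d) (alpha g : 'cV[R]_d -> R) :
  b - a <= 1 -> measurable D -> D `<=` sector_ball -> measT alpha ->
  intT leb g -> (forall x, ~ D x -> g x = 0) ->
  (\int[lebesgue_measure]_(t in (`]a, b[%classic : set T1)) slab A (fun x => (alpha x - t * m x)%R) g <=
    (smoothing_const * N `^ (- (sigma - 1)))%:E * \int[leb]_x (g x ^+ 2)%:E)%E.
Proof.
move=> ab mD DB malpha ig gD.
have N1 := sector_N_ge1; have /andP[eps0 eps1] := eps01; have /andP[s2 sd] := sigma2.
have N0 : 0 < N by exact: lt_le_trans N1.
have CL0 : 0 < C_L by exact: lt_le_trans CL1.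
have CM0 : 0 < C_max by exact: lt_le_trans CM1.
have oA : orthogonal_mx A by exact: orthogonal_tperm.
have mm : measT m.
  by apply: continuous_measurable_cV; have [_] := symbol_smooth sm [::].
have g0 : (0 <= \int[leb]_x (g x ^+ 2)%:E)%E.
  by apply: integral_ge0 => x _; rewrite lee_fin sqr_ge0.
have d0 : 0 < d%:R :> R by [].
have c00 : 0 < (1024 * d%:R)^-1 :> R by rewrite invr_gt0; exact: mulr_gt0 (ltr0n R 1024) d0.
have P0 := powR_gt0 (sigma - 1) N0.
have slab0 t : (0 <= slab A (fun x => (alpha x - t * m x)%R) g)%E.
  by apply: integral_ge0 => y _; rewrite lee_fin osc_sqr_ge0.
have [hN|hN] := leP (2 * C_max) N.
- have N1' : 1 < N by have := CM1; lra.
  have [_ eS] := thS.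
  have cE : sector_center th = N *: sector_e th by rewrite /sector_center -/N N1'.
  have lam0 : 0 < C_L^-1 * N `^ (sigma - 1) by rewrite mulr_gt0 ?invr_gt0.
  have BE : sector_ball = eball (N *: sector_e th) (5 * eps * N) by rewrite /sector_ball N1' cE.
  have gd : (Num.sqrt d%:R)^-1 * enorm (grad m (N *: sector_e th)) <=
      `|(A^T *m grad m (N *: sector_e th)) ord0 0|.
    by rewrite coord0_tperm; move: good; rewrite /good_directions /= cE.
  have expand x y : D x -> D y -> (1024 * d%:R)^-1 * dotv (x - y) (x - y) <=
     (m x - m y) ^+ 2 / (2 * pi * (C_L^-1 * N `^ (sigma - 1))) ^+ 2 +
     dotv (tailv (A^T *m (x - y))) (tailv (A^T *m (x - y))).
    move=> /DB Dx /DB Dy; rewrite BE in Dx Dy.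
    exact: (symbol_expansive sm s2 (ltW sd) eps0 epsk hN (net_sphere net eS) oA gd Dx Dy).
  have := slab_smoothing mm malpha ig lam0 c00 mD gD expand.
  (* At high frequency the bound holds on the whole time axis, and the interval is simply
     enlarged. *)
  move=> h; apply: (@le_trans _ _ (\int[lebesgue_measure]_(t in (setT : set T1)) slab A (fun x => (alpha x - t * m x)%R) g)%E).
    by apply: ge0_subset_integral => //; exact: measurable_slab.
  apply: (le_trans h); apply: lee_wpmul2r => //; rewrite lee_fin invfM invrK powRN mulrAC.
  rewrite ler_wpM2r ?invr_ge0 ?(ltW P0)// lerDl.
  apply: mulr_ge0; last exact: powR_ge0.
  by apply: mulr_ge0; [apply: mulr_ge0 => //; exact: ltW|exact: sqr_ge0].
- have gB x : ~ eball (sector_center th) (5 * N) x -> g x = 0.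
    by move=> nx; apply: gD => /DB/sector_ball_sub.
  have N50 : 0 < 5 * N by rewrite mulr_gt0.
  have bnd t : (slab A (fun x => (alpha x - t * m x)%R) g <= (5 * N * expR pi ^+ 2)%:E * \int[leb]_x (g x ^+ 2)%:E)%E.
    apply: (slab_le oA _ ig N50 gB).
    by apply: measurable_funB => //; exact: measurable_funM.
  set Y := ((5 * N * expR pi ^+ 2)%:E * _)%E in bnd.
  have Y0 : (0 <= Y)%E by rewrite mule_ge0// lee_fin; apply: mulr_ge0; [exact: ltW|exact: sqr_ge0].
  apply: (@le_trans _ _ (\int[lebesgue_measure]_(t in (`]a, b[%classic : set T1)) Y)%E).
    by apply: ge0_le_integralW => t _.
  (* The length of the time interval enters here only. *)
  have mI1 : (lebesgue_measure (`]a, b[%classic : set R) <= 1%:E)%E.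
    by rewrite lebesgue_measure_itv/=; case: ifP => _ //.
  rewrite integral_cst//; apply: (@le_trans _ _ (Y * 1)%E).
    apply: lee_wpmul2l => //; exact: mI1.
  rewrite mule1; apply: lee_wpmul2r => //; rewrite lee_fin powRN ler_pdivlMr//.
  (* For [N < 2 C_max] the missing gain [N^(-(sigma - 1))] is paid for by the constant
     [(2 C_max)^(sigma - 1)]. *)
  apply: (@le_trans _ _ (10 * C_max * expR pi ^+ 2 * (2 * C_max) `^ (sigma - 1))); last first.
    have h3 (x : R) : 0 <= (Num.sqrt x)^-1 ^+ d by apply: exprn_ge0; rewrite invr_ge0 sqrtr_ge0.
    by rewrite lerDr; exact: mulr_ge0 (ltW CL0) (h3 _).
  apply: ler_pM; rewrite ?powR_ge0//.
  + by apply: mulr_ge0; [exact: ltW|exact: sqr_ge0].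
  + by rewrite ler_wpM2r ?sqr_ge0//; lra.
  + by rewrite ge0_ler_powR ?nnegrE ?(ltW N0) ?mulr_ge0 ?(ltW CM0) ?(ltW hN)//; lra.
Qed.

Variables (c : \bar R) (a b : R) (f : 'cV[R]_d -> R[i]).
Hypothesis c2 : (2%:E <= c)%E.
Hypothesis ab : b - a <= 1.

Let Pf := sector_proj eps S chi th f.

Let chiF xi : R[i] := (chi_sector eps S chi th xi)%:C * fourier f xi.

Let mchi : measT (fun xi : 'cV[R]_d => chi_sector eps S chi th xi).
Proof.
by apply: (measurable_chi_sector S eps01 cut); apply: le_trans sector_N_ge1.
Qed.

Let chi1 xi : `|chi_sector eps S chi th xi| <= 1.
Proof.
have [_ eS] := thS.
by apply: (normr_chi_sector_le1 eps01 cut) => //; apply: le_trans sector_N_ge1.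
Qed.

Let chi_out xi : ~ sector_ball xi -> chi_sector eps S chi th xi = 0.
Proof.
move=> nx; apply/eqP; apply: contrapT => /negP/(chi_sector_support eps01 cut thS).
by rewrite -/N => h; apply: nx; rewrite /sector_ball; move: h; case: ifP.
Qed.

Lemma chi_sector_out xi : ~ eball (sector_center th) (5 * N) xi -> chi_sector eps S chi th xi = 0.
Proof. by move=> nx; apply: chi_out => /sector_ball_sub. Qed.

Let fL2 : L2 leb (fourier f). Proof. exact: L2_fourier. Qed.

Lemma sector_proj_null : {ae leb, forall xi, chiF xi = 0} -> cLnorm leb 2%:E Pf = 0%E.
Proof. exact: (localized_null mchi chi1 chi_sector_out fL2). Qed.

Lemma sector_directional_estimate (c0 : 'cV[R]_d) (rho : R) : 0 < rho ->
  {ae leb, forall xi, ~ eball c0 rho xi -> chiF xi = 0} ->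
  (dir_norm +oo%E 2%:E c O j `]a, b[ (fun t => propagator m (- t) Pf) <=
   (Num.sqrt (8 * smoothing_const * (1 + expR pi ^+ 2)) *
    (N `^ (- ((sigma - 1) / 2)) * rho `^ (n%:R * (2^-1 - fine (c^-1)%E))))%:E * cLnorm leb 2%:E Pf)%E.
Proof.
move=> rho0 supp.
have N1 := sector_N_ge1; have N0 : 0 < N by exact: lt_le_trans N1.
(* The sector ball is where the phase expands, the other ball fixes the loss in Bernstein's
   inequality; the transform lives in both. *)
pose D := sector_ball `&` eball c0 rho.
have mD : measurable D by apply: measurableI; [exact: measurable_sector_ball|exact: measurable_eball].
pose G0 := fourier Pf.
have G02 : L2 leb G0 by exact: L2_fourier.
have Gsupp := localized_fourier_support mchi chi1 chi_sector_out fL2.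
have Gball : {ae leb, forall xi, ~ sector_ball xi -> G0 xi = 0}.
  have outE c' r : sector_ball = eball c' r -> {ae leb, forall xi, ~ sector_ball xi -> G0 xi = 0}.
    by move=> E; rewrite E; apply: Gsupp; apply: aeW => xi; rewrite -E => /chi_out ->; rewrite mul0r.
  by rewrite /sector_ball in outE *; case: ifP outE => _ outE; exact: outE.
have GD : {ae leb, forall xi, ~ D xi -> G0 xi = 0}.
  apply: filterS2 Gball (Gsupp _ _ supp) => xi h1 h2 nD.
  by have [hb|hb] := pselect (sector_ball xi); [apply: h2 => hc; apply: nD|exact: h1].
pose L := smoothing_const * N `^ (- (sigma - 1)).
have L0 : 0 <= L by rewrite mulr_ge0 ?powR_ge0 ?smoothing_const_ge0.
have mm : measT m.
  by apply: continuous_measurable_cV; have [_] := symbol_smooth sm [::].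
have h0 : (0 <= cLnorm leb 2%:E Pf)%E by exact: Lnorm_ge0.
apply: Lnorm_infty_le.
  by rewrite mule_ge0// lee_fin !mulr_ge0 ?sqrtr_ge0 ?powR_ge0.
move=> x1; rewrite gee0_abs ?Lnorm_ge0//.
have sub : D `<=` eball c0 rho by move=> x [].
have subB : D `<=` sector_ball by move=> x [].
have mI : measurable (`]a, b[%classic : set T1) by exact: measurable_itv.
have oA : orthogonal_mx A by exact: orthogonal_tperm.
have := directional_estimate x1 oA mm G02 mD sub rho0 GD mI L0 c2
  (fun al g mal ig gD => sector_smoothing ab mD subB mal ig gD).
move=> h; apply: (le_trans h).
have lef := localized_fourier_le mchi chi1 chi_sector_out fL2.
rewrite -(cLnorm2_sqr leb Pf) in lef.
set K := (rho ^+ n) `^ _.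
have K0 : 0 <= K by rewrite powR_ge0.
have e0 : 0 <= 1 + expR pi ^+ 2 :> R by rewrite addr_ge0// sqr_ge0.
have k2 : 0 <= 2 * (L * (1 + expR pi ^+ 2)) by exact: mulr_ge0 (ler0n R 2) (mulr_ge0 L0 e0).
have k4 : 0 <= K ^+ 2 * (2 * (L * (1 + expR pi ^+ 2)) * 4).
  exact: mulr_ge0 (sqr_ge0 K) (mulr_ge0 k2 (ler0n R 4)).
apply: (@le_trans _ _ (((K ^+ 2 * (2 * (L * (1 + expR pi ^+ 2)) * 4))%:E *
   (cLnorm leb 2%:E Pf * cLnorm leb 2%:E Pf)) `^ 2^-1)%E).
  have k0 : (0 <= (2 * (L * (1 + expR pi ^+ 2)))%:E)%E by rewrite lee_fin; exact: k2.
  have i0 : (0 <= \int[leb]_x (sqrn (G0 x))%:E)%E.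
    by apply: integral_ge0 => x _; rewrite lee_fin sqrn_ge0.
  apply: gt0_ler_poweR => //.
  - by rewrite in_itv/= leey andbT mule_ge0 ?lee_fin ?sqr_ge0// mule_ge0.
  - by rewrite in_itv/= leey andbT mule_ge0 ?mule_ge0// lee_fin; exact: k4.
  rewrite [in leRHS]EFinM -muleA; apply: lee_wpmul2l; first by rewrite lee_fin sqr_ge0.
  by rewrite [in leRHS]EFinM -muleA; apply: lee_wpmul2l.
rewrite (poweR_half_sqr k4 h0).
apply: lee_wpmul2r => //; rewrite lee_fin sqrtrM ?sqr_ge0// sqrtr_sqr (ger0_norm K0).
(* The 8 is 2, from splitting into real and imaginary parts, times 4, from the bound on the
   transform of [Pf]. *)
have -> : 2 * (L * (1 + expR pi ^+ 2)) * 4 =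
   8 * smoothing_const * (1 + expR pi ^+ 2) * N `^ (- (sigma - 1)).
  by rewrite /L; ring.
rewrite sqrtrM; last exact: mulr_ge0 (mulr_ge0 (ler0n R 8) smoothing_const_ge0) e0.
have -> : Num.sqrt (N `^ (- (sigma - 1))) = N `^ (- ((sigma - 1) / 2)).
  by rewrite -powR12_sqrt ?powR_ge0// -powRrM mulNr.
rewrite /K -powR_mulrn ?(ltW rho0)// -powRrM.
by rewrite mulrC mulrA.
Qed.

End sector_estimates.

Theorem proposition3p3 (R : realType) (n : nat) :
  exists2 k : R, 0 < k &
  forall (sigma C_L C_max : R) (m : 'cV[R]_n.+1 -> R),
  2 <= sigma < n.+1%:R ->
  symbol_of_order sigma C_L C_max m ->
  forall (eps : R) (S : {fset 'cV[R]_n.+1}) (chi : R -> R),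
  0 < eps <= 1 ->
  direction_net eps S ->
  cutoff eps chi ->
  eps <= k * C_L ^- 2 ->
  exists2 T0 : R, 0 < T0 &
  forall c : \bar R, (2%:E <= c)%E ->
  exists C : R,
  forall (a b : R) (th : sector R n.+1) (O : 'M[R]_n.+1) (j : 'I_n.+1)
    (f : 'cV[R]_n.+1 -> R[i]),
  b - a <= T0 ->
  sector_family eps S th ->
  orthogonal_mx O ->
  good_directions m th O j ->
  L2 lebesgue_cV f ->
  let N := sector_N th in
  let Pf := sector_proj eps S chi th f in
  let lhs := dir_norm +oo%E 2%:E c O j `]a, b[ (fun t => propagator m (- t) Pf) in
  let gamma := n%:R * (2^-1 - fine (c^-1)%E) in
  (lhs <= (C * N `^ (- ((sigma - 1) / 2) + gamma))%:E * cLnorm lebesgue_cV 2%:E Pf)%E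
  /\
  forall r : R, (ediam (ess_support (fourier f)) <= r%:E)%E ->
  (lhs <= (C * (N `^ (- ((sigma - 1) / 2)) * r `^ gamma))%:E
          * cLnorm lebesgue_cV 2%:E Pf)%E.
Proof.
exists (20 * n.+1%:R ^+ 3 * 2 ^+ n.+1)^-1.
  by rewrite invr_gt0 !mulr_gt0 ?exprn_gt0.
move=> sigma C_L C_max m sigma2 sm eps S chi eps01 net cut epsk.
exists 1 => // c c2.
pose C0 := Num.sqrt (8 * @smoothing_const R n sigma C_L C_max * (1 + expR pi ^+ 2)).
(* The first claim uses the radius [5 N] and picks up [5^gamma]; the summand 1 serves the second
   claim, where the radius is [r] itself. *)
exists (C0 * (1 + 5 `^ (n%:R * (2^-1 - fine (c^-1)%E)))).
move=> a b th O j f ab thS oO good _ N Pf lhs gamma.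
have C00 : 0 <= C0 by exact: sqrtr_ge0.
have est := sector_directional_estimate sigma2 sm eps01 net cut epsk thS oO good (f := f) c2 ab.
have N1 : 1 <= N := sector_N_ge1 eps01 thS.
have N0 : 0 < N by exact: lt_le_trans N1.
have h0 : (0 <= cLnorm lebesgue_cV 2%:E Pf)%E by exact: Lnorm_ge0.
have claim1 : (lhs <= (C0 * (1 + 5 `^ gamma) * N `^ (- ((sigma - 1) / 2) + gamma))%:E * cLnorm lebesgue_cV 2%:E Pf)%E.
  have N50 : 0 < 5 * N by rewrite mulr_gt0.
  apply: le_trans (est (sector_center th) _ N50 _) _.
    by apply: aeW => xi nx; rewrite (chi_sector_out eps01 cut thS) ?mul0r.
  apply: lee_wpmul2r => //; rewrite lee_fin -/C0 -/gamma -mulrA ler_wpM2l//.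
  rewrite powRM ?(ltW N0)// powRD ?(gt_eqF N0) ?implybT//.
  rewrite mulrCA ler_wpM2r ?mulr_ge0 ?powR_ge0//; last by rewrite lerDr.
split=> // r /ess_support_eball[r0 [c0 Fc0]].
(* With [r = 0] the transform of [f] vanishes off a null set, so [Pf] is null and the first claim
   already gives the second. *)
have [re|rn] := eqVneq r 0.
  have null0 : cLnorm lebesgue_cV 2%:E Pf = 0%E.
    apply: (sector_proj_null eps01 cut thS).
    have pt : {ae lebesgue_cV, forall xi, ~ eball c0 0 xi}.
      exists (eball c0 0); split; [exact: measurable_eball|exact: lebesgue_point|].
      by move=> xi /contrapT.
    by apply: filterS2 pt Fc0 => xi /= h1; rewrite re => /(_ h1) ->; rewrite mulr0.
  by move: claim1; rewrite null0 !mule0.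
have rp : 0 < r by rewrite lt_neqAle eq_sym rn.
apply: le_trans (est c0 _ rp _) _.
  by apply: filterS Fc0 => xi h /h ->; rewrite mulr0.
apply: lee_wpmul2r => //; rewrite lee_fin -/C0 -/gamma ler_wpM2r ?mulr_ge0 ?powR_ge0//.
by rewrite ler_peMr// lerDl powR_ge0.
Qed.
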